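(* Let $k$ be an algebraically closed field of characteristic zero and let $n\ge 2$. Let $P_{n,\tau}=\mathrm{PGL}_n\rtimes\langle\tau\rangle$, where $\tau$ has order two and acts on $\mathrm{PGL}_n$ by $\tau(h)=(h^{-1})^t$. The associated $P_{n,\tau}$-variety of a central simple algebra of degree $n$ with involution is unique up to birational isomorphism of $P_{n,\tau}$-varieties. That is, if $(A,\sigma)$ is a central simple algebra of degree $n$ with involution, and $X$ and $Y$ are irreducible $P_{n,\tau}$-varieties, generically free as $\mathrm{PGL}_n$-varieties, such that $(k_n(X),\sigma_{X,\tau})$ and $(k_n(Y),\sigma_{Y,\tau})$ are both isomorphic to $(A,\sigma)$ as algebras with involution, then there is a $P_{n,\tau}$-equivariant birational isomorphism $X\dashrightarrow Y$.
   Context: Conventions: A central simple algebra is a simple $k$-algebra that is finite-dimensional over its center, such that the center is a finitely generated field extension of $k$; it has degree $n$ if its dimension over its center is $n^2$. All algebra homomorphisms and involutions are $k$-linear; an involution is an anti-automorphism $\sigma$ with $\sigma^2=\mathrm{id}$. $a^t$ denotes the transpose of a matrix $a$, and for $h\in\mathrm{PGL}_n$, $h^t$ denotes the class of the transpose of a matrix representing $h$. $\mathrm{PGL}_n$ is identified with the subgroup $\mathrm{PGL}_n\times 1$ of $P_{n,\tau}$. ''In general position'' means in some dense open subset. A $G$-variety is generically free if points in general position have trivial stabilizer in $G$. For an irreducible, generically free $\mathrm{PGL}_n$-variety $X$, $k_n(X)$ denotes the set of $\mathrm{PGL}_n$-equivariant rational maps $X\dashrightarrow \mathrm{M}_n=\mathrm{M}_n(k)$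 ($\mathrm{PGL}_n$ acting on $\mathrm{M}_n$ by conjugation), with pointwise addition and multiplication; it is a central simple algebra of degree $n$ (known fact). If $X$ is an irreducible $P_{n,\tau}$-variety which is generically free as a $\mathrm{PGL}_n$-variety, $\sigma_{X,\tau}$ is the involution of $k_n(X)$ given by $\sigma_{X,\tau}(f)(x)=f(\tau x)^t$ for $x\in X$ in general position. An associated $P_{n,\tau}$-variety of $(A,\sigma)$ is an irreducible $P_{n,\tau}$-variety $X$, generically free as a $\mathrm{PGL}_n$-variety, with $(A,\sigma)\cong(k_n(X),\sigma_{X,\tau})$ as algebras with involution. *)

(* Defs.v *)
From HB Require Import structures.
From mathcomp Require Import all_boot all_order all_algebra.
From mathcomp Require Import all_classical.
From mathcomp Require Import topology_structure subtype_topology bool_topology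
  quotient_topology discrete_topology initial_topology.
From mathcomp Require Import -(notations) mpoly.
From mathcomp Require Import ring.

Set Implicit Arguments.
Unset Strict Implicit.
Unset Printing Implicit Defensive.

Import GRing.Theory.
Local Open Scope classical_set_scope.
Local Open Scope ring_scope.
Local Open Scope quotient_scope.

Lemma filterS4 (T : Type) (F : set_system T) {FF : Filter F}
    (P Q R S U : set T) : (forall x, P x -> Q x -> R x -> S x -> U x) ->
  F P -> F Q -> F R -> F S -> F U.
Proof.
move=> H FP FQ FR FS.
by apply: filterS3 (filterI FP FQ) FR FS => x [? ?]; exact: H.
Qed.

Lemma near_open (T : topologicalType) (x : T) (P : set T) :
  (\forall y \near x, P y) -> exists U, [/\ open U, U x & U `<=` P].
Proof.
move=> H; have : nbhs x P by exact: H.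
by rewrite nbhsE => -[U [oU Ux] sU]; exists U.
Qed.

(* A space with functions is a topological space with a sheaf of
   k-valued functions.  The sheaf is given through its germs: [regular_at x f]
   says that the germ of [f] at [x] belongs to the sheaf, and the sections over
   an open set U are the functions regular at every point of U.  Functions are
   total; their values away from [x] are irrelevant by [regular_at_eq]. *)
Record kspace (k : fieldType) := KSpace {
  kspace_sort :> topologicalType;
  regular_at : kspace_sort -> set (kspace_sort -> k);
  regular_at_near : forall x f, regular_at x f ->
    \forall y \near x, regular_at y f;
  regular_at_eq : forall x f g, regular_at x f ->
    (\forall y \near x, f y = g y) -> regular_at x g;
  regular_at_cst : forall x (c : k), regular_at x (fun=> c);
  regular_atD : forall x f g, regular_at x f -> regular_at x g ->
    regular_at x (fun y => f y + g y);
  regular_atM : forall x f g, regular_at x f -> regular_at x g ->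
    regular_at x (fun y => f y * g y);
  regular_at_neq0 : forall x f, regular_at x f -> f x != 0 ->
    \forall y \near x, f y != 0;
  regular_atV : forall x f, regular_at x f -> f x != 0 ->
    regular_at x (fun y => (f y)^-1)
}.
Arguments regular_at {k k0} x f : rename.

Section Morphisms.
Context {k : fieldType}.

Definition morphism_at (X Y : kspace k) (f : X -> Y) (x : X) :=
  {for x, continuous f} /\
  forall h : Y -> k, regular_at (f x) h -> regular_at x (fun y => h (f y)).

Definition morphism (X Y : kspace k) (f : X -> Y) :=
  forall x, morphism_at f x.

Definition kspace_iso (X Y : kspace k) :=
  exists (f : X -> Y) (g : Y -> X),
    [/\ morphism f, morphism g, cancel f g & cancel g f].

Lemma morphism_at_comp (X Y Z : kspace k) (f : X -> Y) (g : Y -> Z) x :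
  morphism_at f x -> morphism_at g (f x) -> morphism_at (fun y => g (f y)) x.
Proof.
move=> [cf rf] [cg rg]; split; last by move=> h /rg /rf.
exact: (@continuous_comp _ _ _ f g).
Qed.

Lemma regular_at_sum (X : kspace k) (x : X) (I : Type) (r : seq I)
    (F : I -> X -> k) : (forall i, regular_at x (F i)) ->
  regular_at x (fun y => \sum_(i <- r) F i y).
Proof.
move=> H; elim: r => [|i r IH].
  by apply: regular_at_eq (regular_at_cst x 0) _; apply: filterE => y; rewrite big_nil.
apply: regular_at_eq (regular_atD (H i) IH) _.
by apply: filterE => y; rewrite big_cons.
Qed.

Lemma regular_at_prod (X : kspace k) (x : X) (I : Type) (r : seq I)
    (F : I -> X -> k) : (forall i, regular_at x (F i)) ->
  regular_at x (fun y => \prod_(i <- r) F i y).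
Proof.
move=> H; elim: r => [|i r IH].
  by apply: regular_at_eq (regular_at_cst x 1) _; apply: filterE => y; rewrite big_nil.
apply: regular_at_eq (regular_atM (H i) IH) _.
by apply: filterE => y; rewrite big_cons.
Qed.

Lemma regular_atX (X : kspace k) (x : X) (f : X -> k) m : regular_at x f ->
  regular_at x (fun y => f y ^+ m).
Proof.
move=> H; elim: m => [|m IH].
  by apply: regular_at_eq (regular_at_cst x 1) _; apply: filterE => y; rewrite expr0.
by apply: regular_at_eq (regular_atM H IH) _; apply: filterE => y; rewrite exprS.
Qed.

End Morphisms.

Section AffineSpace.
Context {k : fieldType} {p q : nat}.

Definition affine_space : Type := 'M[k]_(p, q).
HB.instance Definition _ := Choice.on affine_space.

Definition polyfun (P : mpoly (p * q) k) (A : affine_space) : k :=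
  meval (fun i => mxvec A 0 i) P.

Definition zariski_base : set (set affine_space) :=
  [set [set A | polyfun P A != 0] | P in setT].

Lemma zariski_cover : \bigcup_(U in zariski_base) U = setT.
Proof.
rewrite predeqE => A; split=> // _; exists [set A | polyfun 1 A != 0].
  by exists 1.
by rewrite /= /polyfun meval1 oner_neq0.
Qed.

Lemma zariski_join (U V : set affine_space) A :
  zariski_base U -> zariski_base V -> U A -> V A ->
  exists W, [/\ zariski_base W, W A & W `<=` U `&` V].
Proof.
move=> [P _ <-] [Q _ <-] /= PA QA.
exists [set B | polyfun (P * Q) B != 0]; split.
- by exists (P * Q).
- by rewrite /= /polyfun mevalM mulf_neq0.
- by move=> B /=; rewrite /polyfun mevalM mulf_eq0 negb_or => /andP[].
Qed.

HB.instance Definition _ :=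
  isBaseTopological.Build affine_space zariski_cover zariski_join.

Lemma open_polyfun P : open [set A | polyfun P A != 0].
Proof.
exists [set [set A | polyfun P A != 0]]; first by move=> _ ->; exists P.
by rewrite bigcup_set1.
Qed.

Lemma near_polyfun P A : polyfun P A != 0 -> \forall B \near A, polyfun P B != 0.
Proof. by move=> PA; apply: (open_nbhs_nbhs (conj (open_polyfun P) PA)). Qed.

Lemma zariski_nbhs (A : affine_space) (U : set affine_space) : nbhs A U ->
  exists P, polyfun P A != 0 /\ [set B | polyfun P B != 0] `<=` U.
Proof.
rewrite nbhsE => -[V [[D sD <-] [W DW WA]] sVU].
have [P _ E] := sD _ DW; exists P; split; first by move: WA; rewrite -E.
by rewrite E => B WB; apply: sVU; exists W.
Qed.

Definition affine_regular_at (A : affine_space) (f : affine_space -> k) :=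
  exists P Q, polyfun Q A != 0 /\
    \forall B \near A, f B = polyfun P B / polyfun Q B.


Lemma affine_regular_at_near A f : affine_regular_at A f ->
  \forall B \near A, affine_regular_at B f.
Proof.
move=> [P [Q [/near_polyfun Q0 /near_join H]]].
by apply: filterS2 Q0 H => B QB HB; exists P, Q.
Qed.

Lemma affine_regular_at_eq A f g : affine_regular_at A f ->
  (\forall B \near A, f B = g B) -> affine_regular_at A g.
Proof.
move=> [P [Q [Q0 H]]] E; exists P, Q; split=> //.
by apply: filterS2 H E => B -> ->.
Qed.

Lemma affine_regular_at_cst A c : affine_regular_at A (fun=> c).
Proof.
exists (mpolyC _ c), 1; rewrite /polyfun meval1 oner_neq0; split=> //.
by apply: filterE => B; rewrite mevalC meval1 divr1.
Qed.

Lemma affine_regular_atD A f g : affine_regular_at A f ->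
  affine_regular_at A g -> affine_regular_at A (fun B => f B + g B).
Proof.
move=> [P [Q [Q0 H]]] [P' [Q' [Q'0 H']]].
exists (P * Q' + P' * Q), (Q * Q'); split.
  by rewrite /polyfun mevalM mulf_neq0.
have := near_polyfun Q0; have := near_polyfun Q'0.
apply: filterS4 H H' => B -> -> ? ?.
by rewrite /polyfun mevalD !mevalM addf_div.
Qed.

Lemma affine_regular_atM A f g : affine_regular_at A f ->
  affine_regular_at A g -> affine_regular_at A (fun B => f B * g B).
Proof.
move=> [P [Q [Q0 H]]] [P' [Q' [Q'0 H']]].
exists (P * P'), (Q * Q'); split.
  by rewrite /polyfun mevalM mulf_neq0.
apply: filterS2 H H' => B -> ->.
by rewrite /polyfun !mevalM mulf_div.
Qed.

Lemma affine_regular_at_num A f P Q :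
  (\forall B \near A, f B = polyfun P B / polyfun Q B) -> f A != 0 ->
  polyfun P A != 0.
Proof. by move=> /nbhs_singleton ->; rewrite mulf_eq0 => /norP[]. Qed.

Lemma affine_regular_at_neq0 A f : affine_regular_at A f -> f A != 0 ->
  \forall B \near A, f B != 0.
Proof.
move=> [P [Q [Q0 H]]] f0.
have := near_polyfun (affine_regular_at_num H f0); have := near_polyfun Q0.
by apply: filterS3 H => B -> ? ?; rewrite mulf_neq0 ?invr_eq0.
Qed.

Lemma affine_regular_atV A f : affine_regular_at A f -> f A != 0 ->
  affine_regular_at A (fun B => (f B)^-1).
Proof.
move=> [P [Q [Q0 H]]] f0; exists Q, P; split.
  exact: affine_regular_at_num H f0.
by apply: filterS H => B ->; rewrite invf_div.
Qed.

Definition affine_kspace : kspace k :=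
  KSpace affine_regular_at_near affine_regular_at_eq affine_regular_at_cst
    affine_regular_atD affine_regular_atM affine_regular_at_neq0
    affine_regular_atV.

Lemma regular_at_polyfun P (A : affine_kspace) : regular_at A (polyfun P).
Proof.
exists P, 1; rewrite /polyfun meval1 oner_neq0; split=> //.
by apply: filterE => B; rewrite meval1 divr1.
Qed.

Lemma regular_at_meval (X : kspace k) (x : X) (f : X -> affine_kspace) P :
  (forall i j, regular_at x (fun y => f y i j)) ->
  regular_at x (fun y => polyfun P (f y)).
Proof.
move=> H; apply: (@regular_at_eq _ _ _ (fun y => \sum_(m <- msupp P)
   mcoeff m P * \prod_i (mxvec (f y) 0 i) ^+ m i)); last first.
  by apply: filterE => y; rewrite /polyfun mevalE.
apply: regular_at_sum => m; apply: regular_atM; first exact: regular_at_cst.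
apply: regular_at_prod => i; apply: regular_atX.
case/mxvec_indexP: i => i j; apply: regular_at_eq (H i j) _.
by apply: filterE => y; rewrite mxvecE.
Qed.

Lemma morphism_at_affine (X : kspace k) (f : X -> affine_kspace) (x : X) :
  morphism_at f x <-> forall i j, regular_at x (fun y => f y i j).
Proof.
split=> [[_ H] i j|H].
  apply: (H (fun A => A i j)).
  have := regular_at_polyfun (mpolyX k (mnm1 (mxvec_index i j))) (f x).
  move=> /regular_at_eq; apply; apply: filterE => A.
  by rewrite /polyfun mevalXU mxvecE.
have cf : {for x, continuous f}.
  move=> U /zariski_nbhs [P [P0 PU]].
  have := regular_at_neq0 (regular_at_meval P H) P0.
  by apply: filterS => y /PU.
split=> // h [P [Q [Q0 E]]].
have r := regular_atM (regular_at_meval P H)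
  (regular_atV (regular_at_meval Q H) Q0).
have {}E : \forall y \near x,
  h (f y) = polyfun P (f y) / polyfun Q (f y) := cf _ E.
by apply: regular_at_eq r _; apply: filterS E => y ->.
Qed.

End AffineSpace.
Arguments affine_space : clear implicits.
Arguments affine_kspace : clear implicits.

Section Subspace.
Context {k : fieldType} (X : kspace k) (S : set X).

Definition sub_regular_at (a : S) (f : S -> k) :=
  exists g, regular_at (set_val a) g /\ \forall b \near a, f b = g (set_val b).

Lemma near_set_val (a : S) (P : X -> Prop) :
  (\forall y \near set_val a, P y) -> \forall b \near a, P (set_val b).
Proof. exact: initial_continuous. Qed.

Lemma sub_regular_at_near a f : sub_regular_at a f ->
  \forall b \near a, sub_regular_at b f.
Proof.
move=> [g [/regular_at_near/near_set_val rg /near_join E]].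
by apply: filterS2 rg E => b ? ?; exists g.
Qed.

Lemma sub_regular_at_eq a f g : sub_regular_at a f ->
  (\forall b \near a, f b = g b) -> sub_regular_at a g.
Proof.
move=> [h [rh E]] E'; exists h; split=> //.
by apply: filterS2 E E' => b -> ->.
Qed.

Lemma sub_regular_at_cst a c : sub_regular_at a (fun=> c).
Proof. by exists (fun=> c); split; [exact: regular_at_cst|exact: filterE]. Qed.

Lemma sub_regular_atD a f g : sub_regular_at a f ->
  sub_regular_at a g -> sub_regular_at a (fun b => f b + g b).
Proof.
move=> [f' [rf Ef]] [g' [rg Eg]]; exists (fun x => f' x + g' x).
by split; [exact: regular_atD|apply: filterS2 Ef Eg => b -> ->].
Qed.

Lemma sub_regular_atM a f g : sub_regular_at a f ->
  sub_regular_at a g -> sub_regular_at a (fun b => f b * g b).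
Proof.
move=> [f' [rf Ef]] [g' [rg Eg]]; exists (fun x => f' x * g' x).
by split; [exact: regular_atM|apply: filterS2 Ef Eg => b -> ->].
Qed.

Lemma sub_regular_at_neq0 a f : sub_regular_at a f -> f a != 0 ->
  \forall b \near a, f b != 0.
Proof.
move=> [g [rg E]]; rewrite (nbhs_singleton E) => g0.
have := near_set_val (regular_at_neq0 rg g0).
by apply: filterS2 E => b ->.
Qed.

Lemma sub_regular_atV a f : sub_regular_at a f -> f a != 0 ->
  sub_regular_at a (fun b => (f b)^-1).
Proof.
move=> [g [rg E]]; rewrite (nbhs_singleton E) => g0.
exists (fun x => (g x)^-1); split; first exact: regular_atV.
by apply: filterS E => b ->.
Qed.

Definition sub_kspace : kspace k :=
  KSpace sub_regular_at_near sub_regular_at_eq sub_regular_at_cst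
    sub_regular_atD sub_regular_atM sub_regular_at_neq0 sub_regular_atV.

End Subspace.

(* The final structure for the projection X -> Q: a function on an open subset
   of Q is regular when its pullback to X is. *)
Section QuotientSpace.
Context {k : fieldType} (X : kspace k) (Q : quotType X).
Local Notation T := (quotient_topology Q).

Definition quot_regular_at (q : T) (f : T -> k) :=
  exists U : set T, [/\ open U, U q &
    forall x : X, U (\pi_T x) -> regular_at x (fun y => f (\pi_T y))].

Lemma near_pi (x : X) (P : T -> Prop) :
  (\forall t \near \pi_T x, P t) -> \forall y \near x, P (\pi_T y).
Proof. exact: pi_continuous. Qed.

Lemma quot_regular_at_near q f : quot_regular_at q f ->
  \forall t \near q, quot_regular_at t f.
Proof.
move=> [U [oU Uq H]]; apply: filterS (open_nbhs_nbhs (conj oU Uq)) => t Ut.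
by exists U.
Qed.

Lemma quot_regular_at_eq q f g : quot_regular_at q f ->
  (\forall t \near q, f t = g t) -> quot_regular_at q g.
Proof.
move=> [U [oU Uq H]] /near_open[V [oV Vq sV]].
exists (U `&` V); split=> //; first exact: openI.
move=> x [/H rx Vx]; apply: regular_at_eq rx _.
apply: (@near_pi x (fun t => f t = g t)).
by have := open_nbhs_nbhs (conj oV Vx); apply: filterS => t /sV.
Qed.

Lemma quot_regular_at_cst q c : quot_regular_at q (fun=> c).
Proof.
by exists setT; split=> // [|x _]; [exact: openT|exact: regular_at_cst].
Qed.

Lemma quot_regular_atD q f g : quot_regular_at q f ->
  quot_regular_at q g -> quot_regular_at q (fun t => f t + g t).
Proof.
move=> [U [oU Uq HU]] [V [oV Vq HV]].
exists (U `&` V); split=> //; first exact: openI.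
by move=> x [/HU ? /HV ?]; exact: regular_atD.
Qed.

Lemma quot_regular_atM q f g : quot_regular_at q f ->
  quot_regular_at q g -> quot_regular_at q (fun t => f t * g t).
Proof.
move=> [U [oU Uq HU]] [V [oV Vq HV]].
exists (U `&` V); split=> //; first exact: openI.
by move=> x [/HU ? /HV ?]; exact: regular_atM.
Qed.

Lemma quot_open_neq0 (U : set T) (f : T -> k) : open U ->
  (forall x : X, U (\pi_T x) -> regular_at x (fun y => f (\pi_T y))) ->
  open (U `&` [set t | f t != 0]).
Proof.
move=> oU H; rewrite /open /= /quotient_open openE => x [Ux fx].
have oU' := near_pi (open_nbhs_nbhs (conj oU Ux)).
by apply: filterS2 oU' (regular_at_neq0 (H _ Ux) fx) => y.
Qed.

Lemma quot_regular_at_neq0 q f : quot_regular_at q f -> f q != 0 ->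
  \forall t \near q, f t != 0.
Proof.
move=> [U [oU Uq H]] fq.
by apply: filterS (open_nbhs_nbhs (conj (quot_open_neq0 oU H) _)) => // t [].
Qed.

Lemma quot_regular_atV q f : quot_regular_at q f -> f q != 0 ->
  quot_regular_at q (fun t => (f t)^-1).
Proof.
move=> [U [oU Uq H]] fq; exists (U `&` [set t | f t != 0]); split=> //.
  exact: quot_open_neq0.
by move=> x [/H rx fx]; exact: regular_atV.
Qed.

Definition quot_kspace : kspace k :=
  KSpace quot_regular_at_near quot_regular_at_eq quot_regular_at_cst
    quot_regular_atD quot_regular_atM quot_regular_at_neq0 quot_regular_atV.

End QuotientSpace.

Section BoolSpace.
Context (k : fieldType).
Definition bool_regular_at (b : bool) (f : bool -> k) := True.

Program Definition bool_kspace : kspace k :=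
  @KSpace k bool bool_regular_at _ _ _ _ _ _ _.
Next Obligation. by move=> b f _; exact: filterE. Qed.
Next Obligation. by []. Qed.
Next Obligation. by []. Qed.
Next Obligation. by []. Qed.
Next Obligation. by []. Qed.
Next Obligation. by move=> b f _ f0; apply: open_nbhs_nbhs; split=> //; exact: discrete_open. Qed.
Next Obligation. by []. Qed.
End BoolSpace.

Section ProductSpace.
Context {k : fieldType} (X Y : kspace k).

Definition prod_space : Type := (X * Y)%type.
HB.instance Definition _ := Choice.on prod_space.

Definition tensor_eval (s : seq ((X -> k) * (Y -> k))) (p : prod_space) : k :=
  \sum_(ab <- s) ab.1 p.1 * ab.2 p.2.

Definition tensor_regular_at (p : prod_space) (s : seq ((X -> k) * (Y -> k))) :=
  forall ab, ab \in s -> regular_at p.1 ab.1 /\ regular_at p.2 ab.2.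

Definition tensor_mul (s t : seq ((X -> k) * (Y -> k))) :
    seq ((X -> k) * (Y -> k)) :=
  [seq ((fun x => ab.1 x * cd.1 x), (fun y => ab.2 y * cd.2 y)) | ab <- s, cd <- t].

Lemma tensor_eval_cat s t p :
  tensor_eval (s ++ t) p = tensor_eval s p + tensor_eval t p.
Proof. by rewrite /tensor_eval big_cat. Qed.

Lemma tensor_eval_mul s t p :
  tensor_eval (tensor_mul s t) p = tensor_eval s p * tensor_eval t p.
Proof.
rewrite /tensor_eval /tensor_mul big_allpairs_dep /= big_distrlr /=.
by apply: eq_bigr => ab _; apply: eq_bigr => cd _; rewrite mulrACA.
Qed.

Lemma tensor_regular_at_cat p s t : tensor_regular_at p s ->
  tensor_regular_at p t -> tensor_regular_at p (s ++ t).
Proof. by move=> hs ht ab; rewrite mem_cat => /orP[/hs|/ht]. Qed.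

Lemma tensor_regular_at_mul p s t : tensor_regular_at p s ->
  tensor_regular_at p t -> tensor_regular_at p (tensor_mul s t).
Proof.
move=> hs ht _ /allpairsP[[ab cd] /= [/hs[? ?] /ht[? ?] ->]].
by split; exact: regular_atM.
Qed.

(* The open sets of X x Y are generated by the nonvanishing loci of the sums
   of products of regular functions on U x V, for U and V open; this is the
   Zariski product topology, finer than the product topology. *)
Definition prod_base : set (set prod_space) :=
  [set W | exists (U : set X) (V : set Y) s, [/\ open U, open V,
     (forall p, U p.1 -> V p.2 -> tensor_regular_at p s) &
     W = [set p | [/\ U p.1, V p.2 & tensor_eval s p != 0]]]].

Lemma prod_cover : \bigcup_(W in prod_base) W = setT.
Proof.
rewrite predeqE => p; split=> // _; exists setT => //.
exists setT, setT, [:: (fun=> 1, fun=> 1)]; split; try exact: openT.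
  by move=> q _ _ ab; rewrite inE => /eqP ->; split; exact: regular_at_cst.
by apply/esym; rewrite predeqE => q; split=> // _; split=> //;
  rewrite /tensor_eval big_seq1 mulr1 oner_neq0.
Qed.

Lemma prod_join (W W' : set prod_space) p :
  prod_base W -> prod_base W' -> W p -> W' p ->
  exists W'', [/\ prod_base W'', W'' p & W'' `<=` W `&` W'].
Proof.
move=> [U [V [s [oU oV hs ->]]]] [U' [V' [s' [oU' oV' hs' ->]]]] [? ? ?] [? ? ?].
eexists; split.
- exists (U `&` U'), (V `&` V'), (tensor_mul s s').
  split; [exact: openI|exact: openI| |reflexivity].
  by move=> q [? ?] [? ?]; apply: tensor_regular_at_mul; [exact: hs|exact: hs'].
- by split=> //; rewrite tensor_eval_mul mulf_neq0.
- by move=> q [[? ?] [? ?]]; rewrite tensor_eval_mul mulf_eq0 negb_or => /andP[].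
Qed.

HB.instance Definition _ :=
  isBaseTopological.Build prod_space prod_cover prod_join.

Lemma open_prod_base W : prod_base W -> open W.
Proof. by exists [set W]; [move=> _ ->|rewrite bigcup_set1]. Qed.

Lemma prod_nbhs (p : prod_space) (N : set prod_space) : nbhs p N ->
  exists W, [/\ prod_base W, W p & W `<=` N].
Proof.
rewrite nbhsE => -[O [[D sD <-] [W DW WA]] sON].
by exists W; split=> //; [exact: sD|move=> q Wq; apply: sON; exists W].
Qed.

Lemma near_prod (p : prod_space) (U : set X) (V : set Y) :
  nbhs p.1 U -> nbhs p.2 V -> \forall q \near p, U q.1 /\ V q.2.
Proof.
move=> /near_open[U' [oU' U'p sU]] /near_open[V' [oV' V'p sV]].
have oW : open [set p : prod_space | [/\ U' p.1, V' p.2 &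
    tensor_eval [:: (fun=> 1, fun=> 1)] p != 0]].
  apply: open_prod_base; exists U', V', [:: (fun=> 1, fun=> 1)]; split=> //.
  by move=> q _ _ ab; rewrite inE => /eqP ->; split; exact: regular_at_cst.
apply: filterS (open_nbhs_nbhs (conj oW _)) => /=.
  by move=> q [/sU ? /sV ?].
by split=> //; rewrite /tensor_eval big_seq1 mulr1 oner_neq0.
Qed.

Lemma tensor_regular_at_near p s : tensor_regular_at p s ->
  \forall q \near p, tensor_regular_at q s.
Proof.
elim: s => [|ab s IH] H; first by apply: filterE.
have [/regular_at_near h1 /regular_at_near h2] := H ab (mem_head _ _).
have {}IH : \forall q \near p, tensor_regular_at q s.
  by apply: IH => cd cds; apply: H; rewrite inE cds orbT.
apply: filterS2 IH (near_prod h1 h2) => q hs [? ?] cd.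
by rewrite inE => /orP[/eqP ->|/hs].
Qed.

Lemma tensor_near_neq0 p s : tensor_regular_at p s -> tensor_eval s p != 0 ->
  \forall q \near p, tensor_eval s q != 0.
Proof.
move=> H s0.
have [U [V [oU oV Up Vp HUV]]] : exists U V, [/\ open U, open V, U p.1, V p.2 &
    forall q, U q.1 -> V q.2 -> tensor_regular_at q s].
  elim: s H {s0} => [|ab s IH] H.
    by exists setT, setT; split=> //; exact: openT.
  have [|U [V [oU oV Up Vp HUV]]] := IH.
    by move=> cd cds; apply: H; rewrite inE cds orbT.
  have [/regular_at_near/near_open[U' [oU' U'p sU]]] := H ab (mem_head _ _).
  move=> /regular_at_near/near_open[V' [oV' V'p sV]].
  exists (U `&` U'), (V `&` V'); split=> //; try exact: openI.
  move=> q [Uq U'q] [Vq V'q] cd; rewrite inE => /orP[/eqP ->|].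
    by split; [exact: sU|exact: sV].
  exact: HUV.
have oW : open [set q : prod_space | [/\ U q.1, V q.2 & tensor_eval s q != 0]].
  by apply: open_prod_base; exists U, V, s.
have Wp : [/\ U p.1, V p.2 & tensor_eval s p != 0] by [].
by have := open_nbhs_nbhs (conj oW Wp); apply: filterS => q [].
Qed.

Definition prod_regular_at (p : prod_space) (f : prod_space -> k) :=
  exists s t, [/\ tensor_regular_at p s, tensor_regular_at p t,
    tensor_eval t p != 0 &
    \forall q \near p, f q = tensor_eval s q / tensor_eval t q].

Lemma prod_regular_at_near p f : prod_regular_at p f ->
  \forall q \near p, prod_regular_at q f.
Proof.
move=> [s [t [hs ht t0 /near_join E]]].
have := tensor_near_neq0 ht t0; have := tensor_regular_at_near ht.
have := tensor_regular_at_near hs.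
by apply: filterS4 E => q ? ? ? ?; exists s, t.
Qed.

Lemma prod_regular_at_eq p f g : prod_regular_at p f ->
  (\forall q \near p, f q = g q) -> prod_regular_at p g.
Proof.
move=> [s [t [hs ht t0 E]]] E'; exists s, t; split=> //.
by apply: filterS2 E E' => q -> ->.
Qed.

Lemma prod_regular_at_cst p c : prod_regular_at p (fun=> c).
Proof.
exists [:: (fun=> c, fun=> 1)], [:: (fun=> 1, fun=> 1)]; split.
- by move=> ab; rewrite inE => /eqP ->; split; exact: regular_at_cst.
- by move=> ab; rewrite inE => /eqP ->; split; exact: regular_at_cst.
- by rewrite /tensor_eval big_seq1 mulr1 oner_neq0.
- by apply: filterE => q; rewrite /tensor_eval !big_seq1 !mulr1 divr1.
Qed.

Lemma prod_regular_atD p f g : prod_regular_at p f ->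
  prod_regular_at p g -> prod_regular_at p (fun q => f q + g q).
Proof.
move=> [s [t [hs ht t0 E]]] [s' [t' [hs' ht' t0' E']]].
exists (tensor_mul s t' ++ tensor_mul s' t), (tensor_mul t t'); split.
- by apply: tensor_regular_at_cat; exact: tensor_regular_at_mul.
- exact: tensor_regular_at_mul.
- by rewrite tensor_eval_mul mulf_neq0.
have := tensor_near_neq0 ht t0; have := tensor_near_neq0 ht' t0'.
apply: filterS4 E E' => q -> -> ? ?.
by rewrite tensor_eval_cat !tensor_eval_mul addf_div.
Qed.

Lemma prod_regular_atM p f g : prod_regular_at p f ->
  prod_regular_at p g -> prod_regular_at p (fun q => f q * g q).
Proof.
move=> [s [t [hs ht t0 E]]] [s' [t' [hs' ht' t0' E']]].
exists (tensor_mul s s'), (tensor_mul t t'); split.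
- exact: tensor_regular_at_mul.
- exact: tensor_regular_at_mul.
- by rewrite tensor_eval_mul mulf_neq0.
by apply: filterS2 E E' => q -> ->; rewrite !tensor_eval_mul mulf_div.
Qed.

Lemma prod_regular_at_neq0 p f : prod_regular_at p f -> f p != 0 ->
  \forall q \near p, f q != 0.
Proof.
move=> [s [t [hs ht t0 E]]].
rewrite (nbhs_singleton E) mulf_eq0 => /norP[s0 _].
have := tensor_near_neq0 ht t0; have := tensor_near_neq0 hs s0.
by apply: filterS3 E => q -> ? ?; rewrite mulf_neq0 ?invr_eq0.
Qed.

Lemma prod_regular_atV p f : prod_regular_at p f -> f p != 0 ->
  prod_regular_at p (fun q => (f q)^-1).
Proof.
move=> [s [t [hs ht t0 E]]].
rewrite (nbhs_singleton E) mulf_eq0 => /norP[s0 _].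
by exists t, s; split=> //; apply: filterS E => q ->; rewrite invf_div.
Qed.

Definition prod_kspace : kspace k :=
  KSpace prod_regular_at_near prod_regular_at_eq prod_regular_at_cst
    prod_regular_atD prod_regular_atM prod_regular_at_neq0 prod_regular_atV.

Lemma morphism_pair (Z : kspace k) (f : Z -> X) (g : Z -> Y) (z : Z) :
  morphism_at f z -> morphism_at g z ->
  morphism_at (fun w => (f w, g w) : prod_kspace) z.
Proof.
move=> [cf rf] [cg rg].
have rs s : tensor_regular_at (f z, g z) s ->
    regular_at z (fun w => tensor_eval s (f w, g w)).
  elim: s => [|ab s IH] H.
    apply: regular_at_eq (regular_at_cst z 0) _.
    by apply: filterE => w; rewrite /tensor_eval big_nil.
  have [h1 h2] := H ab (mem_head _ _).
  have {}IH := IH (fun cd cds => H cd (@mem_behead _ (ab :: s) cd cds)).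
  apply: regular_at_eq (regular_atD (regular_atM (rf _ h1) (rg _ h2)) IH) _.
  by apply: filterE => w; rewrite /tensor_eval big_cons.
have c : {for z, continuous (fun w => (f w, g w) : prod_kspace)}.
  move=> N /prod_nbhs [_ [[U [V [s [oU oV hs ->]]]] [/= Uz Vz sz] sN]].
  have s0 := regular_at_neq0 (rs _ (hs (f z, g z) Uz Vz)) sz.
  have fU : \forall w \near z, U (f w) := cf _ (open_nbhs_nbhs (conj oU Uz)).
  have gV : \forall w \near z, V (g w) := cg _ (open_nbhs_nbhs (conj oV Vz)).
  by apply: filterS3 s0 fU gV => w sw Uw Vw; apply: sN.
split=> // h [s [t [hs ht t0 E]]].
have r := regular_atM (rs _ hs) (regular_atV (rs _ ht) t0).
have {}E : \forall w \near z, h (f w, g w) =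
  tensor_eval s (f w, g w) / tensor_eval t (f w, g w) := c _ E.
by apply: regular_at_eq r _; apply: filterS E => w ->.
Qed.

End ProductSpace.

(* A variety is a separated space with functions that is covered by finitely
   many open subspaces isomorphic to closed subspaces of affine spaces. *)
Section Varieties.
Context {k : fieldType}.

Definition affine_variety (X : kspace k) :=
  exists m (Z : set (affine_kspace k 1 m)),
    closed Z /\ kspace_iso X (sub_kspace Z).

Definition variety (X : kspace k) :=
  (exists N (U : 'I_N -> set X),
    [/\ forall i, open (U i), \bigcup_i U i = setT &
        forall i, affine_variety (sub_kspace (U i))]) /\
  closed [set p : prod_kspace X X | p.1 = p.2].

Definition irreducible_space (X : topologicalType) :=
  [set: X] !=set0 /\
  forall U V : set X, open U -> open V -> U !=set0 -> V !=set0 ->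
    U `&` V !=set0.

Definition generically (X : topologicalType) (P : X -> Prop) :=
  exists U : set X, [/\ open U, dense U & U `<=` P].

(* A rational map X --> Y is represented by a total function; its values
   outside a dense open set are irrelevant. *)
Definition rational (X Y : kspace k) (f : X -> Y) :=
  generically (fun x => morphism_at f x).

End Varieties.

Section Generically.
Context {X : topologicalType}.

Lemma genericallyW (P : X -> Prop) : (forall x, P x) -> generically P.
Proof.
move=> H; exists setT; split=> //; first exact: openT.
by move=> O [x Ox] _; exists x.
Qed.

Lemma generically2 (P Q R : X -> Prop) : (forall x, P x -> Q x -> R x) ->
  generically P -> generically Q -> generically R.
Proof.
move=> H [U [oU dU sU]] [V [oV dV sV]]; exists (U `&` V); split.
- exact: openI.
- exact: denseI.
- by move=> x [/sU ? /sV ?]; exact: H.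
Qed.

Lemma generically1 (P Q : X -> Prop) : (forall x, P x -> Q x) ->
  generically P -> generically Q.
Proof. by move=> H [U [oU dU sU]]; exists U; split=> // x /sU /H. Qed.

Lemma generically_preim (Y : topologicalType) (f : X -> Y) (g : Y -> X)
    (P : Y -> Prop) : continuous f -> continuous g -> cancel f g ->
  cancel g f -> generically P -> generically (fun x => P (f x)).
Proof.
move=> cf cg fK gK [U [oU dU sU]]; exists (f @^-1` U); split.
- by move/continuousP: cf; apply.
- move=> O [x Ox] oO.
  have oO' : open (g @^-1` O) by move/continuousP: cg; apply.
  have [|y [/= Oy Uy]] := dU (g @^-1` O) _ oO'.
    by exists (f x); rewrite /= fK.
  by exists (g y); split=> //=; rewrite gK.
- by move=> x /sU.
Qed.
End Generically.

Lemma invmxM (k : fieldType) n (A B : 'M[k]_n) : A \in unitmx ->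
  B \in unitmx -> invmx (A *m B) = invmx B *m invmx A.
Proof.
move=> uA uB; have uAB : A *m B \in unitmx by rewrite unitmx_mul uA.
have E : (A *m B) *m (invmx B *m invmx A) = 1%:M.
  by rewrite mulmxA mulmxK // mulmxV.
by rewrite -[RHS](mulKmx uAB) E mulmx1.
Qed.

Section ProjectiveLinearGroup.
Context (k : fieldType) (n : nat).

Definition GL_kspace : kspace k :=
  @sub_kspace k (affine_kspace k n n) [set g | (g : 'M[k]_n) \in unitmx].

Definition GL_mx (g : GL_kspace) : 'M[k]_n := set_val g.

Definition GL_of (A : 'M[k]_n) (uA : A \in unitmx) : GL_kspace :=
  exist _ (A : affine_kspace k n n) (mem_set uA).

Lemma GL_unit (g : GL_kspace) : GL_mx g \in unitmx.
Proof. by have := set_valP g. Qed.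

Definition proportional : rel GL_kspace := fun g h =>
  `[< exists c : k, c != 0 /\ GL_mx g = c *: GL_mx h >].

Lemma proportional_refl : reflexive proportional.
Proof. by move=> g; apply/asboolP; exists 1; rewrite oner_neq0 scale1r. Qed.

Lemma proportional_sym : ssrbool.symmetric proportional.
Proof.
by move=> g h; apply/asboolP/asboolP => -[c [c0 E]]; exists c^-1;
  rewrite E invr_eq0 c0 scalerA mulVf ?scale1r.
Qed.

Lemma proportional_trans : transitive proportional.
Proof.
move=> h g l /asboolP[c [c0 E]] /asboolP[d [d0 E']]; apply/asboolP.
by exists (c * d); rewrite E E' scalerA mulf_neq0.
Qed.

Canonical proportional_equiv :=
  EquivRel proportional proportional_refl proportional_sym proportional_trans.

Definition PGL_kspace : kspace k :=
  quot_kspace {eq_quot proportional}.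

Definition PGL : Type := PGL_kspace.
HB.instance Definition _ := Choice.on PGL.

Definition PGL_class (g : GL_kspace) : PGL := \pi_{eq_quot proportional} g.
Definition PGL_repr (h : PGL) : GL_kspace :=
  repr (h : {eq_quot proportional}).
Definition PGL_mx (h : PGL) : 'M[k]_n := GL_mx (PGL_repr h).

Lemma PGL_unit h : PGL_mx h \in unitmx.
Proof. exact: GL_unit. Qed.

Lemma PGL_mxP (h h' : PGL) :
  h = h' <-> exists c, c != 0 /\ PGL_mx h = c *: PGL_mx h'.
Proof.
split=> [->|[c [c0 E]]].
  by exists 1; rewrite oner_neq0 scale1r.
rewrite -[h](@reprK _ {eq_quot proportional}).
rewrite -[h'](@reprK _ {eq_quot proportional}).
by apply/eqmodP/asboolP; exists c.
Qed.

Lemma PGL_mx_class A (uA : A \in unitmx) :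
  exists c, c != 0 /\ PGL_mx (PGL_class (GL_of uA)) = c *: A.
Proof.
have : PGL_repr (PGL_class (GL_of uA)) = GL_of uA %[mod {eq_quot proportional}].
  by rewrite reprK.
by move=> /eqmodP/asboolP.
Qed.

Lemma PGL_mul_subproof (h h' : PGL) : PGL_mx h *m PGL_mx h' \in unitmx.
Proof. by rewrite unitmx_mul !PGL_unit. Qed.
Lemma PGL_inv_subproof (h : PGL) : invmx (PGL_mx h) \in unitmx.
Proof. by rewrite unitmx_inv PGL_unit. Qed.
Lemma PGL_tr_subproof (h : PGL) : (PGL_mx h)^T \in unitmx.
Proof. by rewrite unitmx_tr PGL_unit. Qed.

Definition PGL_one : PGL := PGL_class (GL_of (unitmx1 k n)).
Definition PGL_mul (h h' : PGL) : PGL :=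
  PGL_class (GL_of (PGL_mul_subproof h h')).
Definition PGL_inv (h : PGL) : PGL := PGL_class (GL_of (PGL_inv_subproof h)).
Definition PGL_tr (h : PGL) : PGL := PGL_class (GL_of (PGL_tr_subproof h)).

Lemma PGL_mulA : associative PGL_mul.
Proof.
move=> x y z; apply/PGL_mxP.
have [a [a0 ->]] := PGL_mx_class (PGL_mul_subproof x (PGL_mul y z)).
have [b [b0 ->]] := PGL_mx_class (PGL_mul_subproof y z).
have [c [c0 ->]] := PGL_mx_class (PGL_mul_subproof (PGL_mul x y) z).
have [d [d0 ->]] := PGL_mx_class (PGL_mul_subproof x y).
exists (a * b / (c * d)); rewrite !mulf_neq0 ?invr_eq0 ?mulf_neq0 //; split=> //.
rewrite -scalemxAr -scalemxAl mulmxA !scalerA; congr (_ *: _).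
by field; rewrite ?c0 ?d0.
Qed.

Lemma PGL_mul1 : left_id PGL_one PGL_mul.
Proof.
move=> x; apply/PGL_mxP.
have [a [a0 ->]] := PGL_mx_class (PGL_mul_subproof PGL_one x).
have [b [b0 ->]] := PGL_mx_class (unitmx1 k n).
by exists (a * b); rewrite mulf_neq0 // -scalemxAl mul1mx scalerA.
Qed.

Lemma PGL_mulr1 : right_id PGL_one PGL_mul.
Proof.
move=> x; apply/PGL_mxP.
have [a [a0 ->]] := PGL_mx_class (PGL_mul_subproof x PGL_one).
have [b [b0 ->]] := PGL_mx_class (unitmx1 k n).
by exists (a * b); rewrite mulf_neq0 // -scalemxAr mulmx1 scalerA.
Qed.

Lemma PGL_mulV : left_inverse PGL_one PGL_inv PGL_mul.
Proof.
move=> x; apply/PGL_mxP.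
have [a [a0 ->]] := PGL_mx_class (PGL_mul_subproof (PGL_inv x) x).
have [b [b0 ->]] := PGL_mx_class (PGL_inv_subproof x).
have [c [c0 ->]] := PGL_mx_class (unitmx1 k n).
exists (a * b / c); rewrite !mulf_neq0 ?invr_eq0 //; split=> //.
by rewrite -scalemxAl mulVmx ?PGL_unit // !scalerA mulfVK.
Qed.

Lemma PGL_mulrV : right_inverse PGL_one PGL_inv PGL_mul.
Proof.
move=> x; apply/PGL_mxP.
have [a [a0 ->]] := PGL_mx_class (PGL_mul_subproof x (PGL_inv x)).
have [b [b0 ->]] := PGL_mx_class (PGL_inv_subproof x).
have [c [c0 ->]] := PGL_mx_class (unitmx1 k n).
exists (a * b / c); rewrite !mulf_neq0 ?invr_eq0 //; split=> //.
by rewrite -scalemxAr mulmxV ?PGL_unit // !scalerA mulfVK.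
Qed.

HB.instance Definition _ :=
  isGroup.Build PGL PGL_mulA PGL_mul1 PGL_mulr1 PGL_mulV PGL_mulrV.

(* Independent of the representative of h, by [conj_scale]. *)
Definition PGL_conj (h : PGL) (M : 'M[k]_n) : 'M[k]_n :=
  PGL_mx h *m M *m invmx (PGL_mx h).

Lemma conj_scale (A : 'M[k]_n) c M : c != 0 -> A \in unitmx ->
  (c *: A) *m M *m invmx (c *: A) = A *m M *m invmx A.
Proof.
move=> c0 uA; rewrite invmxZ ?unitmxZ ?unitfE //.
by rewrite -!scalemxAl -scalemxAr scalerA divff ?scale1r.
Qed.

Definition PGL_tau (h : PGL) : PGL := PGL_tr (h^-1)%g.

Lemma PGL_tau_mx h : exists c, c != 0 /\ PGL_mx (PGL_tau h) =
  c *: invmx (PGL_mx h)^T.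
Proof.
have [a [a0 ->]] := PGL_mx_class (PGL_tr_subproof (h^-1)%g).
have [b [b0 ->]] := PGL_mx_class (PGL_inv_subproof h).
by exists (a * b); rewrite mulf_neq0 // linearZ /= scalerA trmx_inv.
Qed.

Lemma PGL_tauM h h' : PGL_tau (h * h')%g = (PGL_tau h * PGL_tau h')%g.
Proof.
apply/PGL_mxP.
have [a [a0 ->]] := PGL_tau_mx (h * h')%g.
have [b [b0 ->]] := PGL_mx_class (PGL_mul_subproof h h').
have [c [c0 ->]] := PGL_mx_class (PGL_mul_subproof (PGL_tau h) (PGL_tau h')).
have [d [d0 ->]] := PGL_tau_mx h.
have [e [e0 ->]] := PGL_tau_mx h'.
exists (a / b / (c * d * e)).
rewrite !mulf_neq0 ?invr_eq0 ?mulf_neq0 //; split=> //.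
rewrite -scalemxAl -scalemxAr !scalerA linearZ /= trmx_mul.
rewrite invmxZ ?unitmxZ ?unitfE //; last first.
  by rewrite unitmx_mul !unitmx_tr !PGL_unit.
rewrite scalerA invmxM ?unitmx_tr ?PGL_unit //.
by congr (_ *: _); field; rewrite ?b0 ?c0 ?d0 ?e0.
Qed.

Lemma PGL_tauK : involutive PGL_tau.
Proof.
move=> h; apply/PGL_mxP.
have [a [a0 ->]] := PGL_tau_mx (PGL_tau h).
have [b [b0 ->]] := PGL_tau_mx h.
exists (a / b); rewrite mulf_neq0 ?invr_eq0 //; split=> //.
rewrite linearZ /= invmxZ ?unitmxZ ?unitfE ?unitmx_tr ?unitmx_inv ?unitmx_tr ?PGL_unit //.
by rewrite scalerA trmx_inv trmxK invmxK.
Qed.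

Lemma tr_PGL_conj h M : (PGL_conj (PGL_tau h) M)^T = PGL_conj h M^T.
Proof.
rewrite /PGL_conj; have [c [c0 ->]] := PGL_tau_mx h.
rewrite conj_scale ?unitmx_inv ?unitmx_tr ?PGL_unit // invmxK.
by rewrite !trmx_mul trmxK trmx_inv trmxK mulmxA.
Qed.

(* The variety underlying PGL_n x| <tau> is the product of PGL_n and the
   two-point variety <tau> = bool; (h, b) stands for h tau^b. *)
Definition P_kspace : kspace k := prod_kspace PGL_kspace (bool_kspace k).
Definition P_group : Type := P_kspace.
HB.instance Definition _ := Choice.on P_group.

Definition P_elt (h : PGL) (b : bool) : P_group := (h, b).
Definition P_one : P_group := P_elt 1%g false.
Definition P_mul (p q : P_group) : P_group :=
  P_elt ((p.1 : PGL) * (if p.2 then PGL_tau q.1 else q.1))%g (p.2 (+) q.2).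
Definition P_inv (p : P_group) : P_group :=
  P_elt (if p.2 then PGL_tau ((p.1 : PGL)^-1)%g else ((p.1 : PGL)^-1)%g) p.2.

Lemma PGL_tau1 : PGL_tau 1%g = 1%g.
Proof. by apply: (@mulgI _ (PGL_tau 1%g)); rewrite -PGL_tauM !mulg1. Qed.

Lemma P_mulA : associative P_mul.
Proof.
move=> [x [|]] [y [|]] [z c]; rewrite /P_mul /P_elt /=;
  by rewrite ?PGL_tauM ?PGL_tauK mulgA ?addbA // negbK.
Qed.
Lemma P_mul1 : left_id P_one P_mul.
Proof. by move=> [x b]; rewrite /P_mul /P_elt /= mul1g. Qed.
Lemma P_mulr1 : right_id P_one P_mul.
Proof. by move=> [x [|]]; rewrite /P_mul /P_elt /= ?PGL_tau1 mulg1. Qed.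
Lemma P_mulV : left_inverse P_one P_inv P_mul.
Proof.
by move=> [x [|]]; rewrite /P_mul /P_inv /P_elt /= -?PGL_tauM mulVg ?PGL_tau1.
Qed.
Lemma P_mulrV : right_inverse P_one P_inv P_mul.
Proof.
by move=> [x [|]]; rewrite /P_mul /P_inv /P_elt /= ?PGL_tauK mulgV.
Qed.
HB.instance Definition _ :=
  isGroup.Build P_group P_mulA P_mul1 P_mulr1 P_mulV P_mulrV.

Definition P_tau : P_group := P_elt 1%g true.
Definition P_PGL (h : PGL) : P_group := P_elt h false.

Lemma P_tau_PGL h : (P_tau * P_PGL h)%g = (P_PGL (PGL_tau h) * P_tau)%g.
Proof.
change (P_mul P_tau (P_PGL h) = P_mul (P_PGL (PGL_tau h)) P_tau).
by rewrite /P_mul /P_elt /= mul1g mulg1.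
Qed.
Lemma P_tau_tau : (P_tau * P_tau)%g = 1%g.
Proof.
change (P_mul P_tau P_tau = P_one).
by rewrite /P_mul /P_elt /= PGL_tau1 mulg1.
Qed.

Record Pvariety := PVariety {
  pv_kspace :> kspace k;
  pv_variety : variety pv_kspace;
  pv_act : P_group -> pv_kspace -> pv_kspace;
  pv_act1 : forall x, pv_act 1%g x = x;
  pv_actM : forall p q x, pv_act (p * q)%g x = pv_act p (pv_act q x);
  pv_act_morphism :
    morphism (fun u : prod_kspace P_kspace pv_kspace => pv_act u.1 u.2)
}.

End ProjectiveLinearGroup.

Section AlgebraOfEquivariantMaps.
Context {k : fieldType} {n : nat} (X : Pvariety k n).

Lemma pv_act_cts p : continuous (@pv_act k n X p).
Proof.
move=> x.
have m1 : morphism_at (fun=> p : P_kspace k n) x.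
  by split=> [|h _]; [exact: cst_continuous|exact: regular_at_cst].
have m2 : morphism_at (fun y : X => y) x.
  by split.
have m := morphism_at_comp (morphism_pair m1 m2)
  (@pv_act_morphism k n X (p, x)).
by case: m.
Qed.

Lemma pv_actKV p : cancel (@pv_act k n X p) (pv_act (p^-1)%g).
Proof. by move=> x; rewrite -pv_actM mulVg pv_act1. Qed.

Lemma pv_actVK p : cancel (pv_act (p^-1)%g) (@pv_act k n X p).
Proof. by move=> x; rewrite -pv_actM mulgV pv_act1. Qed.

Lemma generically_act p (P : X -> Prop) :
  generically P -> generically (fun x => P (pv_act p x)).
Proof.
apply: generically_preim; [exact: pv_act_cts|exact: (@pv_act_cts (p^-1)%g)| |].
  exact: pv_actKV.
exact: pv_actVK.
Qed.

Definition PGL_equivariant (f : X -> 'M[k]_n) :=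
  forall h : PGL k n,
    generically (fun x => f (pv_act (P_PGL h) x) = PGL_conj h (f x)).

(* [kn] below is k_n(X) and [kn_sigma] is sigma_{X,tau}.  As n = 0 and X empty
   are not excluded here, 1 <> 0 may fail in [kn], so it is given as a pzRing
   and an lmodule, with the algebra laws [kn_scalerAl] and [kn_scalerAr]. *)
Definition kn_pred : pred (X -> affine_space k n n) := fun f =>
  `[< rational (Y := affine_kspace k n n) f /\ PGL_equivariant f >].

Definition kn_map := {f : X -> affine_space k n n | kn_pred f}.

Definition kn_eq : rel kn_map := fun f g =>
  `[< generically (fun x => val f x = val g x) >].

Lemma kn_eq_refl : reflexive kn_eq.
Proof. by move=> f; apply/asboolP; exact: genericallyW. Qed.

Lemma kn_eq_sym : ssrbool.symmetric kn_eq.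
Proof. by move=> f g; apply/asboolP/asboolP; exact: generically1. Qed.

Lemma kn_eq_trans : transitive kn_eq.
Proof.
move=> g f h /asboolP fg /asboolP gh; apply/asboolP.
by move: fg gh; apply: generically2 => x -> ->.
Qed.

Canonical kn_equiv := EquivRel kn_eq kn_eq_refl kn_eq_sym kn_eq_trans.

Definition kn : Type := {eq_quot kn_eq}.
HB.instance Definition _ := Choice.on kn.

Definition kn_fun (f : kn) : X -> 'M[k]_n := val (repr (f : {eq_quot kn_eq})).

Definition kn_class (f : X -> 'M[k]_n) (hf : kn_pred f) : kn :=
  \pi_{eq_quot kn_eq} (Sub f hf : kn_map).

Lemma kn_classE f (hf : kn_pred f) :
  generically (fun x => kn_fun (kn_class hf) x = f x).
Proof.
have : repr (kn_class hf : {eq_quot kn_eq}) = (Sub f hf : kn_map)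
   %[mod {eq_quot kn_eq}] by rewrite reprK.
by move=> /eqmodP/asboolP.
Qed.

Lemma knP (f g : kn) : generically (fun x => kn_fun f x = kn_fun g x) -> f = g.
Proof.
move=> H; rewrite -[f](@reprK _ {eq_quot kn_eq}).
rewrite -[g](@reprK _ {eq_quot kn_eq}).
by apply/eqmodP/asboolP.
Qed.

Lemma kn_fun_rational (f : kn) :
  generically (fun x => forall i j, regular_at x (fun y => kn_fun f y i j)).
Proof.
have /asboolP[H _] := valP (repr (f : {eq_quot kn_eq})).
by apply: generically1 H => x /morphism_at_affine.
Qed.

Lemma kn_fun_equivariant (f : kn) : PGL_equivariant (kn_fun f).
Proof. by have /asboolP[] := valP (repr (f : {eq_quot kn_eq})). Qed.

Lemma generically_mp (P Q : X -> Prop) :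
  generically P -> generically (fun x => P x -> Q x) -> generically Q.
Proof. by apply: generically2 => x Px; apply. Qed.

Lemma kn_predP (f : X -> 'M[k]_n) :
  generically (fun x => forall i j, regular_at x (fun y => f y i j)) ->
  PGL_equivariant f -> kn_pred f.
Proof.
move=> H He; apply/asboolP; split=> //.
by apply: generically1 H => x /morphism_at_affine.
Qed.

Lemma regular_at_ext (x : X) (f g : X -> k) : f =1 g -> regular_at x f ->
  regular_at x g.
Proof. by move=> /funext ->. Qed.

Lemma kn_cst_subproof (c : k) : kn_pred (fun=> c%:M).
Proof.
apply: kn_predP => [|h]; apply: genericallyW => x.
  by move=> i j; exact: regular_at_cst.
by rewrite /PGL_conj mul_mx_scalar -scalemxAl mulmxV ?PGL_unit // scalemx1.
Qed.

Lemma kn_add_subproof (f g : kn) : kn_pred (fun x => kn_fun f x + kn_fun g x).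
Proof.
apply: kn_predP => [|h].
  move: (kn_fun_rational f) (kn_fun_rational g).
  apply: generically2 => x rf rg i j.
  by apply: regular_at_ext (regular_atD (rf i j) (rg i j)) => y; rewrite mxE.
move: (kn_fun_equivariant f h) (kn_fun_equivariant g h).
by apply: generically2 => x -> ->; rewrite /PGL_conj mulmxDr mulmxDl.
Qed.

Lemma kn_mul_subproof (f g : kn) : kn_pred (fun x => kn_fun f x *m kn_fun g x).
Proof.
apply: kn_predP => [|h].
  move: (kn_fun_rational f) (kn_fun_rational g).
  apply: generically2 => x rf rg i j.
  have r := regular_at_sum (index_enum _)
    (fun l => regular_atM (rf i l) (rg l j)).
  by apply: regular_at_ext r => y; rewrite mxE.
move: (kn_fun_equivariant f h) (kn_fun_equivariant g h).
apply: generically2 => x -> ->; rewrite /PGL_conj.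
by rewrite !mulmxA mulmxKV ?PGL_unit.
Qed.

Lemma kn_scale_subproof (c : k) (f : kn) : kn_pred (fun x => c *: kn_fun f x).
Proof.
apply: kn_predP => [|h].
  apply: generically1 (kn_fun_rational f) => x rf i j.
  by apply: regular_at_ext (regular_atM (regular_at_cst x c) (rf i j)) => y;
    rewrite mxE.
apply: generically1 (kn_fun_equivariant f h) => x ->.
by rewrite /PGL_conj -scalemxAr -scalemxAl.
Qed.

Lemma kn_sigma_subproof (f : kn) :
  kn_pred (fun x => (kn_fun f (pv_act (P_tau k n) x))^T).
Proof.
apply: kn_predP => [|h].
  have := generically_act (P_tau k n) (kn_fun_rational f).
  apply: generically1 => x rf i j.
  have m1 : morphism_at (fun=> P_tau k n : P_kspace k n) x.
    by split=> [|l _]; [exact: cst_continuous|exact: regular_at_cst].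
  have m2 : morphism_at (fun y : X => y) x by split.
  have [_ m] := morphism_at_comp (morphism_pair m1 m2)
    (@pv_act_morphism k n X (P_tau k n, x)).
  by apply: regular_at_ext (m _ (rf j i)) => y; rewrite mxE.
have := generically_act (P_tau k n) (kn_fun_equivariant f (PGL_tau h)).
apply: generically1 => x E.
by rewrite -pv_actM P_tau_PGL pv_actM E tr_PGL_conj.
Qed.

Definition kn_zero : kn := kn_class (kn_cst_subproof 0).
Definition kn_one : kn := kn_class (kn_cst_subproof 1).
Definition kn_add (f g : kn) : kn := kn_class (kn_add_subproof f g).
Definition kn_mul (f g : kn) : kn := kn_class (kn_mul_subproof f g).
Definition kn_scale (c : k) (f : kn) : kn := kn_class (kn_scale_subproof c f).
Definition kn_opp (f : kn) : kn := kn_scale (-1) f.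

Definition kn_sigma (f : kn) : kn := kn_class (kn_sigma_subproof f).

Let zeroE := kn_classE (kn_cst_subproof 0).
Let oneE := kn_classE (kn_cst_subproof 1).
Let addE f g := kn_classE (kn_add_subproof f g).
Let mulE f g := kn_classE (kn_mul_subproof f g).
Let scaleE c f := kn_classE (kn_scale_subproof c f).
Let sigmaE f := kn_classE (kn_sigma_subproof f).

Lemma kn_addA : associative kn_add.
Proof.
move=> f g h; apply: knP.
apply: generically_mp (addE f (kn_add g h)) _; apply: generically_mp (addE g h) _.
apply: generically_mp (addE (kn_add f g) h) _; apply: generically_mp (addE f g) _.
by apply: genericallyW => x -> -> -> ->; rewrite addrA.
Qed.

Lemma kn_addC : commutative kn_add.
Proof.
move=> f g; apply: knP.
apply: generically_mp (addE f g) _; apply: generically_mp (addE g f) _.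
by apply: genericallyW => x -> ->; rewrite addrC.
Qed.

Lemma kn_add0 : left_id kn_zero kn_add.
Proof.
move=> f; apply: knP.
apply: generically_mp (addE kn_zero f) _; apply: generically_mp zeroE _.
by apply: genericallyW => x -> ->; rewrite raddf0 add0r.
Qed.

Lemma kn_addN : left_inverse kn_zero kn_opp kn_add.
Proof.
move=> f; apply: knP.
apply: generically_mp (addE (kn_opp f) f) _; apply: generically_mp zeroE _.
apply: generically_mp (scaleE (-1) f) _.
by apply: genericallyW => x -> -> ->; rewrite scaleN1r raddf0 addNr.
Qed.

HB.instance Definition _ :=
  GRing.isZmodule.Build kn kn_addA kn_addC kn_add0 kn_addN.

Lemma kn_mulA : associative kn_mul.
Proof.
move=> f g h; apply: knP.
apply: generically_mp (mulE f (kn_mul g h)) _; apply: generically_mp (mulE g h) _.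
apply: generically_mp (mulE (kn_mul f g) h) _; apply: generically_mp (mulE f g) _.
by apply: genericallyW => x -> -> -> ->; rewrite mulmxA.
Qed.

Lemma kn_mul1 : left_id kn_one kn_mul.
Proof.
move=> f; apply: knP.
apply: generically_mp (mulE kn_one f) _; apply: generically_mp oneE _.
by apply: genericallyW => x -> ->; rewrite mul1mx.
Qed.

Lemma kn_mulr1 : right_id kn_one kn_mul.
Proof.
move=> f; apply: knP.
apply: generically_mp (mulE f kn_one) _; apply: generically_mp oneE _.
by apply: genericallyW => x -> ->; rewrite mulmx1.
Qed.

Lemma kn_mulDl : left_distributive kn_mul kn_add.
Proof.
move=> f g h; apply: knP.
apply: generically_mp (mulE (kn_add f g) h) _; apply: generically_mp (addE f g) _.
apply: generically_mp (addE (kn_mul f h) (kn_mul g h)) _.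
apply: generically_mp (mulE f h) _; apply: generically_mp (mulE g h) _.
by apply: genericallyW => x -> -> -> -> ->; rewrite mulmxDl.
Qed.

Lemma kn_mulDr : right_distributive kn_mul kn_add.
Proof.
move=> f g h; apply: knP.
apply: generically_mp (mulE f (kn_add g h)) _; apply: generically_mp (addE g h) _.
apply: generically_mp (addE (kn_mul f g) (kn_mul f h)) _.
apply: generically_mp (mulE f g) _; apply: generically_mp (mulE f h) _.
by apply: genericallyW => x -> -> -> -> ->; rewrite mulmxDr.
Qed.

HB.instance Definition _ :=
  GRing.Zmodule_isPzRing.Build kn kn_mulA kn_mul1 kn_mulr1 kn_mulDl kn_mulDr.

Lemma kn_scaleA c d f : kn_scale c (kn_scale d f) = kn_scale (c * d) f.
Proof.
apply: knP; apply: generically_mp (scaleE c (kn_scale d f)) _.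
apply: generically_mp (scaleE d f) _; apply: generically_mp (scaleE (c * d) f) _.
by apply: genericallyW => x -> -> ->; rewrite scalerA.
Qed.

Lemma kn_scale1 : left_id 1 kn_scale.
Proof.
move=> f; apply: knP; apply: generically_mp (scaleE 1 f) _.
by apply: genericallyW => x ->; rewrite scale1r.
Qed.

Lemma kn_scaleDr : right_distributive kn_scale +%R.
Proof.
move=> c f g; apply: knP; apply: generically_mp (scaleE c (f + g)) _.
apply: generically_mp (addE f g) _; apply: generically_mp (scaleE c f) _.
apply: generically_mp (addE (kn_scale c f) (kn_scale c g)) _.
apply: generically_mp (scaleE c g) _.
by apply: genericallyW => x -> -> -> -> ->; rewrite scalerDr.
Qed.

Lemma kn_scaleDl f : {morph kn_scale^~ f : a b / a + b}.
Proof.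
move=> a b; apply: knP; apply: generically_mp (scaleE (a + b) f) _.
apply: generically_mp (addE (kn_scale a f) (kn_scale b f)) _.
apply: generically_mp (scaleE a f) _; apply: generically_mp (scaleE b f) _.
by apply: genericallyW => x -> -> -> ->; rewrite scalerDl.
Qed.

HB.instance Definition _ :=
  GRing.Zmodule_isLmodule.Build k kn kn_scaleA kn_scale1 kn_scaleDr kn_scaleDl.

Lemma kn_scalerAl c (f g : kn) : c *: (f * g) = (c *: f) * g.
Proof.
apply: knP; apply: generically_mp (scaleE c (f * g)) _.
apply: generically_mp (mulE f g) _; apply: generically_mp (mulE (c *: f) g) _.
apply: generically_mp (scaleE c f) _.
by apply: genericallyW => x -> -> -> ->; rewrite scalemxAl.
Qed.

Lemma kn_scalerAr c (f g : kn) : c *: (f * g) = f * (c *: g).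
Proof.
apply: knP; apply: generically_mp (scaleE c (f * g)) _.
apply: generically_mp (mulE f g) _; apply: generically_mp (mulE f (c *: g)) _.
apply: generically_mp (scaleE c g) _.
by apply: genericallyW => x -> -> -> ->; rewrite scalemxAr.
Qed.

Lemma kn_sigmaK : involutive kn_sigma.
Proof.
move=> f; apply: knP; apply: generically_mp (sigmaE (kn_sigma f)) _.
apply: generically_mp (generically_act (P_tau k n) (sigmaE f)) _.
apply: genericallyW => x -> ->.
by rewrite trmxK -pv_actM P_tau_tau pv_act1.
Qed.

Lemma kn_sigmaM : {morph kn_sigma : f g / f * g >-> g * f}.
Proof.
move=> f g; apply: knP; apply: generically_mp (sigmaE (f * g)) _.
apply: generically_mp (generically_act (P_tau k n) (mulE f g)) _.
apply: generically_mp (mulE (kn_sigma g) (kn_sigma f)) _.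
apply: generically_mp (sigmaE f) _; apply: generically_mp (sigmaE g) _.
by apply: genericallyW => x -> -> -> -> ->; rewrite trmx_mul.
Qed.

Lemma kn_sigma_linear : linear kn_sigma.
Proof.
move=> c f g; apply: knP; apply: generically_mp (sigmaE (c *: f + g)) _.
apply: generically_mp (generically_act (P_tau k n) (addE (c *: f) g)) _.
apply: generically_mp (generically_act (P_tau k n) (scaleE c f)) _.
apply: generically_mp (addE (c *: kn_sigma f) (kn_sigma g)) _.
apply: generically_mp (scaleE c (kn_sigma f)) _.
apply: generically_mp (sigmaE f) _; apply: generically_mp (sigmaE g) _.
by apply: genericallyW => x -> -> -> -> -> -> ->; rewrite linearP.
Qed.

Definition PGL_generically_free :=
  generically (fun x : X => forall h : PGL k n, pv_act (P_PGL h) x = x -> h = 1%g).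

End AlgebraOfEquivariantMaps.

Section CentralSimpleAlgebras.
Context {k : fieldType} (A : algType k).

Definition center : set A := [set z | forall a, z * a = a * z].

Definition two_sided_ideal (I : set A) :=
  [/\ I 0, forall a b, I a -> I b -> I (a + b) &
      forall a b, I a -> I (b * a) /\ I (a * b)].

Definition simple_algebra :=
  forall I : set A, two_sided_ideal I -> I = [set 0] \/ I = setT.

Definition dim_over_center (d : nat) :=
  exists b : 'I_d -> A, forall a, exists! z : {ffun 'I_d -> A},
    (forall i, center (z i)) /\ a = \sum_i z i * b i.

(* When s is a set of central elements, the smallest central subfield
   containing s is k(s). *)
Definition central_subfield (F : set A) :=
  [/\ F `<=` center, forall c : k, F c%:A,
      forall a b, F a -> F b -> F (a - b) /\ F (a * b) &
      forall a b, F a -> a * b = 1 -> F b].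

Definition center_finitely_generated :=
  exists s : seq A, {in s, forall a, center a} /\
    forall F, central_subfield F -> {in s, forall a, F a} -> center `<=` F.

Definition central_simple_of_degree (n : nat) :=
  [/\ simple_algebra, dim_over_center (n ^ 2) & center_finitely_generated].

Definition algebra_involution (s : A -> A) :=
  [/\ linear s, {morph s : x y / x * y >-> y * x} & involutive s].

Definition isomorphic_to_kn (s : A -> A) (n : nat) (X : Pvariety k n) :=
  exists phi : {rmorphism A -> kn X},
    [/\ scalable phi, bijective phi &
        forall a, phi (s a) = kn_sigma (phi a)].

End CentralSimpleAlgebras.

Section BirationalIsomorphisms.
Context {k : fieldType} {n : nat} (X Y : Pvariety k n).

Definition birational_isomorphism (f : X -> Y) :=
  exists (g : Y -> X) (U : set X) (V : set Y),
    [/\ open U /\ dense U, open V /\ dense V,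
        forall x, U x -> [/\ morphism_at f x, V (f x) & g (f x) = x] &
        forall y, V y -> [/\ morphism_at g y, U (g y) & f (g y) = y]].

Definition P_equivariant (f : X -> Y) :=
  forall p : P_group k n,
    generically (fun x => f (pv_act p x) = pv_act p (f x)).

Definition P_birational := exists f : X -> Y,
  birational_isomorphism f /\ P_equivariant f.

End BirationalIsomorphisms.

(* Main.v *)
(* Let L be a finite family in A containing a basis of A over its center.  The
   matrices by which the elements of L act define theta_X : X --> M_n^L, which
   is PGL_n-equivariant, and tau-equivariant up to transposition when L is
   stable under sigma; likewise theta_Y.

   (1) theta_X and theta_Y have the same Zariski closure of images.  A family of
   central elements satisfies the same polynomial relations on X and on Y, so by
   quantifier elimination its sets of values on any nonempty open subsets of X
   and Y meet.  If the family contains the structure constants of A and the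
   coordinates of L, then two points x, y with equal central values have
   PGL_n-conjugate images, by Skolem-Noether in M_n(k).

   (2) For L large enough theta_X is birational onto its image.  For a rational
   function f on X and fixed x, f is a quotient of polynomials in the matrices
   b_i of a basis on the orbit of x, of degree bounded independently of x.  The linear
   relations witnessing this form a space depending only on the orbit, hence
   have a basis of invariant rational functions, which are central elements.

   So X --> theta_X(X)^- = theta_Y(Y)^- <-- Y are equivariant birational maps. *)

Require Import Defs.
From mathcomp Require Import all_boot all_order all_algebra.
From mathcomp Require Import all_classical.
From mathcomp Require Import topology_structure subtype_topology
  quotient_topology initial_topology.
From mathcomp Require Import -(notations) mpoly.
From mathcomp Require Import perm closed_field ring.

Set Implicit Arguments.
Unset Strict Implicit.
Unset Printing Implicit Defensive.

Import Order.TTheory GRing.Theory.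
Local Open Scope classical_set_scope.
Local Open Scope ring_scope.
Local Open Scope quotient_scope.

(** * Generic points, regular functions and the action of GL_n *)

Section Density.
Context {X : topologicalType}.

(** The isomorphisms with A compare elements of k_n(X) and k_n(Y), whereas theta_X and theta_Y must
    be compared at points. What passes from X to Y is the truth of a quantifier-free formula in
    central elements: it holds at generic points exactly when it holds in A. Quantifier elimination
    gives the existence of a point of U with prescribed central values this form, up to shrinking U.

    The closures of the images are never formed. Their inclusion reads: an open set that theta_Y
    generically avoids is generically avoided by theta_X. The map X --> Y is then written down
    directly: by (2), chart coordinates on Y are rational functions of theta_Y, and the same
    functions are evaluated at theta_X(x).

    The degree bound in (2) has to be uniform in x because the relations between f and the monomials
    in the b_i must form the kernel of rows of one fixed finite length; only then does an invariant
    projector onto them have rational entries. *)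

Lemma generically_near (P Q : X -> Prop) (x : X) : generically P ->
  (\forall y \near x, Q y) -> exists y, P y /\ Q y.
Proof.
move=> [U [oU dU sU]] /near_open[V [oV Vx sV]].
have [|y [Vy Uy]] := dU V _ oV; first by exists x.
by exists y; split; [exact: sU|exact: sV].
Qed.

Lemma generically_ex (P : X -> Prop) : [set: X] !=set0 -> generically P ->
  exists x, P x.
Proof.
move=> [x _] gP.
by have [|y [? _]] := @generically_near P (fun=> True) x gP; [exact: filterE|exists y].
Qed.

Lemma generically_and (P Q : X -> Prop) : generically P -> generically Q ->
  generically (fun x => P x /\ Q x).
Proof. by apply: generically2. Qed.

Lemma generically_forall (I : finType) (P : I -> X -> Prop) :
  (forall i, generically (P i)) -> generically (fun x => forall i, P i x).
Proof.
move=> H; have : generically (fun x => forall i, i \in enum I -> P i x).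
  elim: (enum I) => [|i s IH]; first by apply: genericallyW.
  move: IH (H i); apply: generically2 => x IH Pi j.
  by rewrite inE => /orP[/eqP ->|/IH].
by apply: generically1 => x Px i; apply: Px; rewrite mem_enum.
Qed.

Hypothesis X_irr : irreducible_space X.

(** Every nonempty open set is dense here. Regularity or nonvanishing checked at a single point
    thereby becomes a generic statement. *)
Lemma irreducible_near (P : X -> Prop) (x : X) : (\forall y \near x, P y) ->
  generically P.
Proof.
move=> /near_open[U [oU Ux sU]]; exists U; split=> // V V0 oV.
by rewrite setIC; apply: (X_irr.2 U V oU oV _ V0); exists x.
Qed.

Lemma irreducible_open (U : set X) x : open U -> U x -> generically U.
Proof. by move=> oU Ux; apply: (@irreducible_near _ x); apply: open_nbhs_nbhs. Qed.

End Density.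

Section RegularFunctions.
Context {k : fieldType} {X : kspace k}.

Lemma regular_at_eqfun (x : X) (f g : X -> k) : f =1 g -> regular_at x f ->
  regular_at x g.
Proof. by move=> /funext ->. Qed.

Lemma regular_atN x (f : X -> k) : regular_at x f -> regular_at x (fun y => - f y).
Proof.
move=> rf; apply: regular_at_eq (regular_atM (regular_at_cst x (-1)) rf) _.
by apply: filterE => y; rewrite mulN1r.
Qed.

Lemma regular_atB x (f g : X -> k) : regular_at x f -> regular_at x g ->
  regular_at x (fun y => f y - g y).
Proof. by move=> rf rg; apply: regular_atD => //; exact: regular_atN. Qed.

(** Nonvanishing is an open condition, so it would meet the generic locus. In this way identities
    known only generically become exact at points of regularity. *)
Lemma regular_generically0 x (f : X -> k) : regular_at x f ->
  generically (fun y => f y = 0) -> f x = 0.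
Proof.
move=> rf gf; apply/eqP/negP => /negP f0.
have [y [->]] := generically_near gf (regular_at_neq0 rf f0).
by rewrite eqxx.
Qed.

Lemma regular_generically_eq x (f g : X -> k) : regular_at x f ->
  regular_at x g -> generically (fun y => f y = g y) -> f x = g x.
Proof.
move=> rf rg E; apply/eqP; rewrite -subr_eq0; apply/eqP.
apply: (@regular_generically0 x (fun y => f y - g y)); first exact: regular_atB.
by move: E; apply: generically1 => y ->; rewrite subrr.
Qed.

Definition mx_regular_at p q (x : X) (f : X -> 'M[k]_(p, q)) :=
  forall i j, regular_at x (fun y => f y i j).

Lemma mx_regular_at_near p q x (f : X -> 'M[k]_(p, q)) : mx_regular_at x f ->
  \forall y \near x, mx_regular_at y f.
Proof.
move=> H; have : \forall y \near x, forall ij : 'I_p * 'I_q,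
    regular_at y (fun z => f z ij.1 ij.2).
  by apply: filter_forall => ij; apply: regular_at_near.
by apply: filterS => y Hy i j; exact: (Hy (i, j)).
Qed.

Lemma mx_regular_at_eq p q x (f g : X -> 'M[k]_(p, q)) : mx_regular_at x f ->
  (\forall y \near x, f y = g y) -> mx_regular_at x g.
Proof.
by move=> rf E i j; apply: regular_at_eq (rf i j) _; apply: filterS E => y ->.
Qed.

Lemma mx_regular_at_cst p q x (C : 'M[k]_(p, q)) : mx_regular_at x (fun=> C).
Proof. by move=> i j; exact: regular_at_cst. Qed.

Lemma mx_regular_atB p q x (f g : X -> 'M[k]_(p, q)) : mx_regular_at x f ->
  mx_regular_at x g -> mx_regular_at x (fun y => f y - g y).
Proof.
move=> rf rg i j.
by apply: regular_at_eqfun (regular_atB (rf i j) (rg i j)) => y; rewrite !mxE.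
Qed.

Lemma mx_regular_atM p q r x (f : X -> 'M[k]_(p, q)) (g : X -> 'M[k]_(q, r)) :
  mx_regular_at x f -> mx_regular_at x g -> mx_regular_at x (fun y => f y *m g y).
Proof.
move=> rf rg i j.
have r' := regular_at_sum (index_enum _) (fun l => regular_atM (rf i l) (rg l j)).
by apply: regular_at_eqfun r' => y; rewrite mxE.
Qed.

Lemma mx_regular_atZ p q x (c : X -> k) (f : X -> 'M[k]_(p, q)) :
  regular_at x c -> mx_regular_at x f -> mx_regular_at x (fun y => c y *: f y).
Proof.
move=> rc rf i j.
by apply: regular_at_eqfun (regular_atM rc (rf i j)) => y; rewrite mxE.
Qed.

Lemma regular_at_det p x (f : X -> 'M[k]_p) : mx_regular_at x f ->
  regular_at x (fun y => \det (f y)).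
Proof.
move=> rf; rewrite /determinant; apply: regular_at_sum => s.
by apply: regular_atM (regular_at_cst _ _) _; apply: regular_at_prod.
Qed.

Lemma mx_regular_at_inv p x (f : X -> 'M[k]_p) : mx_regular_at x f ->
  f x \in unitmx -> mx_regular_at x (fun y => invmx (f y)).
Proof.
move=> rf; rewrite unitmxE unitfE => d0.
have rd := regular_at_det rf.
have ra : mx_regular_at x (fun y => \adj (f y)).
  move=> i j; have rc : regular_at x (fun y => cofactor (f y) j i).
    apply: regular_atM (regular_at_cst _ _) _; apply: regular_at_det => a b.
    by apply: regular_at_eqfun (rf (lift j a) (lift i b)) => y; rewrite !mxE.
  by apply: regular_at_eqfun rc => y; rewrite mxE.
(* [invmx] is given by the adjugate only at invertible matrices, hence an equality near x and not
   everywhere. *)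
apply: mx_regular_at_eq (mx_regular_atZ (regular_atV rd d0) ra) _.
have := regular_at_neq0 rd d0.
by apply: filterS => y fy; rewrite /invmx unitmxE unitfE fy.
Qed.

Lemma near_unitmx p x (f : X -> 'M[k]_p) : mx_regular_at x f ->
  f x \in unitmx -> \forall y \near x, f y \in unitmx.
Proof.
move=> rf; rewrite unitmxE unitfE => /(regular_at_neq0 (regular_at_det rf)).
by apply: filterS => y; rewrite unitmxE unitfE.
Qed.

Lemma mx_regular_at_morphism p q x (f : X -> affine_kspace k p q) :
  mx_regular_at x f -> morphism_at f x.
Proof. by move/morphism_at_affine. Qed.

Lemma mx_regular_generically_eq p q x (f g : X -> 'M[k]_(p, q)) :
  mx_regular_at x f -> mx_regular_at x g ->
  generically (fun y => f y = g y) -> f x = g x.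
Proof.
move=> rf rg E; apply/matrixP => i j.
apply: (regular_generically_eq (rf i j) (rg i j)).
by move: E; apply: generically1 => y ->.
Qed.

End RegularFunctions.

Lemma mx_regular_at_comp (k : fieldType) p q (X Y : kspace k) (g : X -> Y)
    (x : X) (f : Y -> 'M[k]_(p, q)) :
  morphism_at g x -> mx_regular_at (g x) f -> mx_regular_at x (fun y => f (g y)).
Proof. by move=> [_ H] rf i j; exact: H (rf i j). Qed.


Section Projections.
Context {k : fieldType} (X Y : kspace k).

Lemma tensor_regular_at1 (u : prod_kspace X Y) (f : X -> k) (g : Y -> k) :
  regular_at u.1 f -> regular_at u.2 g -> tensor_regular_at u [:: (f, g)].
Proof. by move=> rf rg ab; rewrite inE => /eqP ->. Qed.

Lemma morphism_fst (u : prod_kspace X Y) :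
  morphism_at (fun v : prod_kspace X Y => v.1) u.
Proof.
split.
  move=> U Uu; have : \forall q \near u, U q.1 /\ True.
    by apply: (@near_prod k X Y u U setT); [exact: Uu|exact: filterT].
  by apply: filterS => q [].
move=> h rh; exists [:: (h, fun=> 1)], [:: (fun=> 1, fun=> 1)]; split.
- by apply: tensor_regular_at1 => //; exact: regular_at_cst.
- by apply: tensor_regular_at1; exact: regular_at_cst.
- by rewrite /tensor_eval big_seq1 mulr1 oner_neq0.
- by apply: filterE => q; rewrite /tensor_eval !big_seq1 !mulr1 divr1.
Qed.

Lemma morphism_snd (u : prod_kspace X Y) :
  morphism_at (fun v : prod_kspace X Y => v.2) u.
Proof.
split.
  move=> U Uu; have : \forall q \near u, True /\ U q.2.
    by apply: (@near_prod k X Y u setT U); [exact: filterT|exact: Uu].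
  by apply: filterS => q [].
move=> h rh; exists [:: (fun=> 1, h)], [:: (fun=> 1, fun=> 1)]; split.
- by apply: tensor_regular_at1 => //; exact: regular_at_cst.
- by apply: tensor_regular_at1; exact: regular_at_cst.
- by rewrite /tensor_eval big_seq1 mulr1 oner_neq0.
- by apply: filterE => q; rewrite /tensor_eval !big_seq1 ?mulr1 ?mul1r divr1.
Qed.

Lemma morphism_at_id (y : Y) : morphism_at (fun z : Y => z) y.
Proof. by split. Qed.

Lemma morphism_at_cst (z : X) (y : Y) : morphism_at (fun=> z) y.
Proof. by split=> [|l _]; [exact: cst_continuous|exact: regular_at_cst]. Qed.

End Projections.

Section Action.
Context {k : fieldType} {n : nat} (X : Pvariety k n).

Lemma pv_act_morphism_at p (x : X) : morphism_at (pv_act p) x.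
Proof.
exact: (morphism_at_comp (morphism_pair (morphism_at_cst _ x) (morphism_at_id x))
  (@pv_act_morphism k n X (p, x))).
Qed.

(** The action is lifted to GL_n, where regular functions are locally quotients of polynomials in
    the matrix entries; PGL_n carries only a quotient structure. *)
Definition GL_act (g : GL_kspace k n) (x : X) : X :=
  pv_act (P_PGL (PGL_class g)) x.

Lemma PGL_class_morphism (g : GL_kspace k n) :
  morphism_at (PGL_class (n := n) : _ -> PGL_kspace k n) g.
Proof.
split; first by move=> U; exact: (@pi_continuous _ {eq_quot (@proportional k n)}).
move=> h [U [oU Ug H]]; exact: H.
Qed.

Lemma GL_act_morphism : morphism (fun u : prod_kspace (GL_kspace k n) X =>
  GL_act u.1 u.2).
Proof.
move=> u.
have m1 := morphism_at_comp (morphism_fst u) (PGL_class_morphism u.1).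
have m2 := morphism_pair m1 (morphism_at_cst (false : bool_kspace k) u).
exact: (morphism_at_comp (morphism_pair m2 (morphism_snd u))
  (@pv_act_morphism k n X (_, u.2))).
Qed.

End Action.

Lemma sub_nbhs (k : fieldType) (Y : kspace k) (S : set Y) (a : sub_kspace S)
    (U : set (sub_kspace S)) : nbhs a U ->
  exists W : set Y, [/\ open W, W (set_val a) & forall b : S, W (set_val b) -> U b].
Proof. by move=> /near_open[_ [[W oW <-] Wa sW]]; exists W. Qed.

Section GLIrreducible.
Context {k : closedFieldType}.

(** If p is not constant, it takes the value 1 at a root of p - 1. *)
Lemma poly_nonroot (p : {poly k}) : p != 0 -> exists t, p.[t] != 0.
Proof.
move=> p0; have [/size_poly1P[c c0 ->]|s1] := boolP (size p == 1%N).
  by exists 0; rewrite hornerC.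
have s2 : (1 < size p)%N by rewrite ltn_neqAle eq_sym s1 size_poly_gt0.
have /closed_rootP[t] : size (p - 1) != 1%N.
  by rewrite size_polyDl ?size_polyN ?size_poly1.
rewrite /root !hornerE subr_eq0 => /eqP pt; exists t.
by rewrite pt oner_neq0.
Qed.

Lemma meval_line N (P : mpoly N k) (v w : 'I_N -> k) :
  exists p : {poly k}, forall t, p.[t] = meval (fun i => v i + t * w i) P.
Proof.
exists (\sum_(m <- msupp P) mcoeff m P *: \prod_i ((v i)%:P + w i *: 'X) ^+ m i).
move=> t; rewrite horner_sum mevalE; apply: eq_bigr => m _.
rewrite hornerZ horner_prod; congr (_ * _); apply: eq_bigr => i _.
by rewrite horner_exp !hornerE mulrC.
Qed.

(** Restrict to the line joining a point of U to a point of V: the polynomials defining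
    neighbourhoods of its two ends and the determinant are nonzero polynomials on it, hence so is
    their product. *)
Lemma GL_irreducible n : irreducible_space (GL_kspace k n).
Proof.
split; first by exists (GL_of (unitmx1 k n)).
move=> U V oU oV [g Ug] [h Vh].
have [W [oW Wg sW]] := sub_nbhs (open_nbhs_nbhs (conj oU Ug)).
have [W' [oW' Wh sW']] := sub_nbhs (open_nbhs_nbhs (conj oV Vh)).
have [P [Pg sP]] := zariski_nbhs (open_nbhs_nbhs (conj oW Wg)).
have [Q [Qh sQ]] := zariski_nbhs (open_nbhs_nbhs (conj oW' Wh)).
pose G := GL_mx g; pose H := GL_mx h.
pose L t : 'M[k]_n := G + t *: (H - G).
have line R : exists p : {poly k}, forall t, p.[t] = polyfun R (L t : affine_space k n n).
  have [p Hp] := meval_line R (mxvec G 0) (mxvec (H - G) 0).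
  exists p => t; rewrite Hp /polyfun; apply: meval_eq => i.
  by case/mxvec_indexP: i => a b; rewrite /L !mxvecE !mxE.
have [p Hp] := line P; have [q Hq] := line Q.
pose d : {poly k} := \det (map_mx polyC G + 'X *: map_mx polyC (H - G)).
have Hd t : d.[t] = \det (L t).
  rewrite -[LHS]/(horner_eval t d) -det_map_mx; congr (\det _).
  apply/matrixP => i j; rewrite !mxE.
  by rewrite -[LHS]/(_.[t]) hornerD hornerM hornerX !hornerC.
(* The line passes through G at t = 0 and through H at t = 1. *)
have p0 : p != 0.
  apply: contraNneq Pg => p0; have := Hp 0.
  by rewrite p0 horner0 /L scale0r addr0 => <-.
have q0 : q != 0.
  apply: contraNneq Qh => q0; have := Hq 1.
  by rewrite q0 horner0 /L scale1r addrC subrK => <-.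
have d0 : d != 0.
  apply/eqP => d0; have := Defs.GL_unit g; have := Hd 0.
  by rewrite d0 horner0 /L scale0r addr0 unitmxE unitfE => <-; rewrite eqxx.
have [t] := poly_nonroot (mulf_neq0 (mulf_neq0 p0 q0) d0).
rewrite !hornerM Hp Hq Hd !mulf_eq0 !negb_or => /andP[/andP[Pt Qt] Dt].
have uL : L t \in unitmx by rewrite unitmxE unitfE.
exists (GL_of uL); split.
  by apply: sW; apply: sP.
by apply: sW'; apply: sQ.
Qed.

End GLIrreducible.

(** * Invariant projectors *)

(* The relations satisfied by a matrix-valued rational function on the orbit of
   x depend only on this orbit, hence so does the projector onto the space of
   relations along a fixed complement: its entries are invariant rational
   functions. *)
Section Descent.
Context {k : fieldType} {n : nat} (X : Pvariety k n).
Context (q M : nat) (r : X -> 'M[k]_(q, M)) (D : set X).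
Hypotheses (oD : open D) (D0 : D !=set0)
  (rD : forall x, D x -> mx_regular_at x r).

Definition PGL_act (h : PGL k n) (x : X) := pv_act (P_PGL h) x.

Lemma PGL_act1 x : PGL_act 1%g x = x.
Proof. exact: pv_act1. Qed.

Lemma PGL_actM h g x : PGL_act (h * g)%g x = PGL_act h (PGL_act g x).
Proof. by rewrite /PGL_act -pv_actM. Qed.

Lemma PGL_act_morphism_at h x : morphism_at (PGL_act h) x.
Proof. exact: pv_act_morphism_at. Qed.

(** Translates outside D are ignored, since r is known to be regular only on D. The condition still
    depends only on the orbit of x. *)
Definition orbit_relation p (x : X) (w : 'M[k]_(M, p)) :=
  forall h, D (PGL_act h x) -> r (PGL_act h x) *m w = 0.

Lemma orbit_relation_act p h x (w : 'M[k]_(M, p)) :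
  orbit_relation (PGL_act h x) w <-> orbit_relation x w.
Proof.
split=> H g Dg; last by move: Dg; rewrite -PGL_actM; apply: H.
rewrite -(mulgVK h g) PGL_actM; apply: H.
by rewrite -PGL_actM mulgVK.
Qed.

Let rows m (f : 'I_m -> 'I_q * PGL k n) (x : X) : 'M[k]_(m, M) :=
  \matrix_(i, j) r (PGL_act (f i).2 x) (f i).1 j.

Let admissible m (f : 'I_m -> 'I_q * PGL k n) (x : X) :=
  D x /\ forall i, D (PGL_act (f i).2 x).

Lemma invariant_projector : exists (G : set X) (N : X -> 'M[k]_M),
  [/\ open G /\ G !=set0, G `<=` D,
      forall x, G x -> mx_regular_at x N,
      forall h x, G x -> G (PGL_act h x) -> N (PGL_act h x) = N x &
      forall x, G x -> orbit_relation x (N x) /\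
        forall p (w : 'M[k]_(M, p)), orbit_relation x w -> N x *m w = w].
Proof.
(* The number m of independent rows of r over a single orbit is maximized; it is at most M. *)
pose P m := `[< exists (f : 'I_m -> 'I_q * PGL k n) x,
   admissible f x /\ row_free (rows f x) >].
have P0 : exists m, P m.
  have [x Dx] := D0; exists 0%N; apply/asboolP.
  exists (fun i : 'I_0 => False_rect _ (notF (ltn_ord i))), x.
  by split; [split=> // -[]|rewrite /row_free -leqn0 rank_leq_row].
have Pb m : P m -> (m <= M)%N.
  by move=> /asboolP[f [x [_ /eqP <-]]]; exact: rank_leq_col.
have [m /asboolP[f [x1 [Ax1 free1]]] mmax] := ex_maxnP P0 Pb.
have [C MC] := row_freeP free1.
(* The fixed complement is the column space of C, a right inverse of the rows at x1. On G it stays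
   complementary to the kernel of the rows, and N projects onto this kernel along it. *)
pose G := [set x | admissible f x /\ rows f x *m C \in unitmx].
pose N x : 'M[k]_M := 1%:M - C *m invmx (rows f x *m C) *m rows f x.
have rows_reg x : admissible f x -> mx_regular_at x (rows f).
  move=> [_ Dx] i j.
  have := mx_regular_at_comp (PGL_act_morphism_at (f i).2 x) (rD (Dx i)).
  by move=> /(_ (f i).1 j); apply: regular_at_eqfun => y; rewrite mxE.
have near_adm x : admissible f x -> \forall y \near x, admissible f y.
  move=> [Dx Dfx]; have H : \forall y \near x, forall i, D (PGL_act (f i).2 y).
    apply: filter_forall => i; have [c _] := PGL_act_morphism_at (f i).2 x.
    exact: c (open_nbhs_nbhs (conj oD (Dfx i))).
  by apply: filterS2 (open_nbhs_nbhs (conj oD Dx)) H.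
have rC x : admissible f x -> mx_regular_at x (fun y => rows f y *m C).
  by move=> Ax; apply: mx_regular_atM; [exact: rows_reg|exact: mx_regular_at_cst].
(* The m chosen rows detect all relations along the orbit: a further row outside their span would
   give m + 1 independent ones. *)
have kerP p x (w : 'M[k]_(M, p)) : G x ->
    orbit_relation x w <-> rows f x *m w = 0.
  move=> [[Dx Dfx] uC]; split=> [H|H h Dh].
    apply/matrixP => i j; have /matrixP/(_ (f i).1 j) := H _ (Dfx i).
    rewrite !mxE => E; rewrite -[RHS]E; apply: eq_bigr => l _.
    by rewrite !mxE.
  suff S : (r (PGL_act h x) <= rows f x)%MS.
    by have /submxP[B ->] := S; rewrite -mulmxA H mulmx0.
  apply/row_subP => a; apply/negPn/negP => nS.
  pose f' (i : 'I_(1 + m)) := if fintype.split i is inr j then f j else (a, h).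
  have E : rows f' x = col_mx (row a (r (PGL_act h x))) (rows f x).
    apply/matrixP => i j; rewrite [LHS]mxE /f' mxE.
    by case: splitP => l _; rewrite mxE.
  have : P (1 + m)%N.
    apply/asboolP; exists f', x; split.
      by split=> // i; rewrite /f'; case: splitP.
    rewrite E /row_free eqn_leq rank_leq_row /= -addsmxE add1n.
    have : (rows f x < row a (r (PGL_act h x)) + rows f x)%MS.
      rewrite ltmxE addsmxSr /=; apply: contra nS; apply: submx_trans.
      exact: addsmxSl.
    have frx : row_free (rows f x).
      by apply/row_freeP; exists (C *m invmx (rows f x *m C)); rewrite mulmxA mulmxV.
    by rewrite ltmxErank => /andP[_]; apply: leq_ltn_trans; move/eqP: frx => ->.
  by move=> /mmax; rewrite add1n ltnn.
have NM x : G x -> rows f x *m N x = 0.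
  by move=> [_ uC]; rewrite /N mulmxBr mulmx1 !mulmxA mulmxV // mul1mx subrr.
have NC x : G x -> N x *m C = 0.
  by move=> [_ uC]; rewrite /N mulmxBl mul1mx -!mulmxA mulVmx // mulmx1 subrr.
have Nid p x (w : 'M[k]_(M, p)) : rows f x *m w = 0 -> N x *m w = w.
  by move=> H; rewrite /N mulmxBl mul1mx -!mulmxA H !mulmx0 subr0.
exists G, N; split.
- split; last by exists x1; split=> //; rewrite MC unitmx1.
  rewrite openE => x [Ax uC].
  by apply: filterS2 (near_adm _ Ax) (near_unitmx (rC _ Ax) uC).
- by move=> x [[]].
- move=> x [Ax uC]; apply: mx_regular_atB; first exact: mx_regular_at_cst.
  apply: mx_regular_atM (rows_reg _ Ax).
  apply: mx_regular_atM; first exact: mx_regular_at_cst.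
  exact: mx_regular_at_inv (rC _ Ax) uC.
- move=> h x Gx Ghx.
  (* N(x) N(hx) equals N(hx) because x and hx have the same relations, and equals N(x) because N(x)
     C = 0 while N(hx) differs from 1 by a right multiple of C. *)
  have H : rows f x *m N (PGL_act h x) = 0.
    apply/(kerP _ _ _ Gx)/(orbit_relation_act h)/(kerP _ _ _ Ghx).
    exact: NM.
  rewrite -[LHS](Nid _ _ _ H) {2}/N mulmxBr mulmx1 !mulmxA (NC _ Gx).
  by rewrite !mul0mx subr0.
- move=> x Gx; split; first by apply/(kerP _ _ _ Gx); exact: NM.
  by move=> p w /(kerP _ _ _ Gx); exact: Nid.
Qed.

End Descent.

(** * Equivariant maps at points: central elements and linear independence *)

Section EquivariantMaps.
Context {k : fieldType} {n : nat} (X : Pvariety k n).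
Implicit Types f g : kn X.

Lemma kn_funD f g :
  generically (fun x => kn_fun (f + g) x = kn_fun f x + kn_fun g x).
Proof. exact: kn_classE (kn_add_subproof f g). Qed.

Lemma kn_funM f g :
  generically (fun x => kn_fun (f * g) x = kn_fun f x *m kn_fun g x).
Proof. exact: kn_classE (kn_mul_subproof f g). Qed.

Lemma kn_funZ c f : generically (fun x => kn_fun (c *: f) x = c *: kn_fun f x).
Proof. exact: kn_classE (kn_scale_subproof c f). Qed.

Lemma kn_fun0 : generically (fun x => kn_fun (0 : kn X) x = 0).
Proof.
have := kn_classE (kn_cst_subproof X 0).
by apply: generically1 => x ->; rewrite raddf0.
Qed.

Lemma kn_fun1 : generically (fun x => kn_fun (1 : kn X) x = 1%:M).
Proof. exact: kn_classE (kn_cst_subproof X 1). Qed.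

Lemma kn_fun_sigma f :
  generically (fun x => kn_fun (kn_sigma f) x = (kn_fun f (pv_act (P_tau k n) x))^T).
Proof. exact: kn_classE (kn_sigma_subproof f). Qed.

Lemma kn_funN f : generically (fun x => kn_fun (- f) x = - kn_fun f x).
Proof. by have := kn_funZ (-1) f; apply: generically1 => x ->; rewrite scaleN1r. Qed.

Lemma kn_fun_sum (I : Type) (s : seq I) (F : I -> kn X) :
  generically (fun x => kn_fun (\sum_(i <- s) F i) x = \sum_(i <- s) kn_fun (F i) x).
Proof.
elim: s => [|i s IH].
  by have := kn_fun0; rewrite big_nil; apply: generically1 => x ->; rewrite big_nil.
have := generically_and (kn_funD (F i) (\sum_(j <- s) F j)) IH.
by rewrite big_cons; apply: generically1 => x [-> ->]; rewrite big_cons.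
Qed.

Lemma kn_fun_regular f : generically (fun x => mx_regular_at x (kn_fun f)).
Proof. exact: kn_fun_rational. Qed.

Lemma PGL_conj_regular (Y : kspace k) (h : PGL k n) (y : Y) (f : Y -> 'M[k]_n) :
  mx_regular_at y f -> mx_regular_at y (fun z => PGL_conj h (f z)).
Proof.
by move=> rf; do ?apply: mx_regular_atM => //; exact: mx_regular_at_cst.
Qed.

(** Equivariance in [kn] is only generic, with a generic set depending on h. Orbit relations need it
    at given points, which regularity on both sides provides. *)
Lemma kn_fun_act f h x : mx_regular_at x (kn_fun f) ->
  mx_regular_at (PGL_act h x) (kn_fun f) ->
  kn_fun f (PGL_act h x) = PGL_conj h (kn_fun f x).
Proof.
move=> rx rhx; apply: (@mx_regular_generically_eq _ _ _ _ x
  (fun y => kn_fun f (PGL_act h y)) (fun y => PGL_conj h (kn_fun f y))).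
- exact: mx_regular_at_comp (PGL_act_morphism_at h x) rhx.
- exact: PGL_conj_regular.
- exact: kn_fun_equivariant.
Qed.

Definition kn_central (z : kn X) := forall f, z * f = f * z.

Lemma scalar_kn_central z : generically (fun x => exists c, kn_fun z x = c%:M) ->
  kn_central z.
Proof.
move=> sz f; apply: knP.
have := generically_and sz (generically_and (kn_funM z f) (kn_funM f z)).
by apply: generically1 => x [[c E] [-> ->]]; rewrite E scalar_mxC.
Qed.

Hypothesis X_irr : irreducible_space X.

(** Conjugation fixes scalar matrices, so an invariant rational function times the identity is
    equivariant. *)
Lemma invariant_kn (G : set X) (z : X -> k) : open G -> G !=set0 ->
  (forall x, G x -> regular_at x z) ->
  (forall h x, G x -> G (PGL_act h x) -> z (PGL_act h x) = z x) ->
  exists f : kn X, generically (fun x => kn_fun f x = (z x)%:M).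
Proof.
move=> oG [x0 Gx0] rz iz.
have gG : generically G by exact: irreducible_open oG Gx0.
have P : kn_pred (fun x => (z x)%:M : affine_space k n n).
  apply: kn_predP => [|h].
    apply: generically1 gG => x /rz rx i j.
    apply: (@regular_at_eqfun _ _ _ (fun y => z y * (i == j)%:R)).
      by move=> y; rewrite mxE mulr_natr.
    by apply: regular_atM rx _; exact: regular_at_cst.
  have := generically_and gG (generically_act (P_PGL h) gG).
  apply: generically1 => x [Gx Ghx]; rewrite [X in X%:M]iz //.
  by rewrite /PGL_conj mul_mx_scalar -scalemxAl mulmxV ?PGL_unit // scalemx1.
by exists (kn_class P); exact: kn_classE.
Qed.

(** The map theta of the family b, with one flattened n x n matrix per row. *)
Definition kn_mx d (b : 'I_d -> kn X) (x : X) : 'M[k]_(d, n * n) :=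
  \matrix_(i, j) mxvec (kn_fun (b i) x) 0 j.

Lemma row_kn_mx d (b : 'I_d -> kn X) x i : row i (kn_mx b x) = mxvec (kn_fun (b i) x).
Proof. by apply/rowP => j; rewrite !mxE. Qed.

Lemma mul_kn_mx d (b : 'I_d -> kn X) x (w : 'rV_d) :
  w *m kn_mx b x = mxvec (\sum_i w 0 i *: kn_fun (b i) x).
Proof.
rewrite linear_sum mulmx_sum_row; apply: eq_bigr => i _.
by rewrite row_kn_mx linearZ.
Qed.

Lemma kn_mx_regular d (b : 'I_d -> kn X) x :
  (forall i, mx_regular_at x (kn_fun (b i))) -> mx_regular_at x (kn_mx b).
Proof.
move=> H i; case/mxvec_indexP => a c.
by apply: regular_at_eqfun (H i a c) => y; rewrite mxE mxvecE.
Qed.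

(* If the values were dependent, the invariant projector onto the space of
   relations would yield a relation with central coefficients. *)
Lemma kn_mx_row_free (i0 : 'I_n) d (b : 'I_d -> kn X) :
  (forall z, (forall i, kn_central (z i)) -> \sum_i z i * b i = 0 ->
    forall i, z i = 0) ->
  generically (fun x => row_free (kn_mx b x)).
Proof.
move=> b_free; have [D [oD dD sD]] := generically_forall (fun i => kn_fun_regular (b i)).
have D0 : D !=set0.
  by have [x [_ Dx]] := dD setT X_irr.1 openT; exists x.
pose r x := (kn_mx b x)^T.
have rr x : D x -> mx_regular_at x r.
  move=> /sD /kn_mx_regular H i j.
  by apply: regular_at_eqfun (H j i) => y; rewrite [RHS]mxE.
have [G [N [[oG G0] sG rN iN relN]]] := invariant_projector oD D0 rr.
(* The entries of a column of N are invariant, so they are the coefficients of a relation among the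
   b_i over the center; the hypothesis makes them vanish. *)
have N0 x : G x -> N x = 0.
  move=> Gx; apply/matrixP => i j.
  have inv l : exists f : kn X, generically (fun x => kn_fun f x = (N x l j)%:M).
    apply: (invariant_kn oG G0) => [y /rN|h y Gy Ghy]; first exact.
    by rewrite iN.
  have [z zE] := choice inv.
  have zc l : kn_central (z l).
    by apply: scalar_kn_central; apply: generically1 (zE l) => y ->; exists (N y l j).
  have gG : generically G by have [y Gy] := G0; exact: irreducible_open oG Gy.
  have S0 : \sum_l z l * b l = 0.
    apply: knP.
    have := generically_and (generically_and kn_fun0 gG)
     (generically_and (kn_fun_sum (index_enum _) (fun l => z l * b l))
     (generically_and (generically_forall (fun l => kn_funM (z l) (b l)))
       (generically_forall zE))).
    apply: generically1 => y [[-> Gy] [-> [E1 E2]]].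
    have [H _] := relN _ Gy; have := H 1%g; rewrite PGL_act1 => /(_ (sG _ Gy)).
    move=> Hy; have : (col j (N y))^T *m kn_mx b y = mxvec 0.
      by apply: trmx_inj; rewrite trmx_mul trmxK colE mulmxA Hy mul0mx !linear0.
    rewrite mul_kn_mx => /(can_inj mxvecK) S0; rewrite -[RHS]S0.
    by apply: eq_bigr => l _; rewrite E1 E2 mul_scalar_mx !mxE.
  rewrite [RHS]mxE; apply: (regular_generically0 (rN _ Gx i j)).
  have := generically_and (zE i) kn_fun0; rewrite (b_free _ zc S0 i).
  apply: generically1 => y [-> /matrixP/(_ i0 i0)].
  by rewrite !mxE eqxx.
have gG : generically G by have [y Gy] := G0; exact: irreducible_open oG Gy.
apply: generically1 gG => x Gx; rewrite -kermx_eq0; apply/rowV0P => w.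
(* A relation at x is carried by conjugation to every translate, so w is an orbit relation, whence w
   = N w = 0. *)
move=> /sub_kermxP wK; apply: trmx_inj; rewrite trmx0.
have [_ /(_ _ w^T) H] := relN _ Gx; rewrite -[LHS]H ?N0 ?mul0mx // => h Dh.
apply: trmx_inj; rewrite trmx_mul !trmxK trmx0 mul_kn_mx.
have E i : kn_fun (b i) (PGL_act h x) = PGL_conj h (kn_fun (b i) x).
  by apply: kn_fun_act; [exact: sD (sG _ Gx) i|exact: sD Dh i].
have -> : \sum_i w 0 i *: kn_fun (b i) (PGL_act h x) =
    PGL_conj h (\sum_i w 0 i *: kn_fun (b i) x).
  rewrite /PGL_conj mulmx_sumr mulmx_suml; apply: eq_bigr => i _.
  by rewrite E /PGL_conj -scalemxAr -scalemxAl.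
have -> : \sum_i w 0 i *: kn_fun (b i) x = 0.
  by apply: (can_inj mxvecK); rewrite -mul_kn_mx wK linear0.
by rewrite /PGL_conj mulmx0 mul0mx linear0.
Qed.

Lemma cent_scalar_mx (i0 : 'I_n) (A : 'M[k]_n) :
  (forall B, A *m B = B *m A) -> A = (A i0 i0)%:M.
Proof.
move=> H; apply/matrixP => i j; have /matrixP/(_ i i0) := H (delta_mx j i0).
rewrite !mxE (bigD1 j) //= [X in _ + X]big1 => [|l lj]; last first.
  by rewrite !mxE (negPf lj) mulr0.
rewrite (bigD1 i0) //= [X in _ = _ + X]big1 => [|l li]; last first.
  by rewrite !mxE (negPf li) andbF mul0r.
by rewrite !mxE !eqxx andbT !addr0 mulr1 => ->; case: (i == j); rewrite ?mul1r ?mul0r.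
Qed.

Lemma kn_mx_span (b : 'I_(n * n) -> kn X) x M : row_free (kn_mx b x) ->
  exists w : 'rV_(n * n), M = \sum_i w 0 i *: kn_fun (b i) x.
Proof.
rewrite row_free_unit => ub; exists (mxvec M *m invmx (kn_mx b x)).
by apply: (can_inj mxvecK); rewrite -mul_kn_mx mulmxKV.
Qed.

(** The b_i(x) span all matrices, so the value of z commutes with every matrix. *)
Lemma kn_central_scalar (i0 : 'I_n) (b : 'I_(n * n) -> kn X) z :
  kn_central z -> generically (fun x => row_free (kn_mx b x)) ->
  generically (fun x => kn_fun z x = (kn_fun z x i0 i0)%:M).
Proof.
move=> zc gb.
have := generically_and gb (generically_and
  (generically_forall (fun i => kn_funM z (b i)))
  (generically_forall (fun i => kn_funM (b i) z))).
apply: generically1 => x [fb [zb bz]]; apply: cent_scalar_mx => B.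
have [w ->] := kn_mx_span B fb.
rewrite mulmx_sumr mulmx_suml; apply: eq_bigr => i _.
by rewrite -scalemxAr -scalemxAl -zb -bz zc.
Qed.

End EquivariantMaps.

(** * Rational functions in terms of central elements *)

Section PolynomialDegree.
Context {k : fieldType} {p q : nat}.
Implicit Types (f g : affine_space k p q -> k) (d e : nat).

(** [mmeasure mdeg] is one more than the total degree, and 0 at the zero polynomial: the bound means
    degree at most d. *)
Definition polyfun_deg d f :=
  exists P : mpoly (p * q) k, (mmeasure mdeg P <= d.+1)%N /\ forall t, f t = polyfun P t.

Lemma polyfun_degW d e f : (d <= e)%N -> polyfun_deg d f -> polyfun_deg e f.
Proof. by move=> de [P [sP Pf]]; exists P; split=> //; apply: leq_trans sP _. Qed.

Lemma polyfun_deg_ext d f g : f =1 g -> polyfun_deg d f -> polyfun_deg d g.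
Proof. by move=> /funext ->. Qed.

Lemma polyfun_deg_cst d c : polyfun_deg d (fun=> c).
Proof.
exists (mpolyC _ c); split=> [|t]; last by rewrite /polyfun mevalC.
by rewrite mmeasureC; case: (c == 0).
Qed.

Lemma polyfun_degD d f g : polyfun_deg d f -> polyfun_deg d g ->
  polyfun_deg d (fun t => f t + g t).
Proof.
move=> [P [sP Pf]] [Q [sQ Qg]]; exists (P + Q); split=> [|t].
  by apply: leq_trans (mmeasureD_le _ _ _) _; rewrite geq_max sP.
by rewrite Pf Qg /polyfun mevalD.
Qed.

Lemma polyfun_degM d e f g : polyfun_deg d f -> polyfun_deg e g ->
  polyfun_deg (d + e) (fun t => f t * g t).
Proof.
move=> [P [sP Pf]] [Q [sQ Qg]]; exists (P * Q); split=> [|t].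
  have [->|P0] := eqVneq P 0; first by rewrite mul0r mmeasure0.
  have [->|Q0] := eqVneq Q 0; first by rewrite mulr0 mmeasure0.
  rewrite msizeM // -subn1 leq_subLR add1n -addSn -addnS; exact: leq_add.
by rewrite Pf Qg /polyfun mevalM.
Qed.

Lemma polyfun_deg_sum (I : Type) (s : seq I) (F : I -> _) d :
  (forall i, polyfun_deg d (F i)) -> polyfun_deg d (fun t => \sum_(i <- s) F i t).
Proof.
move=> H; elim: s => [|i s IH].
  by apply: polyfun_deg_ext (polyfun_deg_cst d 0) => t; rewrite big_nil.
by apply: polyfun_deg_ext (polyfun_degD (H i) IH) => t; rewrite big_cons.
Qed.

Lemma polyfun_deg_prod (I : Type) (s : seq I) (F : I -> _) (d : I -> nat) :
  (forall i, polyfun_deg (d i) (F i)) ->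
  polyfun_deg (\sum_(i <- s) d i) (fun t => \prod_(i <- s) F i t).
Proof.
move=> H; elim: s => [|i s IH].
  by rewrite big_nil; apply: polyfun_deg_ext (polyfun_deg_cst 0 1) => t; rewrite big_nil.
by rewrite big_cons; apply: polyfun_deg_ext (polyfun_degM (H i) IH) => t; rewrite big_cons.
Qed.

Lemma polyfun_degX d m f : polyfun_deg d f -> polyfun_deg (d * m) (fun t => f t ^+ m).
Proof.
move=> H; elim: m => [|m IH].
  by rewrite muln0; apply: polyfun_deg_ext (polyfun_deg_cst 0 1) => t; rewrite expr0.
by rewrite mulnS; apply: polyfun_deg_ext (polyfun_degM H IH) => t; rewrite exprS.
Qed.

Lemma polyfun_deg_coord i j : polyfun_deg 1 (fun t => t i j).
Proof.
exists (mpolyX k (mnm1 (mxvec_index i j))); split=> [|t].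
  by rewrite mmeasureX /= mdeg1.
by rewrite /polyfun mevalXU mxvecE.
Qed.

Lemma polyfun_deg_comp a b (L : affine_space k p q -> affine_space k a b)
    (P : mpoly (a * b) k) : (forall i j, polyfun_deg 1 (fun t => L t i j)) ->
  polyfun_deg (mmeasure mdeg P) (fun t => polyfun P (L t)).
Proof.
move=> HL; pose d := mmeasure mdeg P.
apply: (@polyfun_deg_ext _ (fun t => \sum_(m <- msupp P | m \in msupp P)
   mcoeff m P * \prod_i (mxvec (L t) 0 i) ^+ m i)).
  by move=> t; rewrite /polyfun mevalE [RHS]big_seq.
(* Only monomials of the support have bounded degree, while [polyfun_deg_sum] asks for a bound at
   every index; the other terms are replaced by 0. *)
have H m : polyfun_deg d (fun t => if m \in msupp P then
    mcoeff m P * \prod_i (mxvec (L t) 0 i) ^+ m i else 0).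
  case mP: (m \in msupp P); last exact: polyfun_deg_cst.
  apply: (@polyfun_degW (0 + \sum_i (1 * m i)%N)%N).
    rewrite add0n (eq_bigr (fun i => m i)) => [|i _]; last by rewrite mul1n.
    by rewrite -mdegE ltnW // msize_mdeg_lt.
  apply: polyfun_degM; first exact: polyfun_deg_cst.
  apply: polyfun_deg_prod => i; apply: polyfun_degX.
  case/mxvec_indexP: i => i j.
  by apply: polyfun_deg_ext (HL i j) => t; rewrite mxvecE.
by apply: polyfun_deg_ext (polyfun_deg_sum (msupp P) H) => t; rewrite -big_mkcond.
Qed.

Lemma polyfun_deg_det m (L : affine_space k p q -> 'M[k]_m) :
  (forall i j, polyfun_deg 1 (fun t => L t i j)) ->
  polyfun_deg m (fun t => \det (L t)).
Proof.
move=> HL; rewrite /determinant; apply: polyfun_deg_sum => s.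
rewrite -[X in polyfun_deg X]add0n; apply: polyfun_degM; first exact: polyfun_deg_cst.
have := polyfun_deg_prod (index_enum _) (fun i => HL i (s i)).
by rewrite sum1_card card_ord.
Qed.

Definition monomial_fun d (i : 'I_#|{: bmultinom (p * q) d.+1}|)
  (t : affine_space k p q) : k := polyfun (mpolyX k (bmnm (enum_val i))) t.

Lemma polyfun_deg_span d f : polyfun_deg d f ->
  exists c, forall t, f t = \sum_i c i * @monomial_fun d i t.
Proof.
move=> [P [sP Pf]]; exists (fun i => mcoeff (bmnm (enum_val i)) P) => t.
rewrite Pf {1}(mpolywE sP) /polyfun raddf_sum /= (reindex_onto enum_val enum_rank) /=.
  by apply: eq_big => [i|i _]; rewrite ?enum_valK ?eqxx // mevalZ.
by move=> m _; rewrite enum_rankK.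
Qed.

End PolynomialDegree.

Section AffineSubspaces.
Context {k : fieldType} {p q : nat} (S : set (affine_kspace k p q)).

Lemma sub_regular_at_polyfun P (a : sub_kspace S) :
  regular_at a (fun b : sub_kspace S => polyfun P (set_val b)).
Proof.
by exists (polyfun P); split; [exact: regular_at_polyfun|exact: filterE].
Qed.

Lemma sub_regular_fraction (a : sub_kspace S) (f : sub_kspace S -> k) :
  regular_at a f -> exists P Q : mpoly (p * q) k, polyfun Q (set_val a) != 0 /\
    \forall b \near a, polyfun Q (set_val b) * f b = polyfun P (set_val b).
Proof.
move=> [F [[P [Q [Q0 E]]] fF]]; exists P, Q; split=> //.
have E' := near_set_val (S := S) E.
have Q' := regular_at_neq0 (sub_regular_at_polyfun Q a) Q0.
by apply: filterS3 fF E' Q' => b -> -> Qb; rewrite mulrC divfK.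
Qed.

End AffineSubspaces.

(** * Regular functions along an orbit, as fractions on GL_n *)

Section OrbitMaps.
Context {k : closedFieldType} {n : nat}.

(* A pair (P, c) stands for the function [P(A) c(x)] on M_n x Z. *)
Definition sum_eval (Z : Type) (s : seq (mpoly (n * n) k * (Z -> k)))
    (A : 'M[k]_n) (x : Z) : k :=
  \sum_(ab <- s) polyfun ab.1 (A : affine_space k n n) * ab.2 x.

Definition sum_scale (Z : Type) (Q : mpoly (n * n) k)
    (s : seq (mpoly (n * n) k * (Z -> k))) := [seq (Q * ab.1, ab.2) | ab <- s].

Lemma sum_evalZ Z Q (s : seq (mpoly (n * n) k * (Z -> k))) A x :
  sum_eval (sum_scale Q s) A x = polyfun Q (A : affine_space k n n) * sum_eval s A x.
Proof.
rewrite /sum_eval big_map mulr_sumr; apply: eq_bigr => ab _.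
by rewrite /polyfun mevalM mulrA.
Qed.

Lemma regular_at_sum_eval Z (s : seq (mpoly (n * n) k * (Z -> k))) x
    (g : GL_kspace k n) : regular_at g (fun h : GL_kspace k n => sum_eval s (GL_mx h) x).
Proof.
apply: regular_at_sum => ab.
by apply: regular_atM; [exact: sub_regular_at_polyfun|exact: regular_at_cst].
Qed.

(** Only the factors on GL_n are cleared of denominators. Those on X stay arbitrary functions, as
    they become constants once x is fixed; this is why the identity holds for all x. *)
Lemma tensor_clear_denominators (X : kspace k) (u : prod_kspace (GL_kspace k n) X) s :
  tensor_regular_at u s ->
  exists (Q : mpoly (n * n) k) (s' : seq (mpoly (n * n) k * (X -> k))),
    polyfun Q (GL_mx u.1) != 0 /\
    \forall h \near u.1, forall x,
      polyfun Q (GL_mx h) * tensor_eval s (h, x) = sum_eval s' (GL_mx h) x.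
Proof.
elim: s => [_|ab s IH H].
  exists 1, [::]; rewrite /polyfun meval1 oner_neq0; split=> //.
  by apply: filterE => h x; rewrite /tensor_eval /sum_eval !big_nil mulr0.
have [|Q [s' [Q0 E]]] := IH; first by move=> cd cds; apply: H; rewrite inE cds orbT.
have [/sub_regular_fraction[P [R [R0 ER]]] _] := H ab (mem_head _ _).
exists (R * Q), ((Q * P, ab.2) :: sum_scale R s'); split.
  by rewrite /polyfun mevalM mulf_neq0.
apply: filterS2 E ER => h E ER x; rewrite -/(GL_mx h) in ER.
have /= := E x; rewrite /tensor_eval /sum_eval !big_cons => E'.
rewrite -/(sum_eval (sum_scale R s') _ _) sum_evalZ /sum_eval -E'.
rewrite /polyfun !mevalM -/(polyfun _ _) -/(polyfun R _) -/(polyfun P _) -ER /=.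
by rewrite mulrDr; congr (_ + _); ring.
Qed.

Lemma GL_act1 (X : Pvariety k n) (x : X) : GL_act (GL_of (unitmx1 k n)) x = x.
Proof. exact: (PGL_act1 x). Qed.

Lemma GL_act_regular (X : Pvariety k n) (f : X -> k) x (g : GL_kspace k n) :
  regular_at (GL_act g x) f -> regular_at g (fun h : GL_kspace k n => f (GL_act h x)).
Proof.
move=> rf; have m := morphism_at_comp
  (morphism_pair (morphism_at_id g) (morphism_at_cst x g)) (@GL_act_morphism k n X (g, x)).
by case: m => _; apply.
Qed.

(** Near (1, x0), f(gx) is a fraction of sums of products of a polynomial in g and a function of x.
    For fixed x the cleared identity spreads from g near 1 by irreducibility of GL_n. The
    polynomials in g, hence their degrees, do not depend on x. *)
Lemma regular_orbit_fraction (X : Pvariety k n) (f : X -> k) x0 : regular_at x0 f ->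
  exists s t : seq (mpoly (n * n) k * (X -> k)),
  \forall x \near x0, sum_eval t 1%:M x != 0 /\
    forall g : GL_kspace k n, regular_at (GL_act g x) f ->
      f (GL_act g x) * sum_eval t (GL_mx g) x = sum_eval s (GL_mx g) x.
Proof.
pose e := GL_of (unitmx1 k n); have e1 x : GL_act e x = x := GL_act1 x.
move=> rf; have [_ m] := @GL_act_morphism k n X (e, x0).
have {m} := m f; rewrite /= e1 => /(_ rf) [s [t [rs rt t0 E]]].
have [Qs [s' [Qs0 Es]]] := tensor_clear_denominators rs.
have [Qt [t' [Qt0 Et]]] := tensor_clear_denominators rt.
exists (sum_scale Qt s'), (sum_scale Qs t').
have {}E : \forall u \near (e, x0) : prod_kspace (GL_kspace k n) X,
    f (GL_act u.1 u.2) = tensor_eval s u / tensor_eval t u /\ tensor_eval t u != 0.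
  by apply: filterS2 E (tensor_near_neq0 rt t0).
have Ex : \forall x \near x0, \forall u \near (e, x) : prod_kspace (GL_kspace k n) X,
    f (GL_act u.1 u.2) = tensor_eval s u / tensor_eval t u /\ tensor_eval t u != 0.
  have [c _] := morphism_pair (morphism_at_cst (e : GL_kspace k n) x0) (morphism_at_id x0).
  exact: c (near_join E).
apply: filterS Ex => x Ex.
have Eg : \forall g \near e, f (GL_act g x) = tensor_eval s (g, x) / tensor_eval t (g, x)
    /\ tensor_eval t (g, x) != 0.
  have [c _] := morphism_pair (morphism_at_id (e : GL_kspace k n)) (morphism_at_cst x e).
  exact: c Ex.
split.
  have [_ te] := nbhs_singleton Eg.
  rewrite sum_evalZ -(nbhs_singleton Et x).
  by rewrite !mulf_neq0.
move=> g rg; apply/eqP; rewrite -subr_eq0; apply/eqP.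
apply: (@regular_generically0 k (GL_kspace k n) g (fun g => f (GL_act g x) *
  sum_eval (sum_scale Qs t') (GL_mx g) x - sum_eval (sum_scale Qt s') (GL_mx g) x)).
  apply: regular_atB; last exact: regular_at_sum_eval.
  by apply: regular_atM; [exact: GL_act_regular|exact: regular_at_sum_eval].
apply: (@irreducible_near _ (GL_irreducible n) _ e).
apply: filterS3 Eg Es Et => h [Eh th] Es Et.
rewrite !sum_evalZ -Es -Et Eh.
by field.
Qed.

End OrbitMaps.

Section Generation.
Context {k : closedFieldType} {n : nat} (X : Pvariety k n).
Hypothesis X_irr : irreducible_space X.
Context (i0 : 'I_n) (b : 'I_(n * n) -> kn X).
Local Notation T := (affine_space k (n * n) (n * n)).

Lemma sum_eval_deg m (L : T -> 'M[k]_n) (s : seq (mpoly (n * n) k * (X -> k))) x :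
  (forall i j, polyfun_deg 1 (fun t => L t i j)) ->
  (\sum_(ab <- s) mmeasure mdeg ab.1 <= m)%N ->
  polyfun_deg m (fun t => sum_eval s (L t) x).
Proof.
move=> HL; elim: s m => [|ab s IH] m Hm.
  by apply: polyfun_deg_ext (polyfun_deg_cst m 0) => t; rewrite /sum_eval big_nil.
move: Hm; rewrite big_cons => Hm.
have H1 : polyfun_deg m (fun t => polyfun ab.1 (L t : affine_space k n n) * ab.2 x).
  apply: (@polyfun_degW _ _ _ (mmeasure mdeg ab.1 + 0)%N).
    by rewrite addn0; apply: leq_trans Hm; rewrite leq_addr.
  by apply: polyfun_degM; [exact: polyfun_deg_comp|exact: polyfun_deg_cst].
have H2 : polyfun_deg m (fun t => sum_eval s (L t) x).
  by apply: IH; apply: leq_trans Hm; rewrite leq_addl.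
by apply: polyfun_deg_ext (polyfun_degD H1 H2) => t; rewrite /sum_eval big_cons.
Qed.

(* Up to the scalar [(g^-1) i0 i0], the entries of g are linear in the matrices
   [g b_i(x) g^-1 = b_i(g x)]: expand the matrix units in the basis [b_i(x)].
   The factor [\det (L t)] disposes of the g for which this scalar vanishes. *)
Lemma orbit_polynomial (f : X -> k) x0 : regular_at x0 f -> exists d,
  \forall x \near x0, (forall i, mx_regular_at x (kn_fun (b i))) ->
  row_free (kn_mx b x) -> exists u v : T -> k,
  [/\ polyfun_deg d u, polyfun_deg d v, v (kn_mx b x) != 0 &
    forall h, regular_at (PGL_act h x) f ->
      (forall i, mx_regular_at (PGL_act h x) (kn_fun (b i))) ->
      f (PGL_act h x) * v (kn_mx b (PGL_act h x)) = u (kn_mx b (PGL_act h x))].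
Proof.
move=> /regular_orbit_fraction[s [t H]].
(* n bounds the degree of the determinant, and the sums those of s and t in g. *)
exists (n + (\sum_(ab <- s) mmeasure mdeg ab.1 + \sum_(ab <- t) mmeasure mdeg ab.1))%N.
apply: filterS H => x [t1 E] rb fb.
(* [w r] holds the coordinates of the matrix unit e_(r, i0) in the basis b_i(x); column r of [L A]
   is column i0 of the same combination of the rows of A. *)
have [w wE] := choice (fun r : 'I_n => kn_mx_span (delta_mx r i0) fb).
pose L (A : T) : 'M[k]_n := \matrix_(a, r) \sum_i w r 0 i * A i (mxvec_index a i0).
have degL a r : polyfun_deg 1 (fun A => L A a r).
  apply: (@polyfun_deg_ext _ _ _ _ (fun A => \sum_i w r 0 i * A i (mxvec_index a i0))).
    by move=> A; rewrite mxE.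
  apply: polyfun_deg_sum => i.
  by apply: (@polyfun_degM _ _ _ 0 1); [exact: polyfun_deg_cst|exact: polyfun_deg_coord].
have LE y a r : L (kn_mx b y) a r = (\sum_i w r 0 i *: kn_fun (b i) y) a i0.
  by rewrite mxE summxE; apply: eq_bigr => i _; rewrite !mxE mxvecE.
exists (fun A => \det (L A) * sum_eval s (L A) x),
  (fun A => \det (L A) * sum_eval t (L A) x); split.
- apply: polyfun_degM; first exact: polyfun_deg_det.
  by apply: sum_eval_deg => //; rewrite leq_addr.
- apply: polyfun_degM; first exact: polyfun_deg_det.
  by apply: sum_eval_deg => //; rewrite leq_addl.
- have -> : L (kn_mx b x) = 1%:M.
    by apply/matrixP => a r; rewrite LE -wE !mxE eqxx andbT.
  by rewrite det1 mul1r.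
move=> h rf rbh.
have -> : L (kn_mx b (PGL_act h x)) = invmx (PGL_mx h) i0 i0 *: PGL_mx h.
  apply/matrixP => a r; rewrite LE.
  have -> : \sum_i w r 0 i *: kn_fun (b i) (PGL_act h x) = PGL_conj h (delta_mx r i0).
    rewrite wE /PGL_conj mulmx_sumr mulmx_suml; apply: eq_bigr => i _.
    by rewrite kn_fun_act // /PGL_conj -scalemxAr -scalemxAl.
  rewrite /PGL_conj -(mul_delta_mx (0 : 'I_1)) mulmxA -colE -mulmxA -rowE.
  by rewrite !mxE big_ord1 !mxE mulrC.
(* If c = 0, both sides vanish through the determinant, n being positive. Otherwise [c *: PGL_mx h]
   is another representative of h, and the fraction is evaluated there. *)
set c := invmx _ _ _; have [->|c0] := eqVneq c 0.
  have n0 : (n == 0)%N = false by case: (n) i0 => [[]|].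
  by rewrite detZ expr0n n0 !mul0r mulr0.
have uc : c *: PGL_mx h \in unitmx by rewrite unitmxZ ?unitfE // PGL_unit.
have hE : PGL_class (GL_of uc) = h.
  by apply/PGL_mxP; have [e [e0 ->]] := PGL_mx_class uc; exists (e * c);
    rewrite mulf_neq0 // scalerA.
have := E (GL_of uc); rewrite /GL_act hE => /(_ rf) <-.
by rewrite mulrCA.
Qed.

Hypothesis b_free : generically (fun x => row_free (kn_mx b x)).

Lemma central_generation (f : X -> k) : generically (fun x => regular_at x f) ->
  exists d (u v : 'I_#|{: bmultinom (n * n * (n * n)) d.+1}| -> kn X),
    [/\ forall i, kn_central (u i), forall i, kn_central (v i) &
    generically (fun x =>
      let Q := fun w : 'I_ _ -> kn X =>
         \sum_i kn_fun (w i) x i0 i0 * monomial_fun i (kn_mx b x : T) in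
      Q v != 0 /\ f x * Q v = Q u)].
Proof.
move=> gf.
have [D [oD dD sD]] := generically_and gf (generically_and b_free
  (generically_forall (fun i => kn_fun_regular (b i)))).
have [x0 [_ Dx0]] := dD setT X_irr.1 openT.
have [d Hd] := orbit_polynomial (sD _ Dx0).1.
exists d; set m := #|_|.
pose Q x : 'rV[k]_m := \row_i monomial_fun i (kn_mx b x : T).
(* A column with upper half v and lower half u is killed by r exactly when f Q v = Q u. *)
pose r x : 'M[k]_(1, m + m) := row_mx (f x *: Q x) (- Q x).
have rQ x : D x -> mx_regular_at x Q.
  move=> /sD[_ [_ rb]] i j.
  have rp := @regular_at_meval _ _ _ X x (kn_mx b)
    (mpolyX k (bmnm (enum_val j))) (kn_mx_regular rb).
  by apply: regular_at_eqfun rp => y; rewrite [RHS]mxE.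
have rr x : D x -> mx_regular_at x r.
  move=> Dx i j; have [rf _] := sD _ Dx; have rq := rQ _ Dx.
  case: (split_ordP j) => l ->.
    by apply: regular_at_eqfun (mx_regular_atZ rf rq i l) => y; rewrite [RHS]row_mxEl.
  apply: regular_at_eqfun (regular_atN (rq i l)) => y.
  by rewrite [RHS]row_mxEr [RHS]mxE.
have D0 : D !=set0 by exists x0.
have [G [N [[oG G0] sG rN iN relN]]] := invariant_projector oD D0 rr.
have gG : generically G by have [y Gy] := G0; exact: irreducible_open oG Gy.
have [x1 [Gx1 Hx1]] := generically_near gG Hd.
have Dx1 := sG _ Gx1; have [rf1 [fb1 rb1]] := sD _ Dx1.
have [u0 [v0 [/polyfun_deg_span[cu Eu] /polyfun_deg_span[cv Ev] v0x1 Huv]]] :=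
  Hx1 rb1 fb1.
pose w : 'cV[k]_(m + m) := col_mx (\col_i cv i) (\col_i cu i).
have Qcol y (c : 'I_m -> k) :
    Q y *m (\col_i c i) = (\sum_i c i * monomial_fun i (kn_mx b y : T))%:M.
  by apply/matrixP => i j; rewrite !ord1 !mxE mulr1n; apply: eq_bigr => l _;
    rewrite !mxE mulrC.
have relw : orbit_relation r D x1 w.
  move=> h Dh; have [rfh [_ rbh]] := sD _ Dh.
  rewrite mul_row_col mulNmx -scalemxAl !Qcol -Eu -Ev -Huv //.
  by rewrite scale_scalar_mx subrr.
have [_ /(_ _ w relw) Nw] := relN _ Gx1.
(* A relation is useful only if its denominator is nonzero. N fixes w, whose denominator does not
   vanish at x1, so some column of N has this property too. *)
have [l Hl] : exists l, (Q x1 *m (col l (usubmx (N x1)))) 0 0 != 0.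
  apply: contrapT => nH.
  have QN : Q x1 *m usubmx (N x1) = 0.
    apply/matrixP => i j; rewrite ord1 [RHS]mxE; apply/eqP/negPn/negP => H.
    by apply: nH; exists j; rewrite colE mulmxA -colE mxE.
  move: v0x1; rewrite Ev; apply/negP/negPn; apply/eqP.
  have := congr1 usubmx Nw; rewrite col_mxKu -mul_usub_mx => /(congr1 (mulmx (Q x1))).
  by rewrite mulmxA QN mul0mx Qcol => /matrixP/(_ 0 0); rewrite !mxE mulr1n => <-.
have inv i : exists z : kn X, generically (fun x => kn_fun z x = (N x i l)%:M).
  apply: (invariant_kn X_irr oG G0) => [y /rN|h y Gy Ghy]; first exact.
  by rewrite iN.
have [z zE] := choice inv.
have zc i : kn_central (z i).
  by apply: scalar_kn_central; apply: generically1 (zE i) => y ->; exists (N y i l).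
exists (fun i => z (rshift m i)), (fun i => z (lshift m i)).
split=> [i|i|]; try exact: zc.
have gden : generically (fun x => (Q x *m (col l (usubmx (N x)))) 0 0 != 0).
  apply: (irreducible_near X_irr (x := x1)).
  have rden : mx_regular_at x1 (fun x => Q x *m (col l (usubmx (N x)))).
    apply: mx_regular_atM; first exact: rQ.
    move=> i j; apply: regular_at_eqfun (rN _ Gx1 (lshift m i) l) => y.
    by rewrite !mxE.
  exact: regular_at_neq0 (rden 0 0) Hl.
have := generically_and (generically_and gG gden) (generically_forall zE).
apply: generically1 => x [[Gx den] zx] /=.
have QE : Q x *m (col l (usubmx (N x))) =
    (\sum_i kn_fun (z (lshift m i)) x i0 i0 * monomial_fun i (kn_mx b x : T))%:M.
  rewrite -Qcol; congr (_ *m _); apply/colP => i.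
  by rewrite !mxE zx mxE eqxx.
have QE' : Q x *m (col l (dsubmx (N x))) =
    (\sum_i kn_fun (z (rshift m i)) x i0 i0 * monomial_fun i (kn_mx b x : T))%:M.
  rewrite -Qcol; congr (_ *m _); apply/colP => i.
  by rewrite !mxE zx mxE eqxx.
split; first by move: den; rewrite QE mxE eqxx.
have [/(_ 1%g) H _] := relN _ Gx; move: H; rewrite PGL_act1 => /(_ (sG _ Gx)).
move=> /(congr1 (col l)); rewrite colE -mulmxA -colE linear0.
have -> : col l (N x) = col_mx (col l (usubmx (N x))) (col l (dsubmx (N x))).
  by rewrite -{1}[N x]vsubmxK col_col_mx.
rewrite mul_row_col mulNmx -scalemxAl QE QE' => /eqP; rewrite subr_eq0 => /eqP.
by move=> /matrixP/(_ 0 0); rewrite !mxE eqxx.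
Qed.

End Generation.

(** * Values of central elements *)

Section Noetherianity.

(** Induction on the number of coordinates outside F, the set on which all elements of S' agree. Fix
    m0 in S'; an element not above m0 has some coordinate i with value below m0 i, so it lies in one
    of finitely many slices with one more fixed coordinate. *)
Lemma dickson n (S : set (multinom n)) : exists l : seq (multinom n),
  (forall m, m \in l -> S m) /\
  forall m, S m -> exists m', m' \in l /\ forall i, (m' i <= m i)%N.
Proof.
suff H j (F : {set 'I_n}) (S' : set (multinom n)) : (n - #|F| <= j)%N ->
    (forall m m', S' m -> S' m' -> forall i, i \in F -> m i = m' i) ->
    exists l : seq (multinom n), (forall m, m \in l -> S' m) /\
      forall m, S' m -> exists m', m' \in l /\ forall i, (m' i <= m i)%N.
  by apply: (H n finset.set0); rewrite ?leq_subr // => m m' _ _ i; rewrite inE.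
elim: j F S' => [|j IH] F S' cF HF;
  (have [[m0 Sm0]|S0] := pselect (exists m, S' m); last by
    exists [::]; split=> // m Sm; case: S0; exists m).
  exists [:: m0]; split=> [m|m Sm]; first by rewrite inE => /eqP ->.
  exists m0; rewrite mem_head; split=> // i; rewrite (HF m0 m) //.
  have -> : F = [set: 'I_n]%SET; last by rewrite inE.
  by apply/eqP; rewrite eqEcard finset.subsetT cardsT card_ord -subn_eq0 -leqn0.
pose S2 (p : 'I_n * nat) := [set m | S' m /\ m p.1 = p.2].
have HL p : exists l : seq (multinom n), (p.1 \notin F -> (forall m, m \in l -> S2 p m) /\
    forall m, S2 p m -> exists m', m' \in l /\ forall i, (m' i <= m i)%N) /\
    (forall m, m \in l -> S2 p m).
  have [pF|pF] := boolP (p.1 \in F); first by exists [::].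
  have [||l [l1 l2]] := IH (p.1 |: F)%SET (S2 p).
  - by rewrite cardsU1 pF subnS; case: (n - #|F|)%N cF.
  - move=> m m' [Sm Em] [Sm' Em'] i; rewrite !inE => /orP[/eqP ->|iF].
      by rewrite Em Em'.
    exact: HF.
  by exists l.
have [L HL'] := choice HL.
exists (m0 :: flatten [seq L (i, v) | i <- enum 'I_n, v <- iota 0 (m0 i)]); split.
  move=> m; rewrite inE => /orP[/eqP -> //|/flattenP[s /allpairsPdep[i [v [_ _ ->]]]]].
  by move=> mL; have [_ /(_ _ mL)[]] := HL' (i, v).
move=> m Sm; have [/forallP le|] := boolP [forall i, m0 i <= m i]%N.
  by exists m0; rewrite mem_head.
rewrite negb_forall => /existsP[i]; rewrite -ltnNge => lt.
have iF : i \notin F by apply: contraTN lt => iF; rewrite (HF m m0) // ltnn.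
have [/(_ iF)[_ H] _] := HL' (i, m i).
have [|m' [m'L le]] := H m; first by split.
exists m'; split=> //; rewrite inE; apply/orP; right; apply/flattenP.
exists (L (i, m i)) => //; apply/allpairsPdep; exists i, (m i).
by rewrite mem_enum mem_iota add0n leq0n.
Qed.

(* Divide by elements of I whose leading monomials generate those of I. *)
Lemma ideal_zeros_finite (k : fieldType) n (I : set (mpoly n k)) :
  (forall p q r, I p -> I q -> I (p - r * q)) ->
  exists l : seq (mpoly n k), (forall p, p \in l -> I p) /\
    forall z, (forall p, p \in l -> meval z p = 0) -> forall p, I p -> meval z p = 0.
Proof.
move=> HI.
have [l [lS Sl]] := dickson [set m | exists p, [/\ I p, p != 0 & mlead p = m]].
have : forall m, exists p, m \in l -> [/\ I p, p != 0 & mlead p = m].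
  move=> m; have [/lS[p Hp]|_] := boolP (m \in l); first by exists p.
  by exists 0.
move=> /choice[P HP]; exists (map P l); split.
  by move=> _ /mapP[m ml ->]; have [] := HP _ ml.
move=> z Hz p; move: {2}(mlead p) (erefl (mlead p)) => m.
elim: (@ltom_wf n m) p => {}m _ IH p Em Ip.
have [->|p0] := eqVneq p 0; first by rewrite raddf0.
have [m' [m'l le]] : exists m', m' \in l /\ forall i, (m' i <= mlead p i)%N.
  by apply: Sl; exists p.
have [Iq q0 Eq] := HP _ m'l; set q := P m' in Iq q0 Eq.
have qz : meval z q = 0 by apply: Hz; exact: map_f.
(* Subtracting r q cancels the leading term of p without changing its value at z. *)
pose r : mpoly n k := (mleadc p / mleadc q) *: mpolyX k (mnm_sub (mlead p) m').
have pc0 : mleadc p != 0 by rewrite mleadc_eq0.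
have qc0 : mleadc q != 0 by rewrite mleadc_eq0.
have r0 : r != 0.
  rewrite scaler_eq0 mulf_eq0 invr_eq0 (negPf pc0) (negPf qc0) -mleadc_eq0.
  by rewrite mleadXm mcoeffX eqxx oner_eq0.
have rq : mnm_add (mlead r) (mlead q) = mlead p.
  rewrite mleadZ ?mulf_neq0 ?invr_eq0 // mleadXm Eq.
  by apply/mnmP => i; rewrite mnmDE mnmBE subnK.
have rE : mlead (r * q) = mlead p by rewrite mleadM.
have cE : mcoeff (mlead p) (p - r * q) = 0.
  rewrite mcoeffB -[X in _ - mcoeff X _]rq mleadcM mleadcZE mleadXm mcoeffX eqxx.
  by rewrite mulr1 divfK // subrr.
have pE : meval z p = meval z (p - r * q).
  by rewrite mevalB mevalM qz mulr0 subr0.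
rewrite pE; have [->|p'0] := eqVneq (p - r * q) 0; first by rewrite raddf0.
apply: (IH (mlead (p - r * q))) => //; last exact: HI.
rewrite -Em lt_neqAle; apply/andP; split.
  by apply: contra_neq p'0 => E; apply/eqP; rewrite -mleadc_eq0 E cE.
by apply: le_trans (mleadB_le _ _) _; rewrite rE joinxx.
Qed.

End Noetherianity.

(** * Affine charts as pairs of total functions *)

Section AffineCharts.
Context {k : fieldType}.

Definition sub_point (X : kspace k) (S : set X) (x : X) (Sx : S x) : sub_kspace S :=
  exist _ x (mem_set Sx).

Lemma sub_pointK (X : kspace k) (S : set X) (x : sub_kspace S) (Sx : S (set_val x)) :
  sub_point Sx = x.
Proof. exact: val_inj. Qed.

Lemma sub_near (X : kspace k) (S : set X) (a : sub_kspace S) (P : X -> Prop) :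
  (\forall b \near a, P (set_val b)) -> \forall x \near set_val a, S x -> P x.
Proof.
move=> /sub_nbhs[W [oW Wa sW]]; apply: filterS (open_nbhs_nbhs (conj oW Wa)).
by move=> x Wx Sx; exact: (sW (sub_point Sx)).
Qed.

Lemma set_val_morphism (X : kspace k) (S : set X) (a : sub_kspace S) :
  morphism_at (fun b : sub_kspace S => set_val b : X) a.
Proof.
split; first exact: initial_continuous.
by move=> h rh; exists h; split=> //; exact: filterE.
Qed.

(** chi is a morphism only on the subspace Z. It is enough that g lands in Z near w, so g need not
    be factored through [sub_kspace Z]. *)
Lemma morphism_at_through (X W : kspace k) (V : kspace k) (Z : set V) (chi : V -> X)
    (g : W -> V) (w : W) :
  (forall b : sub_kspace Z, morphism_at (fun b : sub_kspace Z => chi (set_val b)) b) ->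
  (\forall v \near w, Z (g v)) -> morphism_at g w ->
  morphism_at (fun v => chi (g v)) w.
Proof.
move=> chiM gZ [cg rg]; have Zw := nbhs_singleton gZ.
have [cchi rchi] := chiM (sub_point Zw); split.
  move=> U HU; have := sub_near (P := fun v => U (chi v)) (cchi U HU) => HU'.
  have gU : \forall v \near w, Z (g v) -> U (chi (g v)) := cg _ HU'.
  by apply: filterS2 gZ gU => v Zv; apply.
move=> h rh; have [G [rG EG]] := rchi _ rh.
have E : \forall v \near w, Z (g v) -> h (chi (g v)) = G (g v).
  exact: cg _ (sub_near (P := fun v => h (chi v) = G v) EG).
apply: regular_at_eq (rg _ rG) _.
by apply: filterS2 gZ E => v Zv /(_ Zv).
Qed.

(** psi and chi are made total by the dummy values 0 outside the chart and x0 outside Z, so that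
    later maps avoid the subspace types. *)
Lemma affine_chart (X : kspace k) : variety X -> [set: X] !=set0 ->
  exists m (Z : set (affine_kspace k 1 m)) (O : set X)
    (psi : X -> affine_kspace k 1 m) (chi : affine_kspace k 1 m -> X),
  [/\ closed Z, open O /\ O !=set0,
    forall x, O x -> [/\ morphism_at psi x, Z (psi x) & chi (psi x) = x],
    forall z, Z z -> O (chi z) /\ psi (chi z) = z &
    forall b : sub_kspace Z, morphism_at (fun b : sub_kspace Z => chi (set_val b)) b].
Proof.
move=> [[N [U [oU covU affU]]] _] [x0 _].
have [i _ Ux0] : (\bigcup_i U i) x0 by rewrite covU.
have [m [Z [cZ [f [g [fM gM fK gK]]]]]] := affU i.
pose psi (x : X) : affine_kspace k 1 m :=
  if pselect (U i x) is left Ux then set_val (f (sub_point Ux)) else 0.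
pose chi (z : affine_kspace k 1 m) : X :=
  if pselect (Z z) is left Zz then set_val (g (sub_point Zz)) else x0.
have psiE (a : sub_kspace (U i)) : psi (set_val a) = set_val (f a).
  rewrite /psi; case: pselect => [Ux|]; first by rewrite sub_pointK.
  by case; exact: set_valP.
have chiE (b : sub_kspace Z) : chi (set_val b) = set_val (g b).
  rewrite /chi; case: pselect => [Zx|]; first by rewrite sub_pointK.
  by case; exact: set_valP.
have uval (S : set X) (a : sub_kspace S) : S (set_val a).
  exact: set_valP.
have zval (a : sub_kspace Z) : Z (set_val a) by exact: set_valP.
exists m, Z, (U i), psi, chi; split=> //.
- by split=> //; exists x0.
- move=> x Ux; pose a := sub_point Ux; rewrite -[x]/(set_val a); split.
  + have M := morphism_at_comp (fM a) (set_val_morphism (f a)).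
    apply/morphism_at_affine => s t.
    have /morphism_at_affine/(_ s t)[G [rG EG]] := M.
    apply: regular_at_eq rG _.
    have H : \forall b \near a, psi (set_val b) s t = G (set_val b).
      by apply: filterS EG => b <-; rewrite psiE.
    have := sub_near (P := fun y => psi y s t = G y) H.
    have := open_nbhs_nbhs (conj (oU i) Ux).
    by apply: filterS2 => y Uy /(_ Uy).
  + by rewrite psiE; exact: zval.
  + by rewrite psiE chiE fK.
- move=> z Zz; rewrite -[z]/(set_val (sub_point Zz)) chiE psiE gK.
  by split=> //; exact: uval.
- move=> b; have M := morphism_at_comp (gM b) (set_val_morphism (g b)).
  rewrite (_ : (fun b : sub_kspace Z => chi (set_val b)) = (fun b => set_val (g b))) //.
  by apply/funext => b'; rewrite chiE.
Qed.

End AffineCharts.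

(** * Images of open sets under tuples of rational functions *)

Section Definability.
Context {k : closedFieldType}.

(** The shift by r leaves the first r variables to the values of the functions c; the next ones are
    coordinates of a point. *)
Definition mpoly_term r N (P : mpoly N k) : GRing.term k :=
  foldr (fun m t => GRing.Add (GRing.Mul (GRing.Const (mcoeff m P))
    (foldr (fun (i : 'I_N) u => GRing.Mul (GRing.Exp (GRing.Var k (r + i)) (m i)) u)
      (GRing.NatConst k 1) (index_enum _))) t) (GRing.NatConst k 0) (msupp P).

Lemma eval_mpoly_term r N (P : mpoly N k) e (v : 'I_N -> k) :
  (forall i : 'I_N, e`_(r + i) = v i) -> GRing.eval e (mpoly_term r P) = meval v P.
Proof.
move=> ev; rewrite mevalE /mpoly_term; elim: (msupp P) => [|m s IH] /=.
  by rewrite big_nil.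
rewrite big_cons {}IH; congr (_ * _ + _).
elim: (index_enum _) => [|i t IH] /=; first by rewrite big_nil.
by rewrite big_cons IH ev.
Qed.

Lemma rterm_mpoly_term r N (P : mpoly N k) : GRing.rterm (mpoly_term r P).
Proof.
rewrite /mpoly_term; elim: (msupp P) => //= m s ->; rewrite andbT.
by elim: (index_enum _).
Qed.

Definition conj_formula (I : eqType) (F : I -> GRing.formula k) (s : seq I) :=
  foldr (fun i => GRing.And (F i)) (GRing.Bool true) s.

Lemma holds_conj (I : eqType) (F : I -> GRing.formula k) s e :
  GRing.holds e (conj_formula F s) <-> {in s, forall i, GRing.holds e (F i)}.
Proof.
elim: s => [|i s IH] /=; first by split.
split=> [[Hi /IH Hs] j|H]; first by rewrite inE => /orP[/eqP ->|/Hs].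
split; first by apply: H; exact: mem_head.
by apply/IH => j js; apply: H; rewrite inE js orbT.
Qed.

Lemma rformula_conj (I : eqType) (F : I -> GRing.formula k) s :
  (forall i, GRing.rformula (F i)) -> GRing.rformula (conj_formula F s).
Proof. by move=> H; elim: s => //= i s ->; rewrite H. Qed.

Lemma rformula_exists (f : GRing.formula k) s :
  GRing.rformula (foldr (@GRing.Exists k) f s) = GRing.rformula f.
Proof. by elim: s. Qed.

Definition closed_field_elim := GRing.quantifier_elim (@ClosedFieldQE.ex_elim k).

Lemma closed_field_elim_wf f : GRing.rformula f ->
  GRing.qf_form (closed_field_elim f) && GRing.rformula (closed_field_elim f).
Proof. exact: GRing.quantifier_elim_wf (@ClosedFieldQE.wf_ex_elim k) f. Qed.

Lemma closed_field_elimP e f : GRing.rformula f ->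
  reflect (GRing.holds e f) (GRing.qf_eval e (closed_field_elim f)).
Proof.
exact: GRing.quantifier_elim_rformP (@ClosedFieldQE.wf_ex_elim k)
  (@ClosedFieldQE.holds_ex_elim k (@GRing.solve_monicpoly k)) e f.
Qed.

(** Chevalley's theorem by quantifier elimination. The formula describes the image of a smaller
    nonempty open set, on which the functions c are fractions of polynomials; hence its solutions
    are all attained on U, but only generic points satisfy it. *)
Lemma definable_image (X : kspace k) r (c : nat -> X -> k) (U : set X) :
  variety X -> irreducible_space X ->
  (forall l, generically (fun x => regular_at x (c l))) -> open U -> U !=set0 ->
  exists f : GRing.formula k, [/\ GRing.qf_form f, GRing.rformula f,
    forall s : nat -> k, GRing.qf_eval (mkseq s r) f ->
      exists x, U x /\ forall l, (l < r)%N -> c l x = s l &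
    generically (fun x => GRing.qf_eval (mkseq (c^~ x) r) f)].
Proof.
move=> X_var X_irr rc oU [x0 Ux0].
have [m [Z [O [psi [chi [cZ [oO [x2 Ox2]] psiP chiP chiM]]]]]] :=
  affine_chart X_var X_irr.1.
have gO : generically O := irreducible_open X_irr oO Ox2.
have [x1 [[Ox1 rx1] Ux1]] := generically_near
  (generically_and gO (generically_forall (fun l : 'I_r => rc l)))
  (open_nbhs_nbhs (conj oU Ux0)).
have [mpsi Zpsi chiK] := psiP _ Ox1.
pose b1 : sub_kspace Z := sub_point Zpsi.
have [cchi rchi] : morphism_at (fun b : sub_kspace Z => chi (set_val b)) b1 by exact: chiM.
have frac (l : 'I_r) : exists PQ : mpoly (1 * m) k * mpoly (1 * m) k,
    polyfun PQ.2 (set_val b1) != 0 /\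
    \forall b \near b1, polyfun PQ.2 (set_val b) * c l (chi (set_val b)) =
      polyfun PQ.1 (set_val b).
  have rl : regular_at b1 (fun b : sub_kspace Z => c l (chi (set_val b))).
    by apply: rchi; rewrite /= chiK; exact: rx1.
  have [P [Q [Q0 E]]] := sub_regular_fraction rl.
  by exists (P, Q).
have [PQ HPQ] := choice frac.
have near1 : \forall b \near b1, U (chi (set_val b)) /\ forall l,
    polyfun (PQ l).2 (set_val b) != 0 /\
    polyfun (PQ l).2 (set_val b) * c l (chi (set_val b)) = polyfun (PQ l).1 (set_val b).
  have nU : \forall b \near b1, U (chi (set_val b)).
    have H : nbhs (chi (set_val b1)) U by rewrite /= chiK; exact: open_nbhs_nbhs.
    exact: cchi H.
  suff nPQ : \forall b \near b1, forall l, polyfun (PQ l).2 (set_val b) != 0 /\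
    polyfun (PQ l).2 (set_val b) * c l (chi (set_val b)) = polyfun (PQ l).1 (set_val b).
    by apply: filterS2 nU nPQ.
  have H l : \forall b \near b1, polyfun (PQ l).2 (set_val b) != 0 /\
    polyfun (PQ l).2 (set_val b) * c l (chi (set_val b)) = polyfun (PQ l).1 (set_val b).
    have [Q0 E] := HPQ l.
    by apply: filterS2 (regular_at_neq0 (sub_regular_at_polyfun (PQ l).2 b1) Q0) E.
  exact: filter_forall H.
have [W [oW Wb1 sW]] := sub_nbhs near1.
have [d [d0 sd]] := zariski_nbhs (open_nbhs_nbhs (conj oW Wb1)).
(* Finitely many equations are extracted for Z, so that membership in Z can be expressed by a
   formula. *)
pose I := [set p : mpoly (1 * m) k | forall z, Z z -> polyfun p z = 0].
have [gens [gensI gensZ]] : exists l : seq (mpoly (1 * m) k), (forall p, p \in l -> I p) /\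
    forall z, (forall p, p \in l -> meval z p = 0) -> forall p, I p -> meval z p = 0.
  apply: ideal_zeros_finite => p q u Ip Iq z Zz.
  by rewrite /polyfun mevalB mevalM -!/(polyfun _ _) (Ip _ Zz) (Iq _ Zz) mulr0 subr0.
have ZP z : (forall p, p \in gens -> polyfun p z = 0) -> Z z.
  move=> Hg; have Hz := gensZ (fun i => mxvec z 0 i) Hg; apply: contrapT => nZ.
  have [p [p0 sp]] : exists p, polyfun p z != 0 /\
      [set t | polyfun p t != 0] `<=` ~` Z.
    by apply: zariski_nbhs; apply: open_nbhs_nbhs; split=> //; exact: closed_openC.
  move/eqP: p0; apply; apply: Hz => t Zt; apply/eqP/negPn/negP => /sp; exact.
pose t := @mpoly_term r (1 * m).
pose zero := GRing.NatConst k 0.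
(* The point lies in Z; d does not vanish there, which keeps it where the fractions represent the
   functions c; and each fraction takes the value of its variable. *)
pose body := GRing.And (conj_formula (fun p => GRing.Equal (t p) zero) gens)
  (GRing.And (GRing.Not (GRing.Equal (t d) zero))
    (conj_formula (fun l : 'I_r => GRing.Equal
       (GRing.Mul (t (PQ l).2) (GRing.Var k l)) (t (PQ l).1)) (enum 'I_r))).
pose f0 := foldr (@GRing.Exists k) body (iota r (1 * m)).
have rf0 : GRing.rformula f0.
  rewrite rformula_exists /= !rformula_conj /= ?rterm_mpoly_term // => i;
  by rewrite /= !rterm_mpoly_term.
have /andP[qf rf] := closed_field_elim_wf rf0.
have bodyP e (z : affine_kspace k 1 m) : (forall i : 'I_(1 * m), e`_(r + i) = mxvec z 0 i) ->
    GRing.holds e body <-> [/\ Z z, polyfun d z != 0 &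
      forall l : 'I_r, polyfun (PQ l).2 z * e`_l = polyfun (PQ l).1 z].
  move=> ez; have ev p := eval_mpoly_term p ez.
  rewrite /body /=; split=> [[/holds_conj H1 [H2 /holds_conj H3]]|[H1 H2 H3]].
    split.
    - by apply: ZP => p /H1 /=; rewrite ev.
    - by apply/eqP; move: H2; rewrite ev.
    - by move=> l; have := H3 l (mem_enum _ l); rewrite /= !ev.
  split; first by apply/holds_conj => p /gensI /(_ _ H1) /=; rewrite ev.
  split; first by rewrite ev; apply/eqP.
  by apply/holds_conj => l _ /=; rewrite !ev; exact: H3.
exists (closed_field_elim f0); split=> //.
  move=> s /(closed_field_elimP _ rf0)/GRing.foldExistsP[e Ee He].
  pose z : affine_kspace k 1 m := vec_mx (\row_i e`_(r + i)).
  have [|Zz dz Hz] := (bodyP e z _).1 He.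
    by move=> i; rewrite vec_mxK mxE.
  have [Uz HPz] := sW (sub_point Zz) (sd _ dz).
  exists (chi z); split=> // l lr.
  have es : e`_l = s l.
    by rewrite -(Ee l) ?nth_mkseq // !inE mem_iota leqNgt lr.
  have [Q0 E] := HPz (Ordinal lr); have := Hz (Ordinal lr).
  by rewrite -E /= es => /(mulfI Q0).
have gd : generically (fun x => polyfun d (psi x) != 0).
  apply: (irreducible_near X_irr (x := x1)).
  by have [cpsi _] := mpsi; exact: cpsi (near_polyfun d0).
have := generically_and gO gd; apply: generically1 => x [Ox dx].
have [_ Zx chix] := psiP _ Ox.
apply/(closed_field_elimP _ rf0)/GRing.foldExistsP.
pose v := [seq mxvec (psi x) 0 i | i <- enum 'I_(1 * m)].
have sv : size v = (1 * m)%N by rewrite size_map size_enum_ord.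
exists (mkseq (c^~ x) r ++ v).
  move=> i; rewrite !inE mem_iota negb_and -ltnNge -leqNgt nth_cat size_mkseq.
  case: ltnP => //= ri le; rewrite !nth_default ?size_mkseq //.
  by rewrite sv leq_subRL.
apply/(bodyP _ (psi x)).
  move=> i; rewrite nth_cat size_mkseq ltnNge leq_addr /= addKn.
  by rewrite (nth_map i) ?size_enum_ord // nth_ord_enum.
split=> // l; rewrite nth_cat size_mkseq ltn_ord nth_mkseq //.
have [_ /(_ l)[_]] := sW (sub_point Zx) (sd _ dx).
by rewrite /= chix.
Qed.

End Definability.

(** * Conjugacy of matrix bases with the same multiplication table *)

Section SkolemNoether.
Context {k : fieldType} {n : nat} (i0 : 'I_n).

Definition rows_mx N (b : 'I_N -> 'M[k]_n) : 'M[k]_(N, n * n) :=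
  \matrix_(i, j) mxvec (b i) 0 j.

Lemma mul_rows_mx N (b : 'I_N -> 'M[k]_n) (w : 'rV_N) :
  w *m rows_mx b = mxvec (\sum_i w 0 i *: b i).
Proof.
rewrite linear_sum mulmx_sum_row; apply: eq_bigr => i _.
by rewrite linearZ; congr (_ *: _); apply/rowP => j; rewrite !mxE.
Qed.

(* Conjugation by the matrix whose columns are [al (e_(r, i0)) v], where al is the
   algebra automorphism sending b to b' and v a nonzero column of [al e_(i0, i0)]. *)
Lemma basis_conjugate (b b' : 'I_(n * n) -> 'M[k]_n)
    (c : 'I_(n * n) -> 'I_(n * n) -> 'I_(n * n) -> k) :
  row_free (rows_mx b) -> row_free (rows_mx b') ->
  (forall i j, b i *m b j = \sum_l c i j l *: b l) ->
  (forall i j, b' i *m b' j = \sum_l c i j l *: b' l) ->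
  exists2 h, h \in unitmx & forall i, b' i = h *m b i *m invmx h.
Proof.
rewrite !row_free_unit => uB uB' mulb mulb'.
pose al (M : 'M[k]_n) : 'M[k]_n := vec_mx (mxvec M *m invmx (rows_mx b) *m rows_mx b').
have alD M M' : al (M + M') = al M + al M' by rewrite /al linearD !mulmxDl linearD.
have alZ s M : al (s *: M) = s *: al M by rewrite /al linearZ /= -!scalemxAl linearZ.
have al0 : al 0 = 0 by rewrite /al linear0 !mul0mx linear0.
have al_sum (I : Type) (s : seq I) (P : pred I) F :
    al (\sum_(i <- s | P i) F i) = \sum_(i <- s | P i) al (F i).
  exact: (big_morph al alD al0).
have alb i : al (b i) = b' i.
  have -> : b i = \sum_j (delta_mx 0 i : 'rV_(n * n)) 0 j *: b j.
    rewrite (bigD1 i) //= big1 => [|j ji]; last by rewrite mxE (negPf ji) andbF scale0r.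
    by rewrite mxE !eqxx scale1r addr0.
  rewrite /al -mul_rows_mx mulmxK // mul_rows_mx mxvecK.
  rewrite (bigD1 i) //= big1 => [|j ji]; last by rewrite mxE (negPf ji) andbF scale0r.
  by rewrite mxE !eqxx scale1r addr0.
have span M : exists w : 'rV_(n * n), M = \sum_i w 0 i *: b i.
  exists (mxvec M *m invmx (rows_mx b)).
  by apply: (can_inj mxvecK); rewrite -mul_rows_mx mulmxKV.
have alM M M' : al (M *m M') = al M *m al M'.
  have [w ->] := span M; have [w' ->] := span M'.
  rewrite mulmx_suml !al_sum mulmx_suml; apply: eq_bigr => i _.
  rewrite mulmx_sumr al_sum mulmx_sumr; apply: eq_bigr => j _.
  rewrite -scalemxAl -scalemxAr !alZ -scalemxAl -scalemxAr !alb mulb mulb' al_sum.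
  by do 2!congr (_ *: _); apply: eq_bigr => l _; rewrite alZ alb.
have al_surj M : exists M', al M' = M.
  exists (vec_mx (mxvec M *m invmx (rows_mx b') *m rows_mx b)).
  by rewrite /al vec_mxK mulmxK // mulmxKV // mxvecK.
have al_inj M : al M = 0 -> M = 0.
  rewrite /al => /(congr1 mxvec); rewrite vec_mxK linear0 => E.
  apply: (can_inj mxvecK); rewrite linear0.
  by rewrite -[LHS](mulmxKV uB) -[_ *m invmx _](mulmxK uB') E !mul0mx.
have [j vj] : exists j, col j (al (delta_mx i0 i0)) != 0.
  apply: contrapT => H; have /al_inj/matrixP/(_ i0 i0) : al (delta_mx i0 i0) = 0.
    apply/matrixP => a c'; rewrite [RHS]mxE; apply/eqP/negPn/negP => Hac.
    apply: H; exists c'; apply: contraNneq Hac => /matrixP/(_ a 0).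
    by rewrite !mxE => ->.
  by rewrite !mxE !eqxx => /eqP; rewrite oner_eq0.
pose v := col j (al (delta_mx i0 i0)).
pose h : 'M[k]_n := \matrix_(a, r) (al (delta_mx r i0) *m v) a 0.
have colh r : col r h = al (delta_mx r i0) *m v.
  by apply/matrixP => a c'; rewrite ord1 !mxE.
have hE M : al M *m h = h *m M.
  rewrite [M]matrix_sum_delta !al_sum mulmx_suml mulmx_sumr.
  apply: eq_bigr => r _; rewrite !al_sum mulmx_suml mulmx_sumr.
  apply: eq_bigr => s _; rewrite alZ -scalemxAl -scalemxAr; congr (_ *: _).
  have delta_col (M' : 'M[k]_n) a t : (M' *m delta_mx r s) a t = (col r M') a 0 *+ (s == t).
    rewrite -(mul_delta_mx (0 : 'I_1)) mulmxA -colE !mxE big_ord1 !mxE eqxx.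
    by rewrite mulr_natr eq_sym.
  apply/matrixP => a t; rewrite delta_col colh.
  have -> : (al (delta_mx r s) *m h) a t = (al (delta_mx r s) *m col t h) a 0.
    by rewrite !mxE; apply: eq_bigr => l _; rewrite !mxE.
  rewrite colh mulmxA -alM mul_delta_mx_cond.
  by case: (s == t); rewrite ?mulr1n // !mulr0n al0 mul0mx mxE.
(* If u h = 0 then u al(M) h = u h M = 0 for all M. As al is onto, u B h = 0 for every matrix B, so
   u <> 0 forces h = 0; but column i0 of h is v. *)
have uh : h \in unitmx.
  rewrite -row_free_unit -kermx_eq0; apply/rowV0P => u /sub_kermxP uh0.
  apply: contrapT => /eqP u0.
  have [l ul] : exists l, u 0 l != 0.
    apply: contrapT => H; move/eqP: u0; apply; apply/rowP => l; rewrite mxE.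
    by apply/eqP/negPn/negP => Hl; apply: H; exists l.
  have h0 : h = 0.
    apply/row_matrixP => a; rewrite linear0.
    have [M ME] := al_surj (delta_mx l a).
    have : u *m delta_mx l a *m h = 0 by rewrite -ME -mulmxA hE mulmxA uh0 mul0mx.
    rewrite -(mul_delta_mx (0 : 'I_1)) mulmxA -colE -mulmxA -rowE.
    move/matrixP => E; apply/rowP => t; have := E 0 t.
    rewrite mxE big_ord1 [X in X * _]mxE !mxE => /eqP.
    by rewrite mulf_eq0 (negPf ul) => /eqP.
  move: (colh i0); rewrite h0 linear0 /v => /esym.
  rewrite colE mulmxA -alM mul_delta_mx -colE => E.
  by rewrite E eqxx in vj.
exists h => // i; rewrite -hE alb -mulmxA mulmxV ?mulmx1 //.
Qed.

End SkolemNoether.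

(** * Formulas in central elements at generic points *)

Section Evaluation.
Context {k : closedFieldType} {n : nat} (i0 : 'I_n) {A : algType k}.
Context (X : Pvariety k n) (phi : {rmorphism A -> kn X}).
Hypotheses (X_irr : irreducible_space X) (phiZ : scalable phi) (phi_bij : bijective phi).

Lemma phi_central a : center a -> kn_central (phi a).
Proof.
have [psi _ psiK] := phi_bij.
by move=> ca f; rewrite -[f]psiK -!rmorphM ca.
Qed.

Lemma phi_central_inv f : kn_central f -> exists a, center a /\ phi a = f.
Proof.
have [psi phiK psiK] := phi_bij; move=> cf; exists (psi f); split=> // a.
by apply: (can_inj phiK); rewrite !rmorphM psiK cf.
Qed.

Definition center_basis (b : 'I_(n * n) -> A) := forall a, exists! z : {ffun 'I_(n * n) -> A},
  (forall i, center (z i)) /\ a = \sum_i z i * b i.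

(** A central relation among the images of b lifts to A, where 0 has only one expression. *)
Lemma center_basis_free b : center_basis b ->
  generically (fun x => row_free (kn_mx (phi \o b) x)).
Proof.
move=> b_basis; apply: kn_mx_row_free => // z cz z0.
have [w Hw] := choice (fun i => phi_central_inv (cz i)).
have S0 : \sum_i w i * b i = 0.
  apply: (bij_inj phi_bij); rewrite rmorph0 -[RHS]z0 rmorph_sum; apply: eq_bigr => i _.
  by rewrite rmorphM (Hw i).2.
have [z1 [_ uz]] := b_basis 0.
have c0 : center (0 : A) by move=> a; rewrite mul0r mulr0.
have e0 : z1 = [ffun=> 0].
  apply: uz; split=> [i|]; first by rewrite ffunE.
  by rewrite big1 // => i _; rewrite ffunE mul0r.
have ew : z1 = [ffun i => w i].
  apply: uz; split=> [i|]; first by rewrite ffunE; exact: (Hw i).1.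
  by rewrite -[LHS]S0; apply: eq_bigr => i _; rewrite ffunE.
move=> i; have /ffunP/(_ i) : [ffun i => w i] = [ffun=> 0] :> {ffun 'I_(n * n) -> A}.
  by rewrite -ew -e0.
by rewrite !ffunE -(Hw i).2 => ->; rewrite rmorph0.
Qed.

Hypothesis spanned : exists b : 'I_(n * n) -> kn X,
  generically (fun x => row_free (kn_mx b x)).

Lemma central_scalar a : center a ->
  generically (fun x => kn_fun (phi a) x = (kn_fun (phi a) x i0 i0)%:M).
Proof.
have [b fb] := spanned; move=> /phi_central ca.
exact: (kn_central_scalar _ ca fb).
Qed.

Context (cs : nat -> A) (r : nat).
Hypothesis cs_central : forall l, center (cs l).

Definition central_value (x : X) (l : nat) : k := kn_fun (phi (cs l)) x i0 i0.

(* [GRing.Inv] does not occur in the formulas over rings considered below. *)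
Fixpoint term_elt (t : GRing.term k) : A :=
  match t with
  | GRing.Var i => if (i < r)%N then cs i else 0
  | GRing.Const c => c%:A
  | GRing.NatConst m => m%:R
  | GRing.Add t1 t2 => term_elt t1 + term_elt t2
  | GRing.Opp t1 => - term_elt t1
  | GRing.NatMul t1 m => term_elt t1 *+ m
  | GRing.Mul t1 t2 => term_elt t1 * term_elt t2
  | GRing.Inv t1 => 0
  | GRing.Exp t1 m => term_elt t1 ^+ m
  end.

Lemma kn_funMn (f : kn X) m : generically (fun x => kn_fun (f *+ m) x = kn_fun f x *+ m).
Proof.
elim: m => [|m IH].
  by have := kn_fun0 X; rewrite mulr0n; apply: generically1 => x ->; rewrite mulr0n.
have := generically_and (kn_funD f (f *+ m)) IH; rewrite mulrS.
by apply: generically1 => x [-> ->]; rewrite mulrS.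
Qed.

Lemma term_eltP t : GRing.rterm t -> generically (fun x =>
  kn_fun (phi (term_elt t)) x = (GRing.eval (mkseq (central_value x) r) t)%:M).
Proof.
elim: t => //=.
- move=> i _; case: ifP => ir.
    apply: generically1 (central_scalar (cs_central i)) => x.
    by rewrite nth_mkseq.
  (* Beyond r the environment reads the default 0, which is why [term_elt] is 0 there. *)
  have := kn_fun0 X; rewrite rmorph0; apply: generically1 => x ->.
  by rewrite nth_default ?raddf0 // size_mkseq leqNgt ir.
- move=> c _; rewrite phiZ rmorph1.
  have := generically_and (kn_funZ c (1 : kn X)) (kn_fun1 X).
  by apply: generically1 => x [-> ->]; rewrite scalemx1.
- move=> m _; rewrite rmorph_nat.
  have := generically_and (kn_funMn (1 : kn X) m) (kn_fun1 X).
  by apply: generically1 => x [-> ->]; rewrite -raddfMn.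
- move=> t1 IH1 t2 IH2 /andP[/IH1 H1 /IH2 H2]; rewrite rmorphD.
  have := generically_and (kn_funD (phi (term_elt t1)) (phi (term_elt t2)))
    (generically_and H1 H2).
  by apply: generically1 => x [-> [-> ->]]; rewrite raddfD.
- move=> t1 IH1 /IH1 H1; rewrite rmorphN.
  have := generically_and (kn_funN (phi (term_elt t1))) H1.
  by apply: generically1 => x [-> ->]; rewrite raddfN.
- move=> t1 IH1 m /IH1 H1; rewrite rmorphMn.
  have := generically_and (kn_funMn (phi (term_elt t1)) m) H1.
  by apply: generically1 => x [-> ->]; rewrite raddfMn.
- move=> t1 IH1 t2 IH2 /andP[/IH1 H1 /IH2 H2]; rewrite rmorphM.
  have := generically_and (kn_funM (phi (term_elt t1)) (phi (term_elt t2)))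
    (generically_and H1 H2).
  by apply: generically1 => x [-> [-> ->]]; rewrite -scalar_mxM.
- move=> t1 IH1 m /IH1 H1; elim: m => [|m IHm].
    by rewrite !expr0 rmorph1; apply: kn_fun1.
  have := generically_and (kn_funM (phi (term_elt t1)) (phi (term_elt t1 ^+ m)))
    (generically_and H1 IHm).
  rewrite -rmorphM -exprS; apply: generically1 => x [-> [-> ->]].
  by rewrite -scalar_mxM -exprS.
Qed.

(** Equations are decided in A, so the value is the same for X and Y. The default case is never met
    by quantifier-free formulas over rings. *)
Fixpoint formula_value (f : GRing.formula k) : bool :=
  match f with
  | GRing.Bool b => b
  | GRing.Equal t1 t2 => `[< term_elt t1 = term_elt t2 >]
  | GRing.And f1 f2 => formula_value f1 && formula_value f2
  | GRing.Or f1 f2 => formula_value f1 || formula_value f2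
  | GRing.Implies f1 f2 => formula_value f1 ==> formula_value f2
  | GRing.Not f1 => ~~ formula_value f1
  | _ => false
  end.

Lemma formula_valueP f : GRing.qf_form f -> GRing.rformula f ->
  generically (fun x => GRing.qf_eval (mkseq (central_value x) r) f = formula_value f).
Proof.
elim: f => //=.
- by move=> b _ _; exact: genericallyW.
- move=> t1 t2 _ /andP[r1 r2]; have [H1 H2] := (term_eltP r1, term_eltP r2).
  have [E|nE] := pselect (term_elt t1 = term_elt t2).
    have -> : `[< term_elt t1 = term_elt t2 >] by apply/asboolP.
    have := generically_and H1 H2; rewrite E; apply: generically1 => x [->].
    by move=> /matrixP/(_ i0 i0); rewrite !mxE eqxx => /eqP.
  have -> : `[< term_elt t1 = term_elt t2 >] = false by apply/asboolPn.
  (* An equation failing in A has a nonzero difference of sides, generically scalar; nonzero at one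
     regular point, it is nonzero generically. *)
  pose d := phi (term_elt t1) - phi (term_elt t2).
  have rd := kn_fun_regular d.
  have Hd : generically (fun x => kn_fun d x =
      (GRing.eval (mkseq (central_value x) r) t1 -
       GRing.eval (mkseq (central_value x) r) t2)%:M).
    have := generically_and (generically_and
      (kn_funD (phi (term_elt t1)) (- phi (term_elt t2)))
      (kn_funN (phi (term_elt t2)))) (generically_and H1 H2).
    by apply: generically1 => x [[-> ->] [-> ->]]; rewrite raddfB.
  have gd : generically (fun x => kn_fun d x i0 i0 != 0).
    apply: contrapT => ngd; apply: nE; apply: (bij_inj phi_bij); apply/eqP.
    rewrite -subr_eq0; apply/eqP; apply: knP.
    have := generically_and (generically_and rd Hd) (kn_fun0 X).
    apply: generically1 => x [[rx Ex] ->]; rewrite [LHS]Ex.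
    suff : kn_fun d x i0 i0 = 0 by rewrite Ex mxE eqxx mulr1n => ->; rewrite raddf0.
    apply/eqP/negPn/negP => d0; apply: ngd.
    exact: (irreducible_near X_irr (regular_at_neq0 (rx i0 i0) d0)).
  have := generically_and gd Hd; apply: generically1 => x [+ E].
  by rewrite E mxE eqxx mulr1n subr_eq0 => /negPf.
- move=> f1 IH1 f2 IH2 /andP[q1 q2] /andP[r1 r2].
  by have := generically_and (IH1 q1 r1) (IH2 q2 r2); apply: generically1 => x [-> ->].
- move=> f1 IH1 f2 IH2 /andP[q1 q2] /andP[r1 r2].
  by have := generically_and (IH1 q1 r1) (IH2 q2 r2); apply: generically1 => x [-> ->].
- move=> f1 IH1 f2 IH2 /andP[q1 q2] /andP[r1 r2].
  by have := generically_and (IH1 q1 r1) (IH2 q2 r2); apply: generically1 => x [-> ->].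
- by move=> f1 IH1 q1 r1; have := IH1 q1 r1; apply: generically1 => x ->.
Qed.

End Evaluation.

(** * Comparison of the closures of the two images *)

Section Transfer.
Context {k : closedFieldType} {n : nat} (i0 : 'I_n) {A : algType k}.
Context (b : 'I_(n * n) -> A).
Hypothesis b_basis : center_basis b.

Lemma center0 : center (0 : A).
Proof. by move=> a; rewrite mul0r mulr0. Qed.

Lemma center_coef : exists co : A -> 'I_(n * n) -> A,
  forall a, (forall i, center (co a i)) /\ a = \sum_i co a i * b i.
Proof.
have H a : exists z : 'I_(n * n) -> A, (forall i, center (z i)) /\ a = \sum_i z i * b i.
  by have [z [Hz _]] := b_basis a; exists z.
by have [co Hco] := choice H; exists co.
Qed.

Section OneVariety.
Context (X : Pvariety k n) (phi : {rmorphism A -> kn X}).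
Hypotheses (X_irr : irreducible_space X) (phi_bij : bijective phi).

Lemma center_basis_spanned : exists b' : 'I_(n * n) -> kn X,
  generically (fun x => row_free (kn_mx b' x)).
Proof. by exists (phi \o b); exact: center_basis_free. Qed.

Lemma kn_fun_coef (co : A -> 'I_(n * n) -> A) a :
  (forall a, (forall i, center (co a i)) /\ a = \sum_i co a i * b i) ->
  generically (fun x => kn_fun (phi a) x =
    \sum_i kn_fun (phi (co a i)) x i0 i0 *: kn_fun (phi (b i)) x).
Proof.
move=> Hco; have [ca aE] := Hco a.
have H1 := kn_fun_sum (index_enum _) (fun i => phi (co a i) * phi (b i)).
have H2 := generically_forall (fun i => kn_funM (phi (co a i)) (phi (b i))).
have H3 := generically_forall (fun i =>
  central_scalar i0 phi_bij center_basis_spanned (ca i)).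
have := generically_and H1 (generically_and H2 H3).
have -> : \sum_i phi (co a i) * phi (b i) = phi a.
  by rewrite [in RHS]aE rmorph_sum; apply: eq_bigr => i _; rewrite rmorphM.
apply: generically1 => x [-> [E2 E3]]; apply: eq_bigr => i _.
by rewrite E2 [X in X *m _]E3 mul_scalar_mx.
Qed.

End OneVariety.

Context (X Y : Pvariety k n) (phi : {rmorphism A -> kn X}) (psi : {rmorphism A -> kn Y}).
Hypotheses (X_irr : irreducible_space X) (Y_irr : irreducible_space Y).
Hypotheses (phiZ : scalable phi) (psiZ : scalable psi).
Hypotheses (phi_bij : bijective phi) (psi_bij : bijective psi).

(** The formula describing central values on U holds generically on X, hence holds in A, hence
    generically on Y. At a point y of V where it holds, it asserts that some x in U has the central
    values of y. *)
Lemma matched_points (cs : nat -> A) r (U : set X) (V : set Y) :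
  (forall l, center (cs l)) -> open U -> U !=set0 -> open V -> V !=set0 ->
  exists x y, [/\ U x, V y & forall l, (l < r)%N ->
    kn_fun (phi (cs l)) x i0 i0 = kn_fun (psi (cs l)) y i0 i0].
Proof.
move=> csc oU U0 oV [y0 Vy0].
have sX := center_basis_spanned X_irr phi_bij.
have sY := center_basis_spanned Y_irr psi_bij.
have rc l : generically (fun x => regular_at x (fun x => kn_fun (phi (cs l)) x i0 i0)).
  by apply: generically1 (kn_fun_regular (phi (cs l))) => x; exact.
have [f [qf rf fU gf]] := definable_image r (pv_variety X) X_irr rc oU U0.
have [x [fx fE]] := generically_ex X_irr.1
  (generically_and gf (formula_valueP i0 X_irr phiZ phi_bij sX r csc qf rf)).
have gY := formula_valueP i0 Y_irr psiZ psi_bij sY r csc qf rf.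
have [y [fy Vy]] := generically_near gY (open_nbhs_nbhs (conj oV Vy0)).
have /fU[x' [Ux' E]] : GRing.qf_eval (mkseq (central_value i0 psi cs y) r) f.
  by rewrite fy -fE.
by exists x', y; split.
Qed.

Context (N : nat) (a : 'I_N -> A).

Definition conj_rows (h : PGL k n) (t : 'M[k]_(N, n * n)) : 'M[k]_(N, n * n) :=
  \matrix_(i, j) mxvec (PGL_conj h (vec_mx (row i t))) 0 j.

Lemma conj_rows_kn_mx (Z : Pvariety k n) (c : 'I_N -> kn Z) h z :
  conj_rows h (kn_mx c z) = \matrix_(i, j) mxvec (PGL_conj h (kn_fun (c i) z)) 0 j.
Proof. by apply/matrixP => i j; rewrite !mxE row_kn_mx mxvecK. Qed.

Lemma kn_mx_act (Z : Pvariety k n) (c : 'I_N -> kn Z) h :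
  generically (fun z => kn_mx c (PGL_act h z) = conj_rows h (kn_mx c z)).
Proof.
have := generically_forall (fun i => kn_fun_equivariant (c i) h).
apply: generically1 => z E; rewrite conj_rows_kn_mx.
by apply/matrixP => i j; rewrite [LHS]mxE [RHS]mxE -E.
Qed.

(* Over points with equal central values the matrices of the basis satisfy the
   same multiplication table, so they are conjugate. *)
Lemma kn_mx_closure (O : set (affine_kspace k N (n * n))) : open O ->
  generically (fun y => ~ O (kn_mx (psi \o a) y)) ->
  generically (fun x => ~ O (kn_mx (phi \o a) x)).
Proof.
move=> oO gO.
have [co Hco] := center_coef.
pose es := [seq b i * b j | i <- enum 'I_(n * n), j <- enum 'I_(n * n)] ++
  [seq a i | i <- enum 'I_N].
pose L := [seq co e l | e <- es, l <- enum 'I_(n * n)].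
have Lc l : center (nth 0 L l).
  have [ll|] := ltnP l (size L); last by move=> ?; rewrite nth_default //; exact: center0.
  have /allpairsPdep[e [i [_ _ ->]]] := mem_nth 0 ll.
  exact: (Hco e).1.
have esM i j : b i * b j \in es.
  by rewrite mem_cat; apply/orP; left; apply/allpairsPdep; exists i, j; rewrite !mem_enum.
have esa i : a i \in es.
  by rewrite mem_cat; apply/orP; right; apply: map_f; rewrite mem_enum.
have inL e l : e \in es -> exists2 s, (s < size L)%N & nth 0 L s = co e l.
  move=> ees; have eL : co e l \in L.
    by apply/allpairsPdep; exists e, l; rewrite mem_enum.
  by exists (index (co e l) L); rewrite ?index_mem // nth_index.
pose coef (Z : Pvariety k n) (chi : {rmorphism A -> kn Z}) z e l :=
  kn_fun (chi (co e l)) z i0 i0.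
pose good (Z : Pvariety k n) (chi : {rmorphism A -> kn Z}) z :=
  [/\ forall i, mx_regular_at z (kn_fun (chi (a i))),
      row_free (kn_mx (chi \o b) z),
      forall i j, kn_fun (chi (b i)) z *m kn_fun (chi (b j)) z =
        \sum_l coef Z chi z (b i * b j) l *: kn_fun (chi (b l)) z &
      forall i, kn_fun (chi (a i)) z = \sum_l coef Z chi z (a i) l *: kn_fun (chi (b l)) z].
have gen_good (Z : Pvariety k n) (chi : {rmorphism A -> kn Z}) :
    irreducible_space Z -> bijective chi -> generically (good Z chi).
  move=> Z_irr chi_bij.
  have H1 := generically_forall (fun i => kn_fun_regular (chi (a i))).
  have H2 := center_basis_free i0 Z_irr chi_bij b_basis.
  have H3 := generically_forall (fun ij : 'I_(n * n) * 'I_(n * n) => generically_and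
    (kn_funM (chi (b ij.1)) (chi (b ij.2)))
    (kn_fun_coef Z_irr chi_bij (b ij.1 * b ij.2) Hco)).
  have H4 := generically_forall (fun i => kn_fun_coef Z_irr chi_bij (a i) Hco).
  have := generically_and (generically_and H1 H2) (generically_and H3 H4).
  apply: generically1 => z [[R1 R2] [R3 R4]]; split=> // i j.
  by have [<- <-] := R3 (i, j); rewrite rmorphM.
have [U [oU dU sU]] := gen_good _ _ X_irr phi_bij.
have [V [oV dV sV]] := gen_good _ _ Y_irr psi_bij.
have contra x0 : U x0 -> O (kn_mx (phi \o a) x0) -> False.
  move=> Ux0 Ox0; pose U' := [set x | U x /\ O (kn_mx (phi \o a) x)].
  have oU' : open U'.
    rewrite openE => x [Ux Ox]; have [rx _ _ _] := sU _ Ux.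
    have [c _] := mx_regular_at_morphism (kn_mx_regular (b := phi \o a) rx).
    have nO : \forall y \near x, O (kn_mx (phi \o a) y) := c _ (open_nbhs_nbhs (conj oO Ox)).
    by apply: filterS2 (open_nbhs_nbhs (conj oU Ux)) nO.
  have U'0 : U' !=set0 by exists x0.
  have V0 : V !=set0 by have [y [_ Vy]] := dV setT Y_irr.1 openT; exists y.
  have [x [y [[Ux Ox] Vy E]]] := matched_points (size L) Lc oU' U'0 oV V0.
  have [_ fX mX aX] := sU _ Ux; have [rY fY mY aY] := sV _ Vy.
  have coefE e l : e \in es -> coef _ phi x e l = coef _ psi y e l.
    by move=> /(inL e l)[s ss Es]; rewrite /coef -Es; exact: E.
  have mX' i j : kn_fun (phi (b i)) x *m kn_fun (phi (b j)) x =
      \sum_l coef Y psi y (b i * b j) l *: kn_fun (phi (b l)) x.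
    by rewrite mX; apply: eq_bigr => l _; rewrite coefE.
  have [h uh hE] := basis_conjugate i0 fY fX mY mX'.
  have hP M : PGL_conj (PGL_class (GL_of uh)) M = h *m M *m invmx h.
    by rewrite /PGL_conj; have [c [c0 ->]] := PGL_mx_class uh; exact: conj_scale.
  pose g := PGL_class (GL_of uh).
  have xE : kn_mx (phi \o a) x = conj_rows g (kn_mx (psi \o a) y).
    rewrite conj_rows_kn_mx; apply/matrixP => i j; rewrite [LHS]mxE [RHS]mxE /=.
    congr (mxvec _ 0 j); rewrite hP aX aY mulmx_sumr mulmx_suml.
    apply: eq_bigr => l _; rewrite -scalemxAr -scalemxAl -hE coefE //.
  (* Only the conjugate by g of the image of y is known to lie in O. The contradiction comes from
     the translates g z, with z generic near y. *)
  have rconj : mx_regular_at y (fun z => conj_rows g (kn_mx (psi \o a) z)).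
    move=> i; case/mxvec_indexP => s t.
    apply: regular_at_eqfun (PGL_conj_regular g (rY i) s t) => z.
    by rewrite conj_rows_kn_mx mxE mxvecE.
  have [c _] := mx_regular_at_morphism rconj.
  have nO : \forall z \near y, O (conj_rows g (kn_mx (psi \o a) z)).
    by apply: c; apply: open_nbhs_nbhs; rewrite -xE.
  have gO' := generically_act (P_PGL g) gO.
  have [z [[nOz zE] Oz]] := generically_near
    (generically_and gO' (kn_mx_act (psi \o a) g)) nO.
  by apply: nOz; rewrite -/(PGL_act g z) zE.
by exists U; split=> // x Ux Ox; exact: contra Ux Ox.
Qed.

End Transfer.

(** * The birational map *)

Section GenericLift.
Context {k : fieldType} {p q m : nat} (X Y : kspace k).
Local Notation T := (affine_kspace k p q).
Hypothesis Y_irr : irreducible_space Y.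
Context (thX : X -> 'M[k]_(p, q)) (thY : Y -> 'M[k]_(p, q)).
Hypotheses (rX : generically (fun x => mx_regular_at x thX))
  (rY : generically (fun y => mx_regular_at y thY)).
Hypothesis transfer : forall O : set T, open O ->
  generically (fun y => O (thY y)) -> generically (fun x => O (thX x)).
Hypothesis transferN : forall O : set T, open O ->
  generically (fun y => ~ O (thY y)) -> generically (fun x => ~ O (thX x)).
Context (Z : set (affine_kspace k 1 m)) (C : set Y)
  (psi : Y -> affine_kspace k 1 m) (chi : affine_kspace k 1 m -> Y).
Hypotheses (cZ : closed Z) (oC : open C) (C0 : C !=set0)
  (psiP : forall y, C y -> [/\ morphism_at psi y, Z (psi y) & chi (psi y) = y])
  (chiM : forall b : sub_kspace Z, morphism_at (fun b : sub_kspace Z => chi (set_val b)) b).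
Context (R : T -> 'M[k]_(1, m)).
Hypothesis RP : generically (fun y => mx_regular_at (thY y : T) R /\ R (thY y) = psi y).

(** chi and R together give a generic left inverse of thY. *)
Lemma generic_lift_inj : exists E : set Y, generically E /\
  forall y y', E y -> E y' -> thY y = thY y' -> y = y'.
Proof.
exists [set y | chi (R (thY y)) = y]; split; last by move=> y y' /= Ey Ey' E; rewrite -Ey E.
have [c Cc] := C0; have gC := irreducible_open Y_irr oC Cc.
have := generically_and RP gC.
by apply: generically1 => y [[_ E] /psiP[_ _ Ey]] /=; rewrite E.
Qed.

Let chart_nbhd (W : set (affine_kspace k 1 m)) : open W ->
  open [set t : T | mx_regular_at t R /\ W (R t)].
Proof.
move=> oW; rewrite openE => t [Rt Wt].
have [c _] := mx_regular_at_morphism Rt.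
have H : \forall s \near t, W (R s) := c _ (open_nbhs_nbhs (conj oW Wt)).
by apply: filterS2 (mx_regular_at_near Rt) H.
Qed.

Let generic_chart (W : set (affine_kspace k 1 m)) y : open W -> W (psi y) ->
  mx_regular_at y thY -> mx_regular_at (thY y : T) R -> R (thY y) = psi y ->
  generically (fun x => mx_regular_at (thX x : T) R /\ W (R (thX x))).
Proof.
move=> oW Wy ry Ry E; apply: (transfer (chart_nbhd oW)).
apply: (irreducible_near Y_irr (x := y)).
have [c _] := mx_regular_at_morphism ry; apply: c.
apply: (open_nbhs_nbhs (conj (chart_nbhd oW) _)).
by split=> //; rewrite E.
Qed.

Let generic_point (P : set Y) : generically P ->
  exists y, [/\ P y, C y, mx_regular_at y thY, mx_regular_at (thY y : T) R & R (thY y) = psi y].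
Proof.
move=> gP; have [c Cc] := C0; have gC := irreducible_open Y_irr oC Cc.
have [y [[Py Cy] [ry [Ry E]]]] := generically_ex Y_irr.1
  (generically_and (generically_and gP gC) (generically_and rY RP)).
by exists y.
Qed.

(** As Z is closed, landing outside Z is an open condition on theta; it generically fails on Y,
    hence on X. *)
Let R_in_Z : generically (fun x => [/\ mx_regular_at x thX, mx_regular_at (thX x : T) R &
  \forall x' \near x, Z (R (thX x'))]).
Proof.
have [y [_ _ ry Ry E]] := generic_point (genericallyW (fun _ : Y => I)).
have gO1 := generic_chart openT Logic.I ry Ry E.
have [U [oU dU sU]] := generically_and rX gO1.
have HZ x : U x -> Z (R (thX x)).
  move=> Ux; apply: contrapT => nZ.
  have oO2 := chart_nbhd (closed_openC cZ).
  have [c Cc] := C0; have gC := irreducible_open Y_irr oC Cc.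
  have gN : generically (fun y => ~ [set t : T | mx_regular_at t R /\ (~` Z) (R t)] (thY y)).
    have := generically_and RP gC; apply: generically1 => z [[_ Ez] /psiP[_ Zz _]].
    by move=> [_]; rewrite Ez.
  have [rx [Rx _]] := sU _ Ux; have [cx _] := mx_regular_at_morphism rx.
  have nO2 : \forall x' \near x, [set t : T | mx_regular_at t R /\ (~` Z) (R t)] (thX x').
    by apply: cx; exact: open_nbhs_nbhs.
  by have [z []] := generically_near (transferN oO2 gN) nO2.
exists U; split=> // x Ux; have [rx [Rx _]] := sU _ Ux; split=> //.
by apply: filterS (open_nbhs_nbhs (conj oU Ux)).
Qed.

(** F sends x to the point of the chart of Y with coordinates R(thX x). Each claim is an open or
    closed condition on theta that holds on Y and is carried to X. The last one expresses dominance: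
    generic properties may be pulled back along F. *)
Lemma generic_lift : exists F : X -> Y, [/\
  generically (fun x => morphism_at F x),
  generically (fun x => thY (F x) = thX x) &
  forall P : set Y, generically P -> generically (fun x => P (F x))].
Proof.
exists (fun x => chi (R (thX x))); split.
- apply: generically1 R_in_Z => x [rx Rx Zx].
  apply: (morphism_at_through (Z := Z) (g := fun x => R (thX x)) chiM Zx).
  exact: morphism_at_comp (mx_regular_at_morphism rx) (mx_regular_at_morphism Rx).
- have [y [_ Cy ry Ry E]] := generic_point (genericallyW (fun _ : Y => I)).
  have [_ Zy chiy] := psiP Cy; pose b := sub_point Zy.
  (* Near psi y, the composite of chi and thY is the restriction to Z of a map Gm regular on the
     ambient affine space. *)
  have rb : mx_regular_at b (fun b : sub_kspace Z => thY (chi (set_val b))).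
    by apply: mx_regular_at_comp (chiM b) _; rewrite /= chiy.
  have [G HG] := choice (fun ij : 'I_p * 'I_q => rb ij.1 ij.2).
  pose Gm (z : affine_kspace k 1 m) : 'M[k]_(p, q) := \matrix_(i, j) G (i, j) z.
  have rG : mx_regular_at (psi y) Gm.
    move=> i j; apply: regular_at_eqfun (HG (i, j)).1 => z.
    by rewrite mxE.
  have EG : \forall c \near b, forall ij : 'I_p * 'I_q,
      thY (chi (set_val c)) ij.1 ij.2 = G ij (set_val c).
    exact: filter_forall (fun ij => (HG ij).2).
  have [W1 [oW1 W1y sW1]] := sub_nbhs EG.
  have [W2 [oW2 W2y sW2]] := near_open (mx_regular_at_near rG).
  pose W := W1 `&` W2; have oW : open W by exact: openI.
  have Wy : W (psi y) by [].
  (* The equation Gm (R t) = t holds along thY; its failure is an open condition, which thX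
     therefore avoids as well. *)
  pose O3 := [set t : T | (mx_regular_at t R /\ W (R t)) /\ Gm (R t) != t].
  have oO3 : open O3.
    rewrite openE => t [[Rt Wt] nt].
    have nD := open_nbhs_nbhs (conj (chart_nbhd oW) (conj Rt Wt)).
    have rGR : mx_regular_at t (fun s : T => Gm (R s)).
      exact: mx_regular_at_comp (mx_regular_at_morphism Rt) (sW2 _ Wt.2).
    have [i [j nij]] : exists i j, Gm (R t) i j - t i j != 0.
      apply: contrapT => H; move/eqP: nt; apply; apply/matrixP => i j.
      apply/eqP; rewrite -subr_eq0; apply/negPn/negP => Hij.
      by apply: H; exists i, j.
    have rt : regular_at t (fun s : T => s i j).
      by have /morphism_at_affine := morphism_at_id t; apply.
    have nn := regular_at_neq0 (regular_atB (rGR i j) rt) nij.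
    apply: filterS2 nD nn => s Ds; rewrite subr_eq0 => ns; split=> //.
    by apply: contra_neq ns => ->.
  have [c Cc] := C0; have gC := irreducible_open Y_irr oC Cc.
  have gN : generically (fun y => ~ O3 (thY y)).
    have := generically_and RP gC; apply: generically1 => z [[_ Ez] /psiP[_ Zz chiz]].
    move=> [[_ +] /eqP]; rewrite Ez => -[Wz _]; apply; apply/matrixP => i j.
    by have := sW1 (sub_point Zz) Wz (i, j); rewrite /= chiz mxE => <-.
  have := generically_and (transferN oO3 gN)
    (generically_and R_in_Z (generic_chart oW Wy ry Ry E)).
  apply: generically1 => x [nO [[_ _ /nbhs_singleton Zx] [Rx Wx]]].
  have GE : Gm (R (thX x)) = thX x.
    by apply/eqP/negPn/negP => H; apply: nO.
  rewrite -[RHS]GE; apply/matrixP => i j; rewrite mxE.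
  exact: (sW1 (sub_point Zx) Wx.1 (i, j)).
move=> P [V [oV dV sV]].
have gV : generically V by exists V; split.
have [y [Vy Cy ry Ry E]] := generic_point gV.
have [_ Zy chiy] := psiP Cy; pose b := sub_point Zy.
have [c _] := chiM b.
have nV : \forall b' \near b, V (chi (set_val b')).
  by apply: c; apply: open_nbhs_nbhs; rewrite /= chiy.
have [W [oW Wy sW]] := sub_nbhs nV.
have := generically_and R_in_Z (generic_chart oW Wy ry Ry E).
apply: generically1 => x [[_ _ /nbhs_singleton Zx] [_ Wx]]; apply: sV.
exact: (sW (sub_point Zx) Wx).
Qed.

End GenericLift.

(** * Local coordinates as rational functions of theta *)

Section Coordinates.
Context {k : closedFieldType} {n : nat} (i0 : 'I_n) {A : algType k}.
Context (b : 'I_(n * n) -> A) (X : Pvariety k n) (phi : {rmorphism A -> kn X}).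
Hypotheses (b_basis : center_basis b) (X_irr : irreducible_space X)
  (phi_bij : bijective phi).

(** L is fixed before the family a, because in the end a single family has to serve both X and Y and
    be stable under sigma. *)
Lemma coordinate_function (f : X -> k) : generically (fun x => regular_at x f) ->
  exists L : seq A, forall N (a : 'I_N -> A),
    (forall i, exists j, a j = b i) -> (forall e, e \in L -> exists j, a j = e) ->
  exists R : affine_kspace k N (n * n) -> k, generically (fun x =>
    regular_at (kn_mx (phi \o a) x : affine_kspace k N (n * n)) R /\
    R (kn_mx (phi \o a) x) = f x).
Proof.
move=> rf; have fb := center_basis_free i0 X_irr phi_bij b_basis.
have [d [u [v [cu cv H]]]] := central_generation X_irr i0 fb rf.
have [u' Hu'] := choice (fun i => phi_central_inv phi_bij (cu i)).
have [v' Hv'] := choice (fun i => phi_central_inv phi_bij (cv i)).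
exists (codom u' ++ codom v') => N a ab aL.
have [sb Hsb] := choice ab.
have [su Hsu] : exists su, forall i, a (su i) = u' i.
  have H1 i : exists j, a j = u' i by apply: aL; rewrite mem_cat codom_f.
  by have [su Hsu] := choice H1; exists su.
have [sv Hsv] : exists sv, forall i, a (sv i) = v' i.
  have H1 i : exists j, a j = v' i by apply: aL; rewrite mem_cat codom_f orbT.
  by have [sv Hsv] := choice H1; exists sv.
pose T := affine_kspace k N (n * n).
pose sub (t : T) : affine_space k (n * n) (n * n) := \matrix_(i, j) t (sb i) j.
pose Q (s : 'I_#|{: bmultinom (n * n * (n * n)) d.+1}| -> 'I_N) (t : T) : k :=
  \sum_i t (s i) (mxvec_index i0 i0) * monomial_fun i (sub t).
have coord t i j : regular_at t (fun t : T => t i j).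
  by have /morphism_at_affine := morphism_at_id (t : T); apply.
have rQ s t : regular_at t (Q s).
  apply: regular_at_sum => i; apply: regular_atM; first exact: coord.
  apply: (@regular_at_meval _ _ _ T t sub) => i' j'.
  by apply: regular_at_eqfun (coord t (sb i') j') => t'; rewrite [RHS]mxE.
exists (fun t => Q su t / Q sv t); apply: generically1 H => x /= [Qv fQ].
have subE : sub (kn_mx (phi \o a) x) = kn_mx (phi \o b) x.
  by apply/matrixP => i j; rewrite !mxE /= Hsb.
have QE (s : 'I_#|{: bmultinom (n * n * (n * n)) d.+1}| -> 'I_N) w :
    (forall i, phi (a (s i)) = w i) -> Q s (kn_mx (phi \o a) x) =
      \sum_i kn_fun (w i) x i0 i0 * monomial_fun i (kn_mx (phi \o b) x : affine_space k _ _).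
  by move=> E; apply: eq_bigr => i _; rewrite subE mxE mxvecE /= E.
have Qu : Q su (kn_mx (phi \o a) x) = f x * Q sv (kn_mx (phi \o a) x).
  rewrite (QE su u) => [|i]; last by rewrite Hsu (Hu' i).2.
  by rewrite (QE sv v) => [|i]; [rewrite fQ|rewrite Hsv (Hv' i).2].
have Qv0 : Q sv (kn_mx (phi \o a) x) != 0.
  by rewrite (QE sv v) => [//|i]; rewrite Hsv (Hv' i).2.
split; last by rewrite Qu mulfK.
exact: (regular_atM (rQ su _) (regular_atV (rQ sv _) Qv0)).
Qed.

Lemma coordinate_map m (f : X -> affine_kspace k 1 m) :
  generically (fun x => mx_regular_at x f) ->
  exists L : seq A, forall N (a : 'I_N -> A),
    (forall i, exists j, a j = b i) -> (forall e, e \in L -> exists j, a j = e) ->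
  exists R : affine_kspace k N (n * n) -> 'M[k]_(1, m), generically (fun x =>
    mx_regular_at (kn_mx (phi \o a) x : affine_kspace k N (n * n)) R /\
    R (kn_mx (phi \o a) x) = f x).
Proof.
move=> rf; have rfj j : generically (fun x => regular_at x (fun x => f x 0 j)).
  by apply: generically1 rf => x; exact.
have [L HL] := choice (fun j => coordinate_function (rfj j)).
exists (flatten (codom L)) => N a ab aL.
have H j : exists R : affine_kspace k N (n * n) -> k, generically (fun x =>
    regular_at (kn_mx (phi \o a) x : affine_kspace k N (n * n)) R /\
    R (kn_mx (phi \o a) x) = f x 0 j).
  apply: HL => // e eL; apply: aL; apply/flattenP; exists (L j) => //.
  exact: codom_f.
have [R HR] := choice H.
exists (fun t => \row_j R j t).
have := generically_forall HR; apply: generically1 => x Hx; split.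
  move=> i j; apply: regular_at_eqfun (Hx j).1 => t.
  by rewrite mxE.
by apply/matrixP => i j; rewrite mxE ord1 (Hx j).2.
Qed.

End Coordinates.

Lemma kn_mx_generically_regular (k : fieldType) n (X : Pvariety k n) d (b : 'I_d -> kn X) :
  generically (fun x => mx_regular_at x (kn_mx b)).
Proof.
have := generically_forall (fun i => kn_fun_regular (b i)).
by apply: generically1 => x; exact: kn_mx_regular.
Qed.

(** If thY were not generically in O, it would generically avoid O by irreducibility, and so would
    thX. An inclusion of closures thus becomes a transfer of open conditions in the opposite
    direction. *)
Lemma generically_closure (k : fieldType) p q (X Y : kspace k)
    (thX : X -> affine_kspace k p q) (thY : Y -> affine_kspace k p q) :
  irreducible_space X -> irreducible_space Y ->
  generically (fun y => mx_regular_at y thY) ->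
  (forall O : set (affine_kspace k p q), open O ->
    generically (fun y => ~ O (thY y)) -> generically (fun x => ~ O (thX x))) ->
  forall O : set (affine_kspace k p q), open O ->
    generically (fun x => O (thX x)) -> generically (fun y => O (thY y)).
Proof.
move=> X_irr Y_irr rY H O oO gO; apply: contrapT => nO.
have gN : generically (fun y => ~ O (thY y)).
  apply: generically1 rY => y ry Oy; apply: nO.
  apply: (irreducible_near Y_irr (x := y)).
  by have [c _] := mx_regular_at_morphism ry; apply: c; exact: open_nbhs_nbhs.
by have [x []] := generically_ex X_irr.1 (generically_and gO (H O oO gN)).
Qed.

Section TauAction.
Context {k : closedFieldType} {n : nat} {A : algType k} (sigma : A -> A).
Context (N : nat) (a : 'I_N -> A) (s : 'I_N -> 'I_N).
Hypothesis sE : forall i, sigma (a i) = a (s i).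

(** The value of sigma(f) at x is the transpose of f(tau x), so the value of a_i at tau x is the
    transpose of that of a_(s i) at x. Only s enters, so X and Y share this formula. *)
Definition tau_rows (t : 'M[k]_(N, n * n)) : 'M[k]_(N, n * n) :=
  \matrix_(i, j) mxvec (vec_mx (row (s i) t))^T 0 j.

Definition act_rows (p : P_group k n) (t : 'M[k]_(N, n * n)) : 'M[k]_(N, n * n) :=
  conj_rows (p.1 : PGL k n) (if p.2 then tau_rows t else t).

Lemma kn_mx_P_act (X : Pvariety k n) (phi : {rmorphism A -> kn X}) p :
  (forall e, phi (sigma e) = kn_sigma (phi e)) ->
  generically (fun x => kn_mx (phi \o a) (pv_act p x) = act_rows p (kn_mx (phi \o a) x)).
Proof.
move=> phi_sigma.
have gtau : generically (fun x => kn_mx (phi \o a) (pv_act (P_tau k n) x) =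
    tau_rows (kn_mx (phi \o a) x)).
  have := generically_forall (fun i => kn_fun_sigma (phi (a i))).
  apply: generically1 => x E; apply/matrixP => i j; rewrite [LHS]mxE [RHS]mxE.
  congr (mxvec _ 0 j); rewrite row_kn_mx mxvecK /= -sE phi_sigma E trmxK //.
have pE : p = (P_PGL (p.1 : PGL k n) * (if p.2 then P_tau k n else 1))%g.
  case: p => h [].
    change ((h, true) = P_mul (P_PGL h) (P_tau k n)).
    by rewrite /P_mul /P_elt /= mulg1.
  by rewrite mulg1.
have gh := kn_mx_act (phi \o a) (p.1 : PGL k n).
have := generically_act (if p.2 then P_tau k n else 1%g) gh.
have gt : generically (fun x => kn_mx (phi \o a) (pv_act (if p.2 then P_tau k n else 1%g) x)
    = if p.2 then tau_rows (kn_mx (phi \o a) x) else kn_mx (phi \o a) x).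
  by case: (p.2); [exact: gtau|apply: genericallyW => x; rewrite pv_act1].
move=> /generically_and/(_ gt); apply: generically1 => x [E1 E2].
by rewrite {1}pE pv_actM -/(PGL_act _ _) E1 E2.
Qed.

End TauAction.

Section Birational.
Context {k : fieldType} {n : nat} (X Y : Pvariety k n).

(** The domains must be matched by F and G: intersecting each generic locus with the preimage of the
    other suffices, since G (F x) = x leads back into the first. Dominance keeps them dense. *)
Lemma birational_of_generic_inverse (F : X -> Y) (G : Y -> X) :
  generically (fun x => morphism_at F x) -> generically (fun y => morphism_at G y) ->
  (forall P : set Y, generically P -> generically (fun x => P (F x))) ->
  (forall P : set X, generically P -> generically (fun y => P (G y))) ->
  generically (fun x => G (F x) = x) -> generically (fun y => F (G y) = y) ->
  birational_isomorphism F.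
Proof.
move=> mF mG dF dG GF FG.
have [U1 [oU1 dU1 sU1]] := generically_and mF GF.
have [V1 [oV1 dV1 sV1]] := generically_and mG FG.
pose U := [set x | U1 x /\ V1 (F x)]; pose V := [set y | V1 y /\ U1 (G y)].
have gU1 : generically U1 by exists U1; split.
have gV1 : generically V1 by exists V1; split.
have odense (Z : topologicalType) (P : set Z) : open P -> generically P -> open P /\ dense P.
  move=> oP [W [oW dW sW]]; split=> // O O0 oO.
  by have [z [Oz Wz]] := dW O O0 oO; exists z; split=> //; exact: sW.
exists G, U, V; split.
- apply: odense; last exact: generically_and gU1 (dF _ gV1).
  rewrite openE => x [Ux Vx]; have [[c _] _] := sU1 _ Ux.
  have nV : \forall y \near x, V1 (F y) := c _ (open_nbhs_nbhs (conj oV1 Vx)).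
  by apply: filterS2 (open_nbhs_nbhs (conj oU1 Ux)) nV.
- apply: odense; last exact: generically_and gV1 (dG _ gU1).
  rewrite openE => y [Vy Uy]; have [[c _] _] := sV1 _ Vy.
  have nU : \forall z \near y, U1 (G z) := c _ (open_nbhs_nbhs (conj oU1 Uy)).
  by apply: filterS2 (open_nbhs_nbhs (conj oV1 Vy)) nU.
- by move=> x [Ux Vx]; have [m E] := sU1 _ Ux; split=> //; split=> //; rewrite E.
- by move=> y [Vy Uy]; have [m E] := sV1 _ Vy; split=> //; split=> //; rewrite E.
Qed.

End Birational.

Theorem corollary2p6 (k : closedFieldType) (char0 : [pchar k] =i pred0)
    (n : nat) (n_ge2 : (2 <= n)%N)
    (A : algType k) (sigma : A -> A)
    (A_csa : central_simple_of_degree A n)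
    (sigma_inv : algebra_involution sigma)
    (X Y : Pvariety k n)
    (X_irr : irreducible_space X) (Y_irr : irreducible_space Y)
    (X_free : PGL_generically_free X) (Y_free : PGL_generically_free Y)
    (AX : isomorphic_to_kn sigma X) (AY : isomorphic_to_kn sigma Y) :
  P_birational X Y.
Proof.
have i0 : 'I_n := Ordinal (leq_trans (isT : 0 < 2)%N n_ge2).
have [_ [b b_basis'] _] := A_csa.
have b_basis : @center_basis k n A b := b_basis'.
have [phi [phiZ phi_bij phi_sigma]] := AX; have [psi [psiZ psi_bij psi_sigma]] := AY.
have [_ _ sigmaK] := sigma_inv.
have [mX [ZX [CX [cX [kX [clX [oCX CX0] cXP _ kXM]]]]]] :=
  affine_chart (pv_variety X) X_irr.1.
have [mY [ZY [CY [cY [kY [clY [oCY CY0] cYP _ kYM]]]]]] :=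
  affine_chart (pv_variety Y) Y_irr.1.
have gcX : generically (fun x => mx_regular_at x cX).
  have [x Cx] := CX0; apply: generically1 (irreducible_open X_irr oCX Cx) => z /cXP[H _ _].
  by apply/morphism_at_affine.
have gcY : generically (fun x => mx_regular_at x cY).
  have [x Cx] := CY0; apply: generically1 (irreducible_open Y_irr oCY Cx) => z /cYP[H _ _].
  by apply/morphism_at_affine.
have [LX HLX] := coordinate_map i0 b_basis X_irr phi_bij gcX.
have [LY HLY] := coordinate_map i0 b_basis Y_irr psi_bij gcY.
(* One family for both sides: the basis and what the coordinates of X and of Y require. Adding the
   images under the involution makes it stable. *)
pose L0 := codom b ++ LX ++ LY; pose L := L0 ++ map sigma L0.
pose a (i : 'I_(size L)) : A := nth 0 L i.
have aL e : e \in L -> exists j, a j = e.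
  move=> eL; have ix : (index e L < size L)%N by rewrite index_mem.
  by exists (Ordinal ix); rewrite /a nth_index.
have L0L e : e \in L0 -> exists j, a j = e.
  by move=> eL; apply: aL; rewrite mem_cat eL.
have ab i : exists j, a j = b i by apply: L0L; rewrite mem_cat codom_f.
have aLX e : e \in LX -> exists j, a j = e.
  by move=> eL; apply: L0L; rewrite !mem_cat eL orbT.
have aLY e : e \in LY -> exists j, a j = e.
  by move=> eL; apply: L0L; rewrite !mem_cat eL !orbT.
have [RX HRX] := HLX _ a ab aLX; have [RY HRY] := HLY _ a ab aLY.
have [s sE] : exists s : 'I_(size L) -> 'I_(size L), forall i, sigma (a i) = a (s i).
  have H i : exists j, sigma (a i) = a j.
    have : a i \in L by apply: mem_nth.
    rewrite mem_cat => /orP[eL|/mapP[e eL ->]].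
      by have [|j <-] := aL (sigma (a i)); [rewrite mem_cat map_f ?orbT|exists j].
    by have [j Ej] := L0L _ eL; exists j; rewrite sigmaK Ej.
  by have [s Hs] := choice H; exists s.
pose thX := kn_mx (phi \o a); pose thY := kn_mx (psi \o a).
have rX := kn_mx_generically_regular (phi \o a).
have rY := kn_mx_generically_regular (psi \o a).
have trNXY := kn_mx_closure i0 b_basis X_irr Y_irr phiZ psiZ phi_bij psi_bij (a := a).
have trNYX := kn_mx_closure i0 b_basis Y_irr X_irr psiZ phiZ psi_bij phi_bij (a := a).
have trXY := generically_closure Y_irr X_irr rX trNYX.
have trYX := generically_closure X_irr Y_irr rY trNXY.
have [F [mF FE dF]] := generic_lift Y_irr rX rY trXY trNXY clY oCY CY0 cYP kYM HRY.
have [G [mG GE dG]] := generic_lift X_irr rY rX trYX trNYX clX oCX CX0 cXP kXM HRX.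
have [EX [gEX injX]] := generic_lift_inj X_irr oCX CX0 cXP HRX.
have [EY [gEY injY]] := generic_lift_inj Y_irr oCY CY0 cYP HRY.
(* theta_X takes the same value at G (F x) and x, namely theta_Y (F x), and is generically
   injective. *)
have GF : generically (fun x => G (F x) = x).
  have := generically_and (generically_and gEX (dF _ (dG _ gEX)))
    (generically_and FE (dF _ GE)).
  by apply: generically1 => x [[Ex Egf] [E1 E2]]; apply: injX => //; rewrite E2 E1.
have FG : generically (fun y => F (G y) = y).
  have := generically_and (generically_and gEY (dG _ (dF _ gEY)))
    (generically_and GE (dG _ FE)).
  by apply: generically1 => y [[Ey Efg] [E1 E2]]; apply: injY => //; rewrite E2 E1.
exists F; split; first exact: birational_of_generic_inverse mF mG dF dG GF FG.
(* F (p x) and p (F x) have the same image under theta_Y, obtained from theta_X(x) by [act_rows]. *)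
move=> p; have EX' := kn_mx_P_act sE p phi_sigma; have EY' := kn_mx_P_act sE p psi_sigma.
have := generically_and (generically_and
    (generically_act p (dF _ gEY)) (dF _ (generically_act p gEY)))
  (generically_and (generically_and FE (generically_act p FE)) (generically_and EX' (dF _ EY'))).
apply: generically1 => x [[E1 E2] [[E3 E4] [E5 E6]]].
by apply: injY => //; rewrite E4 E5 E6 E3.
Qed.
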